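(* For every $K\ge1$ there exist constants $C_i,C_i'>0$ ($i=1,2,\dots$) depending only on $K$ such that the following holds. Let $d\ge2$, let $\boldsymbol{\mathcal X}\in\mathbb{R}^{n_1\times\cdots\times n_d}$ be a tensor, let $(r_1,\dots,r_d)$ with $1\le r_i\le n_i$ be the target rank, let $p$ be an oversampling parameter, and set $\ell_i=r_i+p$ for $1\le i\le d$. Let $\hat{\boldsymbol{\mathcal X}}$ be the approximation of $\boldsymbol{\mathcal X}$ generated by the algorithm RSTHOSVD-KRP (described in the context). If $0<\delta\le\min\{1,2de^{-2}\}$ and $\ell_i\ge C_i^d\ln^d(2d\cdot9^{r_i}/\delta)$ for $1\le i\le d$, then with probability at least $1-\delta$, $$\|\boldsymbol{\mathcal X}-\hat{\boldsymbol{\mathcal X}}\|_F^2\le\sum_{i=1}^d\bigl(1+2(1+\Gamma_i)\bigr)\sum_{j=r_i+1}^{n_i}\sigma_j^2(\boldsymbol X_{(i)}),$$ where $$\Gamma_i=(C_i')^d\max\left\{\frac{\ln^{1/2}(2d/\delta)}{\ell_i^{1/2}},\frac{\ln^d(2d/\delta)}{\ell_i}\right\},\qquad 1\le i\le d.$$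
   Context: Notation. $\boldsymbol X_{(i)}\in\mathbb{R}^{n_i\times\prod_{j\ne i}n_j}$ is the mode-$i$ unfolding of $\boldsymbol{\mathcal X}$ (its columns are the mode-$i$ fibers, ordered compatibly with the Kronecker ordering below, i.e. lower modes vary fastest). $\sigma_j(\cdot)$ is the $j$-th largest singular value, taken to be $0$ if $j$ exceeds the number of singular values. The mode-$i$ product $\boldsymbol{\mathcal Y}=\boldsymbol{\mathcal X}\times_i\boldsymbol A$ is defined by $\boldsymbol Y_{(i)}=\boldsymbol A\boldsymbol X_{(i)}$. $\|\boldsymbol{\mathcal X}\|_F$ is the square root of the sum of squares of the entries. The Khatri-Rao product $\odot$ is the columnwise Kronecker product: the $k$-th column of $\boldsymbol A\odot\boldsymbol B$ is $\boldsymbol a_k\otimes\boldsymbol b_k$. The sub-Gaussian norm of a random variable $X$ is $\|X\|_{\Psi_2}=\inf\{t>0:\mathbb{E}\exp(|X|^2/t^2)\le2\}$. In a thin QR factorization $\boldsymbol Y=\boldsymbol Q\boldsymbol R$ of $\boldsymbol Y\in\mathbb{R}^{a\times b}$, $\boldsymbol Q$ has $\min\{a,b\}$ orthonormal columns, and its range contains the range of $\boldsymbol Y$. Algorithm RSTHOSVD-KRP. Set $\boldsymbol{\mathcal G}^{(0)}=\boldsymbol{\mathcal X}$. For $i=1,\dots,d$: draw $d-1$ independent random matrices $\boldsymbol\Omega^{(j)}$, $j\ne i$, independent of everything drawn at earlier steps, with $\ell_i$ columns and with number of rows equal to the current size of mode $j$ of $\boldsymbol{\mathcal G}^{(i-1)}$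 (that is, $n_j$ rows for $j>i$, and for $j<i$ as many rows as $\boldsymbol Q_j$ has columns, namely $\ell_j$ when $\ell_j\le n_j$), whose entries are independent, mean zero, unit variance sub-Gaussian random variables of sub-Gaussian norm at most $K$; compute $$\boldsymbol Y_{(i)}=\boldsymbol G^{(i-1)}_{(i)}\bigl(\boldsymbol\Omega^{(d)}\odot\cdots\odot\boldsymbol\Omega^{(i+1)}\odot\boldsymbol\Omega^{(i-1)}\odot\cdots\odot\boldsymbol\Omega^{(1)}\bigr),$$ where $\boldsymbol G^{(i-1)}_{(i)}$ is the mode-$i$ unfolding of $\boldsymbol{\mathcal G}^{(i-1)}$; compute a thin QR factorization $\boldsymbol Y_{(i)}=\boldsymbol Q_i\boldsymbol R_i$; update $\boldsymbol{\mathcal G}^{(i)}=\boldsymbol{\mathcal G}^{(i-1)}\times_i\boldsymbol Q_i^\top$. Output $\hat{\boldsymbol{\mathcal X}}=\boldsymbol{\mathcal G}^{(d)}\times_1\boldsymbol Q_1\times_2\cdots\times_d\boldsymbol Q_d$. *)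

(* Defs.v *)
From mathcomp Require Import all_boot all_order all_algebra.
From mathcomp Require Import all_classical all_reals all_analysis.
From mathcomp Require Import mxtens polyrcf.

Set Implicit Arguments.
Unset Strict Implicit.
Unset Printing Implicit Defensive.

Import Order.TTheory GRing.Theory Num.Theory.
Import numFieldNormedType.Exports.

Local Open Scope classical_set_scope.
Local Open Scope ring_scope.

(* Modes are numbered from 0, i.e. they are the elements of 'I_d. *)

Section Tensor.
Variable d : nat.
Implicit Types (n m : 'I_d -> nat) (i j : 'I_d) (s : seq 'I_d).

Definition midx n := {dffun forall j, 'I_(n j)}.

(* The modes other than i, in increasing order. *)
Definition others i : seq 'I_d := [seq j <- enum 'I_d | j != i].

(* [kdim m s] is the product of the m j for j in s, associated as in the
   iterated Kronecker product whose rightmost factor is the head of s. *)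
Fixpoint kdim m s : nat :=
  if s is j :: s' then (kdim m s' * m j)%N else 1%N.

(* Rank of a multi-index, restricted to the modes in s, in the order where the
   head of s varies fastest: mxtens_index (a, b) is a * (range of b) + b. *)
Fixpoint kcode n s (x : midx n) : 'I_(kdim n s) :=
  if s is j :: s' then mxtens_index (kcode s' x, x j) else ord0.

Lemma kdim_eq n m s : {in s, n =1 m} -> kdim n s = kdim m s.
Proof.
elim: s => //= j s ih e; rewrite e ?mem_head// ih// => k ks.
by apply: e; rewrite inE ks orbT.
Qed.

Lemma kcode_inj n s (x y : midx n) : kcode s x = kcode s y ->
  forall j, j \in s -> x j = y j.
Proof.
elim: s => //= j s ih /(can_inj (@mxtens_indexK _ _))[/ih exy xyj] k.
by rewrite inE => /predU1P[->//|/exy].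
Qed.

Variable R : realType.

Definition tensor n := {ffun midx n -> R}.

Definition fnorm n (X : tensor n) : R := Num.sqrt (\sum_x X x ^+ 2).

(* The sum has exactly one term, see unfoldE. *)
Definition unfold n i (X : tensor n) : 'M[R]_(n i, kdim n (others i)) :=
  \matrix_(a, k) \sum_(x : midx n | (x i == a) && (kcode (others i) x == k)) X x.

Definition fold n i (M : 'M[R]_(n i, kdim n (others i))) : tensor n :=
  [ffun x : midx n => M (x i) (kcode (others i) x)].

Lemma unfoldE n i (X : tensor n) (x : midx n) :
  unfold i X (x i) (kcode (others i) x) = X x.
Proof.
rewrite mxE (big_pred1 x)// => y; apply/andP/eqP => [[/eqP yxi /eqP yx]|->//].
apply/ffunP => j; have [->//|ji] := eqVneq j i.
by apply: (kcode_inj yx); rewrite mem_filter ji mem_enum.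
Qed.

Lemma unfoldK n i : cancel (@unfold n i) (@fold n i).
Proof. by move=> X; apply/ffunP => x; rewrite ffunE unfoldE. Qed.

(* The mode-i product: the tensor Y of shape m such that Y_(i) = A X_(i), where
   the shapes n of X and m of Y agree except at mode i. *)
Definition modeprod n m i (nm : {in others i, n =1 m})
    (A : 'M[R]_(m i, n i)) (X : tensor n) : tensor m :=
  fold (castmx (erefl, kdim_eq nm) (A *m unfold i X)).

Definition krp p q l (A : 'M[R]_(p, l)) (B : 'M[R]_(q, l)) : 'M[R]_(p * q, l) :=
  \matrix_(k, c) (col c A *t col c B : 'cV_(p * q)) k 0.

(* For s = [:: j_1; ..; j_k] with k > 0 this is W j_k (.) .. (.) W j_1: the row
   of ones is neutral for the Khatri-Rao product. *)
Fixpoint krps m l (W : forall j, 'M[R]_(m j, l)) s : 'M[R]_(kdim m s, l) :=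
  if s is j :: s' then krp (krps W s') (W j) else const_mx 1.

End Tensor.

Section SingularValues.
Variable R : rcfType.

(* Eigenvalues in R, repeated according to their algebraic multiplicity, in
   nonincreasing order. *)
Definition eigvals n (M : 'M[R]_n) : seq R :=
  flatten [seq nseq (mup x (char_poly M)) x | x <- rev (rootsR (char_poly M))].

(* The j-th largest singular value, for j >= 1. *)
Definition singular_value p q (A : 'M[R]_(p, q)) (j : nat) : R :=
  nth 0 [seq Num.sqrt x | x <- eigvals (A^T *m A)] j.-1.

Definition thin_qr a b q (Y : 'M[R]_(a, b)) (Q : 'M[R]_(a, q)) (T : 'M[R]_(q, b))
  : Prop :=
  [/\ q = minn a b, Q^T *m Q = 1%:M, is_trig_mx T^T & Y = Q *m T].

End SingularValues.

Section Algorithm.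
Variables (R : realType) (d : nat) (n ell : 'I_d -> nat).

(* Shape of the core tensor after k steps. *)
Definition stage (k : nat) (j : 'I_d) : nat :=
  if (j < k)%N then minn (n j) (ell j) else n j.

Lemma stageS (i : 'I_d) : {in others i, stage i =1 stage i.+1}.
Proof.
move=> j; rewrite mem_filter => /andP[ji _].
by rewrite /stage ltnS [RHS]/= (leq_eqVlt j) (negPf (ji : val j != val i)).
Qed.

Lemma stageSV (i : 'I_d) : {in others i, stage i.+1 =1 stage i}.
Proof. by move=> j /stageS. Qed.

(* stage i i = n i and stage i.+1 i = minn (n i) (ell i). *)
Definition factors := forall i : 'I_d, 'M[R]_(stage i i, stage i.+1 i).

Fixpoint core (X : tensor R n) (Q : factors) (k : nat) :
    (k <= d)%N -> tensor R (stage k) :=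
  match k with
  | 0 => fun _ => X
  | k'.+1 => fun lt_k' => modeprod (stageS (i := Ordinal lt_k'))
               (Q (Ordinal lt_k'))^T (core X Q (ltnW lt_k'))
  end.

(* [lift_core Q G] is G x_k Q_k .. x_1 Q_1 for G of shape [stage k]; products
   along distinct modes commute, and multiplying in this order takes the shapes
   back through [stage k], .., [stage 0]. *)
Fixpoint lift_core (Q : factors) (k : nat) :
    (k <= d)%N -> tensor R (stage k) -> tensor R n :=
  match k with
  | 0 => fun _ G => G
  | k'.+1 => fun lt_k' G => lift_core Q (ltnW lt_k')
               (modeprod (stageSV (i := Ordinal lt_k')) (Q (Ordinal lt_k')) G)
  end.

Definition sthosvd_approx (X : tensor R n) (Q : factors) : tensor R n :=
  lift_core Q (leqnn d) (core X Q (leqnn d)).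

Definition sketch (X : tensor R n) (Q : factors) (i : 'I_d)
    (W : forall j, 'M[R]_(stage i j, ell i)) : 'M[R]_(stage i i, ell i) :=
  unfold i (core X Q (ltnW (ltn_ord i))) *m krps W (others i).

End Algorithm.

Section Probability.
Local Open Scope ereal_scope.
Context (R : realType) (dd : measure_display) (T : measurableType dd).
Variable P : probability T R.

Definition subgaussian_norm (X : T -> R) : \bar R :=
  ereal_inf [set t%:E | t in
    [set t : R | (0 < t)%R /\ 'E_P[fun w => expR (`|X w| ^+ 2 / t ^+ 2)] <= 2%:E]].

Definition mutually_independent (I : finType) (D : {set I}) (X : I -> T -> R) :=
  forall J : {set I}, J \subset D ->
  forall B : I -> set R, (forall i, measurable (B i)) ->
    P (\bigcap_(i in [set` J]) X i @^-1` B i) = \prod_(i in J) P (X i @^-1` B i).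

Variables (d : nat) (n ell : 'I_d -> nat).

(* [draws] collects the entries of all random matrices: [omega i j a c] is the
   entry (a, c) of the matrix drawn at step i for mode j. Only those with
   j != i are drawn; the others are never used. *)
Definition draws := forall i j : 'I_d,
  'I_(stage n ell i j) -> 'I_(ell i) -> {RV P >-> R}.

Definition draw_mx (omega : draws) (i j : 'I_d) (w : T) :
    'M[R]_(stage n ell i j, ell i) := \matrix_(a, c) omega i j a c w.

Definition entry : finType :=
  {ij : 'I_d * 'I_d & ('I_(stage n ell ij.1 ij.2) * 'I_(ell ij.1))%type}.

Definition draw (omega : draws) (e : entry) : T -> R :=
  omega (tag e).1 (tag e).2 (tagged e).1 (tagged e).2.

Definition drawn : {set entry} := [set e : entry | (tag e).2 != (tag e).1]%SET.

(* The sigma-algebra generated by the draws of steps up to and including i. *)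
Definition sigma_draws (omega : draws) (i : 'I_d) : set (set T) :=
  <<s [set A | exists e, [/\ e \in drawn, ((tag e).1 <= i)%N
                  & exists2 B, measurable B & A = draw omega e @^-1` B]] >>.

(* A run of the algorithm on X. A thin QR factorization need not be unique; any
   one may be used at step i provided it is computed (measurably) from what has
   been drawn so far. *)
Record rsthosvd_krp (K : R) (X : tensor R n) (omega : draws)
    (Q : forall i : 'I_d, T -> 'M[R]_(stage n ell i i, stage n ell i.+1 i)) : Prop := {
  draws_indep : mutually_independent drawn (draw omega);
  draws_mean : forall e, e \in drawn -> 'E_P[draw omega e] = 0;
  draws_var : forall e, e \in drawn -> 'V_P[draw omega e] = 1;
  draws_subgaussian :
    forall e, e \in drawn -> subgaussian_norm (draw omega e) <= K%:E;
  factors_qr : forall i w, exists S,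
    thin_qr (sketch X (fun k => Q k w) (fun j => draw_mx omega i j w)) (Q i w) S;
  factors_meas : forall i a b (B : set R), measurable B ->
    sigma_draws omega i ((fun w => Q i w a b) @^-1` B) }.

End Probability.

(* Main.v *)
(** The approximation error telescopes: the lifting is an isometry adjoint to the
    compression, so it equals the sum over the steps of |U|^2 - |Q^T U|^2, where U is the
    unfolding of the current core.  As U is the unfolding of X times a contraction, it is
    within sum_(j > r) sigma_j^2 of a matrix of rank at most r, and U - U Om Z bounds the
    step error for every Z.  With V an orthonormal basis of the row space of the low-rank
    part and Z = (V Om)^+ V, it remains to show that V Om is well conditioned and that Om
    does not inflate the residual.

    Both concern sums of independent terms |B x|^2 over the columns x of Om.  Integrating
    one Kronecker factor at a time gives E |B x|^(2p) <= (c p)^(k p) |B|^(2p) for k factors.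
    The upper tail follows by truncation and Chernoff's bound; the lower tail of a sum of
    nonnegative variables is sub-Gaussian, so strong that a grid of exp(O(r^2)) points can
    replace an optimal net.  Finally, the draws of a step are decoupled from the past by
    Tonelli's theorem on the product of the two sub-sigma-algebras. *)

Require Import Defs.
From HB Require Import structures.
From mathcomp Require Import all_boot all_order all_algebra.
From mathcomp Require Import all_classical all_reals all_analysis.
From mathcomp Require Import complex mxtens polyrcf.
From mathcomp Require Import measurable_realfun ring lra.

Set Implicit Arguments.
Unset Strict Implicit.
Unset Printing Implicit Defensive.

Import Order.TTheory GRing.Theory Num.Theory.
Import numFieldNormedType.Exports.

Local Open Scope classical_set_scope.
Local Open Scope ring_scope.

(** * Frobenius norm and singular values *)

Section Frobenius.
Variable R : rcfType.

(** Two obstacles shape the probabilistic half. An entry of a column x of Om is a product of d - 1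
    draws, so |B x|^2 has in general no exponential moments, only polynomial ones growing like p^(k
    p). This forces truncation in the upper tail and produces the term L^d / l beside sqrt (L / l)
    in the deviation, where L = ln (2 d / delta). Moreover the matrix sketched at step i depends on
    the earlier draws, so each tail bound is proved for a fixed matrix and a threshold depending on
    X only, and is then integrated over the past.

    The factor 1 + 2 (1 + Gamma) is deterministic: 1 is the residual itself, 2 comes from the lower
    bound l / 2 for |u V Om|^2 on unit vectors u, and 1 + Gamma is the inflation of the residual by
    Om.

    The constants are C' = C1 = 9 e c0, where c0 = 72 e K^2 comes from the moments of linear forms,
    and C = C1^2, which makes Gamma at most 1. The logarithm in the size condition is at least L +
    r, and since d >= 2 its d-th power dominates the r^2 of the grid. *)

Definition sqn p q (A : 'M[R]_(p, q)) : R := \sum_i \sum_j A i j ^+ 2.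

Lemma sqn_ge0 p q (A : 'M[R]_(p, q)) : 0 <= sqn A.
Proof. by apply: sumr_ge0 => i _; apply: sumr_ge0 => j _; exact: sqr_ge0. Qed.

Lemma sqn_trl p q (A : 'M[R]_(p, q)) : sqn A = \tr (A *m A^T).
Proof.
apply: eq_bigr => i _; rewrite mxE; apply: eq_bigr => j _.
by rewrite !mxE.
Qed.

Lemma sqn_tr p q (A : 'M[R]_(p, q)) : sqn A = \tr (A^T *m A).
Proof. by rewrite sqn_trl mxtrace_mulC. Qed.

Lemma sqn_eq0 p q (A : 'M[R]_(p, q)) : sqn A = 0 -> A = 0.
Proof.
move=> /psumr_eq0P A0; apply/matrixP => i j; rewrite mxE.
have /psumr_eq0P Ai : \sum_j A i j ^+ 2 = 0.
  by apply: A0 => // k _; apply: sumr_ge0 => l _; exact: sqr_ge0.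
by apply/eqP; rewrite -sqrf_eq0; apply/eqP/Ai => // l _; exact: sqr_ge0.
Qed.

Lemma sqn0 p q : sqn (0 : 'M[R]_(p, q)) = 0.
Proof. by rewrite sqn_tr mulmx0 mxtrace0. Qed.

Lemma sqn_row q (v : 'rV[R]_q) : v *m v^T = (sqn v)%:M.
Proof. by rewrite sqn_trl trace_mx11 -mx11_scalar. Qed.

Lemma sqnT p q (A : 'M[R]_(p, q)) : sqn A^T = sqn A.
Proof. by rewrite sqn_trl trmxK -sqn_tr. Qed.

Lemma sqnN p q (A : 'M[R]_(p, q)) : sqn (- A) = sqn A.
Proof. by apply: eq_bigr => i _; apply: eq_bigr => j _; rewrite mxE sqrrN. Qed.

Lemma sqnB_proj p q r (Q : 'M[R]_(p, r)) (A : 'M[R]_(p, q)) : Q^T *m Q = 1%:M ->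
  sqn (A - Q *m (Q^T *m A)) = sqn A - sqn (Q^T *m A).
Proof.
move=> QQ; rewrite !sqn_tr; set P := Q *m (Q^T *m A).
have -> : (A - P)^T = A^T - P^T by rewrite linearB.
have PP : P^T *m P = (Q^T *m A)^T *m (Q^T *m A).
  by rewrite /P trmx_mul !mulmxA -[_ *m Q^T *m Q]mulmxA QQ mulmx1.
have AP : A^T *m P = (Q^T *m A)^T *m (Q^T *m A) by rewrite trmx_mul trmxK /P mulmxA.
have PA : P^T *m A = (Q^T *m A)^T *m (Q^T *m A).
  by rewrite /P !trmx_mul trmxK -!mulmxA.
by rewrite mulmxBl !mulmxBr PP AP PA subrr subr0 raddfB.
Qed.

Lemma sqn_projr p q r (V : 'M[R]_(r, q)) (A : 'M[R]_(p, q)) : V *m V^T = 1%:M ->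
  sqn (A - A *m V^T *m V) = sqn A - sqn (A *m V^T).
Proof.
move=> VV; have := @sqnB_proj _ _ _ V^T A^T; rewrite trmxK => /(_ VV).
have -> : A^T - V^T *m (V *m A^T) = (A - A *m V^T *m V)^T.
  by rewrite linearB/= !trmx_mul trmxK.
have -> : V *m A^T = (A *m V^T)^T by rewrite trmx_mul trmxK.
by rewrite !sqnT.
Qed.

(** [A *m Om *m Z] lies in the range of [Q], where the complementary projection vanishes, so [A] and
    [A - A *m Om *m Z] have the same projected residual, and projecting does not increase the norm.
    [Z] is absent from the left side and can be chosen freely. *)
Lemma range_finder_error p q r l (A : 'M[R]_(p, q)) (Om : 'M[R]_(q, l))
    (Q : 'M[R]_(p, r)) (S : 'M[R]_(r, l)) (Z : 'M[R]_(l, q)) :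
  Q^T *m Q = 1%:M -> A *m Om = Q *m S ->
  sqn A - sqn (Q^T *m A) <= sqn (A - A *m Om *m Z).
Proof.
move=> QQ AO; rewrite -sqnB_proj// AO; set B := A - Q *m S *m Z.
have -> : A - Q *m (Q^T *m A) = B - Q *m (Q^T *m B).
  rewrite /B !mulmxBr !mulmxA -[Q *m Q^T *m Q]mulmxA QQ mulmx1.
  by rewrite opprB addrA subrK.
by rewrite sqnB_proj// lerBlDr lerDl sqn_ge0.
Qed.

End Frobenius.

(** * Eigenvalues of Gram matrices, and low-rank approximation by deflation *)

Section Eigen.
Variable R : rcfType.

Let ReM (a b : R[i]) :
  complex.Re (a * b) = complex.Re a * complex.Re b - complex.Im a * complex.Im b.
Proof. by case: a b => a a' [b b']. Qed.

Let ImM (a b : R[i]) :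
  complex.Im (a * b) = complex.Re a * complex.Im b + complex.Im a * complex.Re b.
Proof. by case: a b => a a' [b b']. Qed.

(** Split a complex eigenvector into real and imaginary parts [u] and [w]. By symmetry
    [(u *m M) *m w^T] equals [u *m (w *m M)^T], which leaves Im z (|u|^2 + |w|^2) = 0 with a
    positive second factor. *)
Lemma char_root_real n (M : 'M[R]_n) (z : R[i]) : M^T = M ->
  root (char_poly (map_mx (real_complex R) M)) z -> complex.Im z = 0.
Proof.
move=> Msym; rewrite -eigenvalue_root_char => /eigenvalueP[x xM x0].
pose u : 'rV[R]_n := map_mx (@complex.Re R) x; pose w : 'rV[R]_n := map_mx (@complex.Im R) x.
have uM : u *m M = complex.Re z *: u - complex.Im z *: w.
  apply/rowP => j; have /rowP/(_ j) := xM; rewrite !mxE => /(congr1 (@complex.Re R)).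
  rewrite raddf_sum ReM => <-; apply: eq_bigr => k _.
  by rewrite !mxE /=; case: (x 0 k) => c e /=; rewrite mulr0 subr0.
have wM : w *m M = complex.Im z *: u + complex.Re z *: w.
  apply/rowP => j; have /rowP/(_ j) := xM; rewrite !mxE => /(congr1 (@complex.Im R)).
  rewrite raddf_sum ImM addrC => <-; apply: eq_bigr => k _.
  by rewrite !mxE /=; case: (x 0 k) => c e /=; rewrite mulr0 add0r.
have : (u *m M) *m w^T = u *m (w *m M)^T by rewrite trmx_mul Msym mulmxA.
rewrite uM wM mulmxBl -!scalemxAl linearD/= !linearZ/= mulmxDr -!scalemxAr !sqn_row.
move/matrixP/(_ 0 0); rewrite !mxE /= mulr1n => H.
have {H} : complex.Im z * (sqn u + sqn w) = 0 by move: H; rewrite !mulr1n; lra.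
move/eqP; rewrite mulf_eq0 => /orP[/eqP//|].
rewrite paddr_eq0 ?sqn_ge0// => /andP[/eqP/sqn_eq0 u0 /eqP/sqn_eq0 w0].
case/negP: x0; apply/eqP/rowP => j; rewrite mxE.
have /rowP/(_ j) := u0; have /rowP/(_ j) := w0; rewrite !mxE.
by case: (x 0 j) => a b /= -> ->.
Qed.

Lemma char_poly_split n (M : 'M[R]_n) : M^T = M ->
  {s : seq R | char_poly M = \prod_(x <- s) ('X - x%:P)}.
Proof.
move=> Msym; pose toC := real_complex R.
have [r Dp] := closed_field_poly_normal (char_poly (map_mx toC M)).
move: Dp; rewrite (monicP (char_poly_monic _)) scale1r => Dp.
exists [seq complex.Re z | z <- r]; apply: (map_poly_inj toC).
rewrite map_char_poly -/toC Dp big_map map_prod_XsubC big_seq [RHS]big_seq.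
apply: eq_bigr => z zr; congr ('X - _%:P).
have : complex.Im z = 0.
  by apply: (char_root_real Msym); rewrite -/toC Dp root_prod_XsubC.
by case: z {zr} => a b /= ->.
Qed.

(** Lets any splitting of the characteristic polynomial stand for [eigvals], whose definition by
    roots and multiplicities is awkward to compute with. *)
Lemma eigvals_perm n (M : 'M[R]_n) (s : seq R) :
  char_poly M = \prod_(x <- s) ('X - x%:P) -> perm_eq (eigvals M) s.
Proof.
move=> Ms; have M0 : char_poly M != 0 by rewrite monic_neq0// char_poly_monic.
apply/allP => x _ /=; rewrite /eigvals Ms; set P := \prod_(y <- s) _.
rewrite count_flatten -!map_comp.
have -> : [seq (count_mem x \o (fun x => nseq (mup x P) x)) i | i <- rev (rootsR P)] =
   [seq (if i == x then count_mem x s else 0)%N | i <- rev (rootsR P)].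
  apply: eq_map => y /=; rewrite count_nseq /= mu_prod_XsubC.
  by case: eqP => [->|]; rewrite ?mul1n ?mul0n.
rewrite sumnE big_map -big_mkcond/= big_const_seq iter_addn_0.
have -> : count (eq_op^~ x) (rev (rootsR P)) = (x \in rev (rootsR P)).
  by apply: count_uniq_mem; rewrite rev_uniq uniq_roots.
have [xr|xr] := boolP (x \in rev (rootsR P)); first by rewrite muln1.
rewrite muln0 eq_sym.
apply/eqP/count_memPn; apply: contra xr => xs.
rewrite mem_rev -(roots_on_rootsR _ x) ?inE ?root_prod_XsubC//.
by rewrite /P -Ms.
Qed.

Lemma sorted_flatten_nseq (f : R -> nat) (s : seq R) : sorted >=%R s ->
  sorted >=%R (flatten [seq nseq (f x) x | x <- s]).
Proof.
have getr : transitive (>=%R : rel R) by move=> y x z h1 h2; exact: le_trans h2 h1.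
rewrite !sorted_pairwise//; elim: s => //= x s ih /andP[xs ps].
rewrite pairwise_cat ih// andbT; apply/andP; split.
  apply/allrelP => a b /nseqP[-> _] /flattenP[_ /mapP[y ys ->] /nseqP[-> _]].
  exact: (allP xs).
elim: (f x) => //= n ->; rewrite andbT; apply/allP => y /nseqP[-> _].
exact: lexx.
Qed.

Lemma eigvals_sorted n (M : 'M[R]_n) : sorted >=%R (eigvals M).
Proof.
apply: sorted_flatten_nseq; rewrite rev_sorted.
apply: sub_sorted (sorted_roots _ _ _) => x y; exact: ltW.
Qed.

(** The matrix determinant lemma: a unipotent block matrix conjugates two block triangular matrices
    whose determinants are the two sides. *)
Lemma det1_rank1 (K : comNzRingType) n (u : 'cV[K]_n) (v : 'rV[K]_n) :
  \det (1%:M + u *m v) = 1 + (v *m u) 0 0.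
Proof.
have E : block_mx (1%:M + u *m v) u 0 (1%:M : 'M[K]_(1, 1)) *m block_mx 1%:M 0 (- v) 1%:M =
         block_mx 1%:M 0 (- v) 1%:M *m block_mx 1%:M u 0 (1%:M + v *m u).
  rewrite !mulmx_block !(mul1mx, mulmx1, mul0mx, mulmx0, addr0, add0r).
  by congr block_mx; rewrite ?mulmxN ?mulNmx ?addrK// addrC addrK.
have := congr1 determinant E; rewrite !det_mulmx !(det_ublock, det_lblock) !det1.
rewrite !(mul1r, mulr1) => ->; rewrite [_ + _]mx11_scalar det_scalar1.
by rewrite !mxE eqxx.
Qed.

(* With N = v^T v, both sides are determinants: the matrices
   ('X - M + l N) (1 + ('X - l - 1) N) and ('X - M) (1 + ('X - 1) N) are equal. *)
Lemma char_poly_deflate n (M : 'M[R]_n) (v : 'rV[R]_n) (l : R) : M^T = M ->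
  v *m M = l *: v -> v *m v^T = 1%:M ->
  char_poly (M - l *: (v^T *m v)) * ('X - l%:P) = char_poly M * 'X.
Proof.
move=> Msym vM vv; pose V := map_mx (@polyC R) v; pose U := map_mx (@polyC R) v^T.
have VU : V *m U = 1%:M by rewrite -map_mxM vv map_mx1.
have MU : map_mx (@polyC R) M *m U = l%:P *: U.
  have : M *m v^T = l *: v^T by rewrite -[M in LHS]Msym -trmx_mul vM linearZ.
  by move/(congr1 (map_mx (@polyC R))); rewrite map_mxM map_mxZ.
have detE (a : {poly R}) : \det (1%:M + (a - 1) *: (U *m V)) = a.
  by rewrite scalemxAl det1_rank1 -scalemxAr VU !mxE eqxx mulr1 subrKC.
rewrite -[X in _ * X = _]detE -[X in _ = _ * X]detE /char_poly -!det_mulmx.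
congr (\det _); rewrite /char_poly_mx map_mxB map_mxZ map_mxM -/U -/V.
set MP := map_mx _ M in MU *; set N := U *m V.
have NN : N *m N = N by rewrite /N mulmxA -[U *m V *m U]mulmxA VU mulmx1.
have MN : MP *m N = l%:P *: N by rewrite /N mulmxA MU scalemxAl.
rewrite !mulmxDr !mulmx1 -!scalemxAr.
have -> : ('X%:M - (MP - l%:P *: N)) *m N = 'X *: N.
  by rewrite !mulmxBl -scalemxAl NN MN subrr subr0 mul_scalar_mx.
have -> : ('X%:M - MP) *m N = ('X - l%:P) *: N.
  by rewrite mulmxBl MN mul_scalar_mx scalerBl.
by apply/matrixP => i j; rewrite !mxE; ring.
Qed.

Lemma eigvals_ge0 p q (A : 'M[R]_(p, q)) x : x \in eigvals (A^T *m A) -> 0 <= x.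
Proof.
have Msym : (A^T *m A)^T = A^T *m A by rewrite trmx_mul trmxK.
have [s Es] := char_poly_split Msym.
rewrite (perm_mem (eigvals_perm Es)) -root_prod_XsubC -Es -eigenvalue_root_char.
move=> /eigenvalueP[v vM v0].
have v_gt0 : 0 < sqn v.
  by rewrite lt_def sqn_ge0 andbT; apply: contra v0 => /eqP/sqn_eq0 ->.
rewrite -(pmulr_lge0 _ v_gt0).
have -> : x * sqn v = sqn (v *m A^T).
  rewrite !sqn_trl trmx_mul trmxK -mulmxA (mulmxA A^T) mulmxA vM.
  by rewrite -scalemxAl linearZ.
exact: sqn_ge0.
Qed.

Definition gram_eigval p q (A : 'M[R]_(p, q)) j := nth 0 (eigvals (A^T *m A)) j.

Lemma gram_eigval_ge0 p q (A : 'M[R]_(p, q)) j : 0 <= gram_eigval A j.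
Proof.
rewrite /gram_eigval; have [jl|jl] := ltnP j (size (eigvals (A^T *m A))).
  exact/(eigvals_ge0 (A := A))/mem_nth.
by rewrite nth_default.
Qed.

Lemma singular_value_sqr p q (A : 'M[R]_(p, q)) j :
  singular_value A j.+1 ^+ 2 = gram_eigval A j.
Proof.
rewrite /singular_value /=; have [jl|jl] := ltnP j (size (eigvals (A^T *m A))).
  by rewrite (nth_map 0)// sqr_sqrtr//; exact: gram_eigval_ge0.
by rewrite /gram_eigval !nth_default ?size_map// expr0n.
Qed.

(** [v] is a unit eigenvector of [A^T *m A] for the largest eigenvalue. Removing from the rows their
    component along [v] turns that eigenvalue into 0 and keeps the others, so the ordered list
    shifts by one place. *)
Lemma singular_deflation p q (A : 'M[R]_(p, q)) : A != 0 ->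
  exists v : 'rV[R]_q, [/\ v *m v^T = 1%:M,
    sqn (A - A *m v^T *m v) = sqn A - gram_eigval A 0,
    forall j, gram_eigval (A - A *m v^T *m v) j = gram_eigval A j.+1 &
    (\rank (A - A *m v^T *m v)%R < \rank A)%N].
Proof.
move=> A0; pose M := A^T *m A; have Msym : M^T = M by rewrite /M trmx_mul trmxK.
have [s Es] := char_poly_split Msym.
have perm_s := eigvals_perm Es.
(* The trace is the sum of the eigenvalues; being positive, it forces the list to be nonempty with a
   positive head. *)
have trM : \tr M = \sum_(x <- eigvals M) x.
  have q0 : (0 < q)%N.
    case: q A A0 @M Msym s Es perm_s => // A /eqP[]; exact: thinmx0.
  have ss : size s = q by have := size_char_poly M; rewrite Es size_prod_XsubC => -[].
  have s0 : size s != 0%N by rewrite ss -lt0n.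
  have := coefPn_prod_XsubC s0; rewrite ss.
  rewrite -Es char_poly_trace// => /oppr_inj ->.
  by rewrite (perm_big _ perm_s).
have trM0 : 0 < \tr M.
  rewrite -sqn_tr lt_def sqn_ge0 andbT; apply: contra A0 => /eqP/sqn_eq0 ->//.
case Ee : (eigvals M) => [|l e]; first by rewrite trM Ee big_nil ltxx in trM0.
have lam0 : gram_eigval A 0 = l by rewrite /gram_eigval -/M Ee.
have sorted_e := eigvals_sorted M; rewrite Ee in sorted_e.
have getr : transitive (>=%R : rel R) by move=> y x z h1 h2; exact: le_trans h2 h1.
have l_max x : x \in e -> x <= l.
  by move=> xe; move: sorted_e; rewrite /= path_sortedE// => /andP[/allP/(_ x xe)].
have l0 : 0 < l.
  rewrite lt_def -lam0 gram_eigval_ge0 andbT lam0; apply: contraTneq trM0 => l_eq0.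
  rewrite -leNgt trM Ee big_cons l_eq0 add0r big_seq; apply: sumr_le0 => x xe.
  by rewrite -l_eq0 l_max.
have : root (char_poly M) l.
  by rewrite Es root_prod_XsubC -(perm_mem perm_s) Ee mem_head.
rewrite -eigenvalue_root_char => /eigenvalueP[u uM u0].
have u_gt0 : 0 < sqn u.
  by rewrite lt_def sqn_ge0 andbT; apply: contra u0 => /eqP/sqn_eq0 ->.
pose v := (Num.sqrt (sqn u))^-1 *: u.
have vM : v *m M = l *: v by rewrite -scalemxAl uM !scalerA mulrC.
have vv : v *m v^T = 1%:M.
  rewrite /v linearZ/= -scalemxAl -scalemxAr scalerA sqn_row scale_scalar_mx -invfM.
  by rewrite -expr2 sqr_sqrtr ?mulVf ?gt_eqF// ltW.
pose A' := A - A *m v^T *m v.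
have Mv : M *m v^T = l *: v^T by rewrite -[M in LHS]Msym -trmx_mul vM linearZ.
have M'E : A'^T *m A' = M - l *: (v^T *m v).
  have -> : A'^T = A^T - v^T *m (v *m A^T) by rewrite /A' linearB/= !trmx_mul trmxK.
  rewrite /A' mulmxBl !mulmxBr -/M.
  have -> : A^T *m (A *m v^T *m v) = l *: (v^T *m v).
    by rewrite !mulmxA -/M Mv -scalemxAl.
  have -> : v^T *m (v *m A^T) *m A = l *: (v^T *m v).
    by rewrite -!mulmxA -/M vM -scalemxAr.
  have -> : v^T *m (v *m A^T) *m (A *m v^T *m v) = l *: (v^T *m v).
    rewrite -!mulmxA (mulmxA A^T) -/M (mulmxA M) Mv -scalemxAl -scalemxAr -scalemxAr.
    by rewrite (mulmxA v) vv mul1mx.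
  by rewrite subrr subr0.
exists v; split => //.
- rewrite sqn_projr// lam0; congr (_ - _).
  rewrite -sqnT trmx_mul trmxK sqn_trl trmx_mul trmxK -mulmxA (mulmxA A^T) -/M.
  by rewrite mulmxA vM -scalemxAl vv linearZ/= mxtrace1 mulr1.
(* The new spectrum with [l] added is the old one with 0 added. The 0 comes last because all
   eigenvalues are nonnegative, and it agrees with the default value of [nth] beyond the old
   list. *)
- have pE := char_poly_deflate Msym vM vv; rewrite -M'E in pE.
  have M'sym : (A'^T *m A')^T = A'^T *m A' by rewrite trmx_mul trmxK.
  have [s' Es'] := char_poly_split M'sym.
  have perm_s' := eigvals_perm Es'.
  have perm_ss' : perm_eq (rcons s' l) (rcons s 0).
    by apply: prod_XsubC_eq; rewrite -!cats1 !big_cat !big_seq1 /= -Es -Es' subr0.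
  have P : perm_eq (eigvals (A'^T *m A')) (rcons e 0).
    apply: perm_trans perm_s' _; rewrite -(perm_cons l) -rcons_cons -Ee.
    rewrite -perm_rcons; apply: perm_trans perm_ss' _.
    by rewrite -!cats1 perm_cat2r perm_sym.
  have e0 x : x \in e -> 0 <= x.
    by move=> xe; apply: (eigvals_ge0 (A := A)); rewrite -/M Ee inE xe orbT.
  have sorted_e0 : sorted >=%R (rcons e 0).
    case: e {Ee l_max P} sorted_e e0 => //= x e /andP[_ xe] e0.
    rewrite rcons_path xe/=; apply: e0; rewrite inE.
    by have := mem_last x e; rewrite inE.
  have anti : antisymmetric (>=%R : rel R).
    by move=> x y /andP[h1 h2]; apply/eqP; rewrite eq_le; apply/andP; split; [exact: h2|exact: h1].
  move=> j; rewrite /gram_eigval (sorted_eq getr anti (eigvals_sorted _) sorted_e0 P) -/M Ee /=.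
  rewrite nth_rcons; case: ltnP => // je; rewrite [RHS]nth_default//.
  by case: eqP.
- rewrite -/A'.
  (* [v] lies in the row space of [A] but is orthogonal to the rows of the deflated matrix, so the
     rank drops. *)
  have vA : (v <= A)%MS.
    apply/submxP; exists (l^-1 *: (v *m A^T)).
    by rewrite -scalemxAl -mulmxA -/M vM scalerA mulVf ?scale1r// gt_eqF.
  have A'A : (A' <= A)%MS.
    rewrite addmx_sub// eqmx_opp (submx_trans (submxMl _ _))//.
  have cap : (A' :&: v = 0)%MS.
    apply/eqP/rowV0P => w; rewrite sub_capmx => /andP[/submxP[y wy] /sub_rVP[c wc]].
    have : w *m v^T = 0.
      by rewrite wy -mulmxA /A' mulmxBl -[A *m v^T *m v *m v^T]mulmxA vv mulmx1 subrr mulmx0.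
    rewrite wc -scalemxAl vv => /matrixP/(_ 0 0); rewrite !mxE eqxx mulr1 => ->.
    by rewrite scale0r.
  have v_neq0 : v != 0.
    by apply: contra_eqN vv => /eqP ->; rewrite mul0mx eq_sym oner_eq0.
  have : (\rank (A' + v)%MS <= \rank A)%N by apply: mxrankS; rewrite addsmx_sub A'A.
  by rewrite mxrank_disjoint_sum// (rank_rV v) v_neq0 addn1.
Qed.

(** Induction on the rank bound [m], deflating one direction at a time: the first [r] directions go
    into the factors, the others are paid for in the sum. *)
Lemma low_rank_approx m p q (A : 'M[R]_(p, q)) r : (\rank A <= m)%N -> (r <= m)%N ->
  exists k (H : 'M[R]_(p, k)) (F : 'M[R]_(k, q)),
    (k <= r)%N /\ sqn (A - H *m F) <= \sum_(r <= j < m) gram_eigval A j.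
Proof.
have triv (A1 : 'M[R]_(p, q)) r1 m1 : A1 = 0 ->
  exists k (H : 'M[R]_(p, k)) (F : 'M[R]_(k, q)),
    (k <= r1)%N /\ sqn (A1 - H *m F) <= \sum_(r1 <= j < m1) gram_eigval A1 j.
  move=> ->; exists 0%N, 0, 0; split => //; rewrite mul0mx subrr sqn0.
  by apply: sumr_ge0 => j _; exact: gram_eigval_ge0.
elim: m A r => [|m ih] A r.
  by rewrite leqn0 mxrank_eq0 => /eqP A0 _; exact: triv.
have [A0 _ _|A0] := eqVneq A 0; first exact: triv.
have [v [vv sqnA' lamA' rankA']] := singular_deflation A0 => rA rm.
set A' := A - _ in sqnA' lamA' rankA'.
have rA' : (\rank A' <= m)%N by rewrite -ltnS (leq_trans rankA').
have sumE r1 : \sum_(r1 <= j < m) gram_eigval A' j = \sum_(r1.+1 <= j < m.+1) gram_eigval A j.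
  by rewrite big_add1; apply: eq_bigr => j _.
case: r rm => [_|r rm].
  (* With no rank left to spend, deflation is still applied, now to bound [sqn A] itself by the sum
     of the eigenvalues. *)
  have [k [H [F [k0 bound]]]] := ih A' 0%N rA' (leq0n _).
  exists 0%N, 0, 0; split => //; rewrite mul0mx subr0 big_nat_recl//.
  under eq_bigr do rewrite -lamA'.
  move: k0 H F bound; rewrite leqn0 => /eqP -> H F.
  rewrite thinmx0 mul0mx subr0 sqnA'; lra.
have [k [H [F [kr bound]]]] := ih A' r rA' rm.
exists (1 + k)%N, (row_mx (A *m v^T) H), (col_mx v F); split => //.
by rewrite mul_row_col opprD addrA -sumE.
Qed.

End Eigen.

Lemma eckart_young (R : rcfType) p q (A : 'M[R]_(p, q)) r : (r <= p)%N ->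
  exists k (H : 'M[R]_(p, k)) (F : 'M[R]_(k, q)), (k <= r)%N /\
    sqn (A - H *m F) <= \sum_(r.+1 <= j < p.+1) singular_value A j ^+ 2.
Proof.
move=> rp; have [k [H [F [kr bound]]]] := low_rank_approx (rank_leq_row A) rp.
exists k, H, F; split => //; rewrite big_add1.
by under eq_bigr do rewrite singular_value_sqr.
Qed.

(** * Deterministic error bound for one sketch *)

Section SketchBound.
Variable R : rcfType.

Lemma sqnZ p q (a : R) (A : 'M[R]_(p, q)) : sqn (a *: A) = a ^+ 2 * sqn A.
Proof.
rewrite /sqn mulr_sumr; apply: eq_bigr => i _; rewrite mulr_sumr.
by apply: eq_bigr => j _; rewrite mxE exprMn.
Qed.

Lemma sqn_rows p q (A : 'M[R]_(p, q)) : sqn A = \sum_i sqn (row i A).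
Proof.
apply: eq_bigr => i _; rewrite /sqn big_ord1.
by apply: eq_bigr => j _; rewrite mxE.
Qed.

Lemma gram_schmidt k q (F : 'M[R]_(k, q)) : exists t (V : 'M[R]_(t, q)),
  [/\ (t <= k)%N, V *m V^T = 1%:M & F *m V^T *m V = F].
Proof.
elim: k F => [|k ih] F.
  by exists 0%N, 0; split => //; [rewrite [LHS]flatmx0 [RHS]flatmx0|rewrite [LHS]flatmx0 [RHS]flatmx0].
suff H (f : 'rV_q) (F' : 'M[R]_(k, q)) : exists t (V : 'M[R]_(t, q)),
    [/\ (t <= 1 + k)%N, V *m V^T = 1%:M &
      col_mx f F' *m V^T *m V = col_mx f F'].
  by rewrite -[F](vsubmxK (F : 'M[R]_(1 + k, q))); exact: H.
move: F => _.
have [t [V [tk VV FV]]] := ih F'.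
pose g := f - f *m V^T *m V.
have gV : g *m V^T = 0.
  by rewrite /g mulmxBl -[f *m V^T *m V *m V^T]mulmxA VV mulmx1 subrr.
have [g0|g0] := eqVneq g 0.
  exists t, V; split => //; first exact: leqW.
  rewrite !mul_col_mx FV; congr col_mx; apply/esym/eqP; rewrite -subr_eq0.
  exact/eqP.
have g_gt0 : 0 < sqn g.
  by rewrite lt_def sqn_ge0 andbT; apply: contra g0 => /eqP/sqn_eq0 ->.
pose v := (Num.sqrt (sqn g))^-1 *: g.
have vv : v *m v^T = 1%:M.
  rewrite /v linearZ/= -scalemxAl -scalemxAr scalerA sqn_row scale_scalar_mx -invfM.
  by rewrite -expr2 sqr_sqrtr ?mulVf ?gt_eqF// ltW.
have vV : v *m V^T = 0 by rewrite -scalemxAl gV scaler0.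
have Vv : V *m v^T = 0 by rewrite -[V]trmxK -trmx_mul vV trmx0.
have fv : f *m v^T *m v = g.
  have -> : f = g + f *m V^T *m V by rewrite subrK.
  rewrite mulmxDl -[f *m V^T *m V *m v^T]mulmxA Vv mulmx0 addr0.
  have gE : Num.sqrt (sqn g) *: v = g.
    by rewrite scalerA divff ?scale1r// sqrtr_eq0 -ltNge.
  transitivity (Num.sqrt (sqn g) *: v *m v^T *m v); first by rewrite gE.
  by rewrite -scalemxAl vv -scalemxAl mul1mx gE.
exists (1 + t)%N, (col_mx v V); split => //.
  by rewrite tr_col_mx mul_col_row vv vV Vv VV -scalar_mx_block.
have F'v : F' *m v^T = 0 by rewrite -FV -mulmxA Vv mulmx0.
rewrite tr_col_mx -mulmxA mul_row_col mulmxDr !mulmxA !mul_col_mx fv FV F'v mul0mx.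
by rewrite add_col_mx add0r subrK.
Qed.

(** For the pseudo-inverse [Wi = W^T *m invmx (W *m W^T)], the matrix [X *m Wi *m W] is the
    orthogonal projection of the rows of [X] onto the row space of [W], hence no longer than [X];
    the lower bound on [W], applied row by row, transfers this to [X *m Wi]. *)
Lemma pinv_bound p t l (W : 'M[R]_(t, l)) (c : R) : 0 < c ->
  (forall u : 'rV_t, c * sqn u <= sqn (u *m W)) ->
  exists Wi : 'M[R]_(l, t), W *m Wi = 1%:M /\
    forall X : 'M[R]_(p, l), c * sqn (X *m Wi) <= sqn X.
Proof.
move=> c0 Wc; pose S := W *m W^T.
have Ssym : S^T = S by rewrite /S trmx_mul trmxK.
have Su : S \in unitmx.
  rewrite -row_free_unit; apply: inj_row_free => u uS.
  apply: sqn_eq0; apply/eqP; rewrite eq_le sqn_ge0 andbT -(pmulr_rle0 _ c0).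
  apply: le_trans (Wc u) _; rewrite sqn_trl trmx_mul mulmxA -[u *m W *m _]mulmxA -/S uS.
  by rewrite mul0mx mxtrace0.
exists (W^T *m invmx S); split; first by rewrite mulmxA mulmxV.
move=> X; pose U := X *m (W^T *m invmx S).
have cU : c * sqn U <= sqn (U *m W).
  rewrite [sqn U]sqn_rows [sqn (U *m W)]sqn_rows mulr_sumr.
  by apply: ler_sum => i _; rewrite [row i (U *m W)]row_mul; exact: Wc.
apply: le_trans cU _.
have Pi : (U *m W) *m (U *m W)^T = X *m (U *m W)^T.
  have UWW : U *m W *m W^T = X *m W^T by rewrite -mulmxA -/S /U -!mulmxA mulVmx// mulmx1.
  by rewrite [(U *m W)^T]trmx_mul mulmxA UWW mulmxA.
have Pi' : (U *m W) *m X^T = (U *m W) *m (U *m W)^T.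
  move: (U *m W) Pi => Y Pi; apply: trmx_inj.
  by rewrite !trmx_mul !trmxK -Pi.
have := sqn_ge0 (X - U *m W); rewrite !sqn_trl.
have -> : (X - U *m W)^T = X^T - (U *m W)^T by rewrite linearB.
rewrite mulmxBl !mulmxBr Pi' -Pi subrr subr0 raddfB subr_ge0.
by [].
Qed.

(** Take [Z = Wi *m V] with [Wi] a right inverse of [V *m Om]: the part of [G] in the span of [V] is
    reproduced exactly. What remains is [G2 - Y *m V], whose two terms are orthogonal, and [sqn Y]
    is at most [2 * g * sqn G2], the 2 being due to the lower bound l / 2. *)
Lemma sketch_bound p q l t (G : 'M[R]_(p, q)) (V : 'M[R]_(t, q)) (Om : 'M[R]_(q, l))
    (tau g : R) : (0 < l)%N -> 0 <= g -> V *m V^T = 1%:M ->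
  sqn (G - G *m V^T *m V) <= tau ->
  (forall u : 'rV_t, l%:R / 2 * sqn u <= sqn (u *m V *m Om)) ->
  sqn ((G - G *m V^T *m V) *m Om) <= g * (l%:R * sqn (G - G *m V^T *m V)) ->
  exists Z : 'M[R]_(l, q), sqn (G - G *m Om *m Z) <= (1 + 2 * g) * tau.
Proof.
move=> l0 g0 VV; set G2 := G - _ => Gtau low up.
have l0' : 0 < l%:R :> R by rewrite ltr0n.
have c0 : 0 < l%:R / 2 :> R by rewrite divr_gt0.
have low' (u : 'rV_t) : l%:R / 2 * sqn u <= sqn (u *m (V *m Om)) by rewrite mulmxA; exact: low.
have [Wi [WWi Wib]] := pinv_bound p c0 low'.
exists (Wi *m V); set Y := G2 *m Om *m Wi.
have -> : G - G *m Om *m (Wi *m V) = G2 - Y *m V.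
  have GE : G = G2 + G *m V^T *m V by rewrite subrK.
  have E : G *m Om *m (Wi *m V) = Y *m V + G *m V^T *m V.
    have -> : G *m Om = G2 *m Om + (G *m V^T *m V) *m Om by rewrite -mulmxDl -GE.
    rewrite [LHS]mulmxDl; congr (_ + _); first by rewrite /Y mulmxA.
    by rewrite -!mulmxA (mulmxA Om) (mulmxA V) (mulmxA V) WWi mul1mx.
  by rewrite E /G2 opprD addrA addrAC.
have G2V : G2 *m V^T = 0.
  by rewrite /G2 mulmxBl -[G *m V^T *m V *m V^T]mulmxA VV mulmx1 subrr.
have -> : sqn (G2 - Y *m V) = sqn G2 + sqn Y.
  rewrite !sqn_trl.
  have -> : (G2 - Y *m V)^T = G2^T - V^T *m Y^T by rewrite linearB/= trmx_mul.
  rewrite mulmxBl !mulmxBr !mulmxA G2V mul0mx subr0.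
  rewrite -[Y *m V *m G2^T]mulmxA -[V *m G2^T]trmxK trmx_mul trmxK G2V trmx0 mulmx0 sub0r opprK.
  by rewrite -[Y *m V *m V^T]mulmxA VV mulmx1 raddfD.
have Yb : l%:R / 2 * sqn Y <= g * (l%:R * sqn G2) by exact: le_trans (Wib _) up.
have : sqn Y <= 2 * g * sqn G2.
  rewrite -(ler_pM2l c0); apply: le_trans Yb _.
  by rewrite le_eqVlt; apply/orP; left; apply/eqP; field.
have : 2 * g * sqn G2 <= 2 * g * tau by rewrite ler_wpM2l// mulr_ge0.
lra.
Qed.

Lemma cauchy_schwarz n (a b : 'I_n -> R) :
  (\sum_i a i * b i) ^+ 2 <= (\sum_i a i ^+ 2) * (\sum_i b i ^+ 2).
Proof.
set A := \sum_i a i ^+ 2; set B := \sum_i b i ^+ 2; set C := \sum_i a i * b i.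
have B0 : 0 <= B by apply: sumr_ge0 => i _; exact: sqr_ge0.
have [B_eq0|Bn0] := eqVneq B 0.
  have -> : C = 0.
    rewrite /C big1// => i _; have bi : b i ^+ 2 = 0.
      by apply: (psumr_eq0P _ B_eq0) => // k _; exact: sqr_ge0.
    by move/eqP: bi; rewrite sqrf_eq0 => /eqP ->; rewrite mulr0.
  by rewrite B_eq0 mulr0 expr0n.
have {}B0 : 0 < B by rewrite lt_def Bn0.
have : 0 <= \sum_i (B * a i - C * b i) ^+ 2 by apply: sumr_ge0 => i _; exact: sqr_ge0.
rewrite (_ : \sum_i _ = B * (A * B - C ^+ 2)); first by rewrite pmulr_rge0// subr_ge0.
under eq_bigr do rewrite sqrrB !exprMn.
rewrite big_split sumrB/= -!mulr_sumr -/A -/B.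
rewrite (_ : \sum_i (B * a i * (C * b i)) *+ 2 = 2 * B * C * (\sum_i a i * b i)); first by rewrite -/C; ring.
by rewrite mulr_sumr; apply: eq_bigr => i _; ring.
Qed.

Lemma sqn_mulmx p q l (A : 'M[R]_(p, q)) (B : 'M[R]_(q, l)) : sqn (A *m B) <= sqn A * sqn B.
Proof.
rewrite [sqn A]sqn_rows mulr_suml [sqn (A *m B)]sqn_rows; apply: ler_sum => i _.
rewrite {1 2}/sqn !big_ord1 -[sqn B]sqnT /sqn mulr_sumr; apply: ler_sum => j _.
rewrite !mxE; apply: le_trans (cauchy_schwarz _ _) _.
by rewrite le_eqVlt; apply/orP; left; apply/eqP; congr (_ * _); apply: eq_bigr => k _; rewrite !mxE.
Qed.

(** Young's inequality with weight 1/8, small enough to pass from the constant 3/4 on the grid to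
    1/2 everywhere. *)
Lemma sqnB_le p q (A B : 'M[R]_(p, q)) : sqn (A - B) <= 9 / 8 * sqn A + 9 * sqn B.
Proof.
rewrite /sqn !mulr_sumr -big_split; apply: ler_sum => i _ /=.
rewrite !mulr_sumr -big_split; apply: ler_sum => j _ /=; rewrite !mxE.
have := sqr_ge0 (A i j + 8 * B i j); nra.
Qed.

(** The grid of mesh 1/n in the cube [-1, 1]^t, coded by finite functions so that the union bound
    ranges over a finite type. *)
Definition grid_point t (n : nat) (f : {ffun 'I_t -> 'I_(2 * n).+1}) : 'rV[R]_t :=
  \row_k (((f k)%:R - n%:R) / n%:R).

End SketchBound.

(** * From a grid to all vectors *)

Section Net.
Variable R : realType.

Lemma grid_approx (n : nat) (x : R) : (0 < n)%N -> `|x| <= 1 ->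
  exists z : 'I_(2 * n).+1, (x - (z%:R - n%:R) / n%:R) ^+ 2 <= n%:R^-1 ^+ 2.
Proof.
move=> n0; rewrite ler_norml => /andP[x1 x2].
have n0' : 0 < n%:R :> R by rewrite ltr0n.
pose y := n%:R * x + n%:R.
have y0 : 0 <= y by rewrite /y; nra.
have /andP[t1 t2] := truncn_itv y0.
have zn : (Num.truncn y < (2 * n).+1)%N.
  rewrite ltnS -(ler_nat R); apply: le_trans t1 _; rewrite /y natrM; nra.
exists (Ordinal zn) => /=; set t := (Num.truncn y)%:R in t1 *.
rewrite -natr1 -/t in t2.
have -> : x - (t - n%:R) / n%:R = (y - t) * n%:R^-1.
  by rewrite /y; field; rewrite gt_eqF.
rewrite exprMn -[leRHS]mul1r ler_wpM2r ?sqr_ge0//.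
by rewrite expr_le1//; lra.
Qed.

(* The mesh 1 / (20 t) is fine enough for the crude bound on the norm of W to suffice. *)
Lemma grid_lower_bound t l (W : 'M[R]_(t, l)) : (0 < l)%N ->
  sqn W <= 2 * (l%:R * t%:R) ->
  (forall f, 3 / 4 * l%:R * sqn (grid_point R (n := (20 * t)%N) f) <= sqn (grid_point R f *m W)) ->
  forall u : 'rV_t, l%:R / 2 * sqn u <= sqn (u *m W).
Proof.
move=> l0 sW gW u; have l0' : 0 < l%:R :> R by rewrite ltr0n.
have [t0|t0] := posnP t.
  move: t0 W sW gW u => -> W _ _ u.
  by rewrite [u]thinmx0 sqn0 mulr0 sqn_ge0.
have t1 : 1 <= t%:R :> R by rewrite ler1n.
suff unit_case (y : 'rV_t) : sqn y = 1 -> l%:R / 2 <= sqn (y *m W).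
  have [su|su] := eqVneq (sqn u) 0; first by rewrite su mulr0 sqn_ge0.
  have su0 : 0 < sqn u by rewrite lt_def su sqn_ge0.
  have s2 : (Num.sqrt (sqn u))^-1 ^+ 2 = (sqn u)^-1 by rewrite exprVn sqr_sqrtr// ltW.
  have := unit_case ((Num.sqrt (sqn u))^-1 *: u).
  rewrite sqnZ s2 mulVf// => /(_ erefl); rewrite -scalemxAl sqnZ s2.
  by rewrite [leRHS]mulrC ler_pdivlMr.
move=> y1.
have yk k : `|y 0 k| <= 1.
  rewrite -(@ler_pXn2r _ 2)// ?nnegrE// expr1n real_normK ?num_real// -y1.
  rewrite /sqn big_ord1 (bigD1 k)//= lerDl; apply: sumr_ge0 => j _; exact: sqr_ge0.
pose n := (20 * t)%N; have n0 : (0 < n)%N by rewrite muln_gt0.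
have /choice[z zP] k := grid_approx n0 (yk k).
pose v := grid_point R [ffun k => z k]; pose e := y - v.
(* The error is kept multiplied by [t] because the bound on [sqn W] carries a factor [t]; the mesh
   gives t * t / (20 t)^2. *)
have se : t%:R * sqn e <= 400^-1.
  apply: (@le_trans _ _ (t%:R * \sum_(k < t) n%:R^-1 ^+ 2)).
    rewrite ler_wpM2l// /sqn big_ord1.
    by apply: ler_sum => k _; rewrite !mxE ffunE.
  rewrite sumr_const card_ord -[_ *+ t]mulr_natl /n natrM invfM exprMn.
  rewrite (_ : _ * _ = 20^-1 ^+ 2 * (t%:R / t%:R) ^+ 2); last by ring.
  by rewrite divff ?expr1n ?mulr1 ?pnatr_eq0 -?lt0n// exprVn -natrX.
have se1 : sqn e <= 400^-1 by apply: le_trans se; rewrite ler_peMl ?sqn_ge0.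
have seW : sqn (e *m W) <= l%:R * (2 * 400^-1).
  apply: le_trans (sqn_mulmx _ _) _; apply: le_trans (ler_wpM2l (sqn_ge0 e) sW) _.
  rewrite (_ : _ * _ = l%:R * (2 * (t%:R * sqn e))); last by ring.
  by rewrite ler_wpM2l// ler_wpM2l.
have vE : v = y - e by rewrite /e opprB addrCA subrr addr0.
have yE : y = v - (- e) by rewrite opprK vE subrK.
have b1 : sqn (v *m W) <= 9 / 8 * sqn (y *m W) + 9 * sqn (e *m W).
  by rewrite {1}vE mulmxBl; exact: sqnB_le.
have b2 : 1 <= 9 / 8 * sqn v + 9 * sqn e.
  by rewrite -{1}y1 {1}yE; apply: le_trans (sqnB_le _ _) _; rewrite sqnN.
(* 391/450 solves 9/8 x + 9/400 = 1. The conclusion then holds because 8/9 (3/4 * 391/450 - 9/200)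
   exceeds 1/2. *)
have {}b2 : 391 / 450 <= sqn v by move: b2 se1; move: (sqn v) (sqn e) => ? ?; lra.
have b3 := ler_wpM2l (mulr_ge0 (_ : 0 <= 3 / 4) (ltW l0')) b2.
have {}b3 : 3 / 4 * l%:R * (391 / 450) <= sqn (v *m W).
  by apply: le_trans (b3 _) (gW [ffun k => z k]); rewrite divr_ge0.
move: b1 seW b3; move: (sqn (v *m W)) (sqn (y *m W)) (sqn (e *m W)) (l%:R : R) l0'.
by move=> ? ? ? ? ? ? ? ?; lra.
Qed.

End Net.

(** * Tensor unfoldings *)

Section Unfolding.
Variables (R : realType) (d : nat).
Implicit Types (n m : 'I_d -> nat) (i j : 'I_d) (s : seq 'I_d).

Lemma kdim_prod n s : kdim n s = (\prod_(j <- s) n j)%N.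
Proof. by elim: s => [|j s ih]; rewrite ?big_nil// big_cons mulnC -ih. Qed.

Definition mode_split n i (x : midx n) : 'I_(n i) * 'I_(kdim n (others i)) :=
  (x i, kcode (others i) x).

Lemma mode_split_inj n i : injective (@mode_split n i).
Proof.
move=> x y [xyi xy]; apply/ffunP => j; have [->//|ji] := eqVneq j i.
by apply: (kcode_inj xy); rewrite mem_filter ji mem_enum.
Qed.

Lemma mode_split_bij n i : bijective (@mode_split n i).
Proof.
apply: inj_card_bij; first exact: mode_split_inj.
rewrite card_prod !card_ord kdim_prod /others big_filter big_enum_cond/=.
rewrite card_dep_ffun foldrE big_map -(bigD1 (P := predT) i)//= big_enum/=.
by rewrite [leqRHS](eq_bigr (fun j => n j)) // => j _; rewrite card_ord.
Qed.

Lemma mode_splitP n i (a : 'I_(n i)) (k : 'I_(kdim n (others i))) :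
  exists x : midx n, x i = a /\ kcode (others i) x = k.
Proof.
have [g _ gK] := mode_split_bij n i.
by exists (g (a, k)); have [] := gK (a, k).
Qed.

Lemma foldK n i : cancel (@fold d R n i) (@unfold d R n i).
Proof.
move=> M; apply/matrixP => a k; have [x [<- <-]] := mode_splitP a k.
by rewrite unfoldE ffunE.
Qed.

Definition ip n (X Y : tensor R n) : R := \sum_x X x * Y x.

Lemma ipE n i (X Y : tensor R n) : ip X Y = \tr ((unfold i X)^T *m unfold i Y).
Proof.
rewrite mxtrace_mulC; transitivity (\sum_(p : 'I_(n i) * 'I_(kdim n (others i)))
    unfold i X p.1 p.2 * unfold i Y p.1 p.2).
  rewrite (reindex (@mode_split n i)); last exact/onW_bij/mode_split_bij.
  by apply: eq_bigr => x _; rewrite !unfoldE.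
rewrite -(pair_bigA _ (fun a k => unfold i X a k * unfold i Y a k)).
apply: eq_bigr => a _; rewrite mxE; apply: eq_bigr => k _.
by rewrite [(unfold i X)^T _ _]mxE mulrC.
Qed.

Lemma ip_sqn n i (X : tensor R n) : ip X X = sqn (unfold i X).
Proof. by rewrite (ipE i) sqn_tr. Qed.

Lemma fnorm_sqr n (X : tensor R n) : fnorm X ^+ 2 = ip X X.
Proof.
rewrite /fnorm sqr_sqrtr; first by apply: eq_bigr => x _; rewrite expr2.
by apply: sumr_ge0 => x _; exact: sqr_ge0.
Qed.

Lemma unfold_modeprod n m i (nm : {in others i, n =1 m}) (A : 'M[R]_(m i, n i))
    (X : tensor R n) :
  unfold i (modeprod nm A X) = castmx (erefl, kdim_eq nm) (A *m unfold i X).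
Proof. exact: foldK. Qed.

Lemma castmx_tr_mul p q q' r (e : q = q') (e' : q' = q) (U : 'M[R]_(p, q)) (V : 'M[R]_(r, q'))
    (A : 'M[R]_(r, p)) :
  \tr ((castmx (erefl, e) (A *m U))^T *m V) = \tr (U^T *m castmx (erefl, e') (A^T *m V)).
Proof.
case: q' / e e' V => e' V; rewrite (eq_irrelevance e' erefl) !castmx_id.
by rewrite trmx_mul mulmxA.
Qed.

Lemma modeprod_adj n m i (nm : {in others i, n =1 m}) (mn : {in others i, m =1 n})
    (A : 'M[R]_(m i, n i)) (X : tensor R n) (Y : tensor R m) :
  ip (modeprod nm A X) Y = ip X (modeprod mn A^T Y).
Proof. by rewrite !(ipE i) !unfold_modeprod (castmx_tr_mul _ (kdim_eq mn)). Qed.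

Lemma modeprod_sqn n m i (nm : {in others i, n =1 m}) (A : 'M[R]_(m i, n i))
    (X : tensor R n) :
  ip (modeprod nm A X) (modeprod nm A X) = sqn (A *m unfold i X).
Proof.
rewrite (ip_sqn i) unfold_modeprod; move: (kdim_eq nm) => e.
by case: _ / e; rewrite castmx_id.
Qed.

(** Coordinates are compared as naturals because ['I_(n l)] and ['I_(m l)] are only provably equal
    types. *)
Definition same_off n m j (x : midx n) (y : midx m) :=
  [forall l, (l != j) ==> (x l == y l :> nat)].

Lemma eq_mulnD N a a' b b' : (b < N)%N -> (b' < N)%N ->
  (a * N + b == a' * N + b')%N = (a == a') && (b == b').
Proof.
move=> bN b'N; apply/eqP/andP => [e|[/eqP -> /eqP ->]//].
have N0 : (0 < N)%N by apply: leq_ltn_trans bN.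
have := congr1 (divn^~ N) e; have := congr1 (modn^~ N) e.
rewrite /= !modnMDl !modn_small// !divnMDl// !divn_small// !addn0 => -> ->.
by rewrite !eqxx.
Qed.

Lemma kcode_eq n m s (x : midx n) (y : midx m) : {in s, n =1 m} ->
  (kcode s x == kcode s y :> nat) = all (fun l => x l == y l :> nat) s.
Proof.
elim: s => [|j s ih] nm //=.
have nmj : n j = m j by apply: nm; rewrite mem_head.
rewrite -ih => [|l ls]; last by apply: nm; rewrite inE ls orbT.
have -> : (kcode s y * m j = kcode s y * n j)%N by congr muln.
by rewrite eq_mulnD 1?andbC// [X in (_ < X)%N]nmj.
Qed.

Lemma kcode_same_off n m j (x : midx n) (y : midx m) : {in others j, n =1 m} ->
  (kcode (others j) x == kcode (others j) y :> nat) = same_off j x y.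
Proof.
move=> nm; rewrite kcode_eq//; apply/allP/forallP => [h l|h l].
  by apply/implyP => lj; apply: h; rewrite mem_filter lj mem_enum.
by rewrite mem_filter => /andP[lj _]; have := h l; rewrite lj.
Qed.

Lemma modeprodE n m j (nm : {in others j, n =1 m}) (A : 'M[R]_(m j, n j))
    (X : tensor R n) (y : midx m) :
  modeprod nm A X y = \sum_(x | same_off j x y) A (y j) (x j) * X x.
Proof.
rewrite /modeprod ffunE castmxE/= cast_ord_id mxE.
have same x : same_off j x y =
    (kcode (others j) x == cast_ord (esym (kdim_eq nm)) (kcode (others j) y)).
  by rewrite -kcode_same_off.
transitivity (\sum_b \sum_(x : midx n | (x j == b) && same_off j x y) A (y j) (x j) * X x).
  apply: eq_bigr => b _; rewrite mxE mulr_sumr; under [RHS]eq_bigl do rewrite same.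
  by apply: eq_bigr => x /andP[/eqP -> _].
rewrite [RHS](partition_big (fun x : midx n => x j) predT)//=.
by apply: eq_bigr => b _; apply: eq_bigl => x; rewrite andbC.
Qed.

(** A product along [j] only combines columns of the mode-i unfolding, so it is a right
    multiplication, by a matrix that does not depend on the tensor. Rows are matched by value since
    [n i] and [m i] are only provably equal. *)
Lemma unfold_modeprod_other n m i j (nm : {in others j, n =1 m}) (A : 'M[R]_(m j, n j)) :
  i != j -> (0 < n i)%N ->
  exists Kr : 'M[R]_(kdim n (others i), kdim m (others i)),
  forall (Y : tensor R n) (a : 'I_(n i)) (a' : 'I_(m i)) c, a = a' :> nat ->
    unfold i (modeprod nm A Y) a' c = (unfold i Y *m Kr) a c.
Proof.
move=> ij ni0.
have nmi : n i = m i by apply: nm; rewrite mem_filter ij mem_enum.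
have [g fg gf] := mode_split_bij n i.
have [g' fg' gf'] := mode_split_bij m i.
have mi0 : (0 < m i)%N by rewrite -nmi.
(* Representatives of the column codes, with coordinate [i] set to 0; the entries of the matrix do
   not depend on that coordinate. *)
pose x0 k := g (Ordinal ni0, k); pose y0 c := g' (Ordinal mi0, c).
pose same2 (x : midx n) (y : midx m) := [forall l, (l != i) ==> ((l != j) ==> (x l == y l :> nat))].
exists (\matrix_(k, c) if same2 (x0 k) (y0 c) then A (y0 c j) (x0 k j) else 0).
move=> Y a a' c aa'; pose y := g' (a', c).
have [ya yc] : y i = a' /\ kcode (others i) y = c by have [] := gf' (a', c).
have off n' (x x' : midx n') l : kcode (others i) x = kcode (others i) x' -> l != i -> x l = x' l.
  by move=> xx' li; apply: (kcode_inj xx'); rewrite mem_filter li mem_enum.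
have y0c : kcode (others i) (y0 c) = c by have [] := gf' (Ordinal mi0, c).
have yy0 l : l != i -> y l = y0 c l by apply: off; rewrite yc y0c.
rewrite -{1}ya -{1}yc unfoldE modeprodE [RHS]mxE.
transitivity (\sum_(x : midx n | x i == a) if same2 (x0 (kcode (others i) x)) (y0 c)
   then A (y0 c j) (x0 (kcode (others i) x) j) * Y x else 0).
  rewrite big_mkcond [RHS]big_mkcond/=; apply: eq_bigr => x _.
  have x0c : kcode (others i) (x0 (kcode (others i) x)) = kcode (others i) x.
    by have [] := gf (Ordinal ni0, kcode (others i) x).
  have xx0 l : l != i -> x0 (kcode (others i) x) l = x l by apply: off.
  have ji : j != i by rewrite eq_sym.
  rewrite -!yy0// xx0//.
  have -> : same_off j x y = (x i == a) && same2 (x0 (kcode (others i) x)) (y0 c).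
    apply/forallP/andP => [h|[/eqP xa /forallP h] l].
      split; first by have := h i; rewrite ij/= ya => /eqP xa; apply/eqP/val_inj; rewrite /= xa aa'.
      apply/forallP => l; apply/implyP => li; apply/implyP => lj.
      by have := h l; rewrite lj/= xx0// -yy0.
    apply/implyP => lj; have [->|li] := eqVneq l i; first by rewrite xa ya aa'.
    by have := h l; rewrite li lj/= xx0// -yy0.
  by case: (x i == a) => //=; case: ifP.
have ga k : g (a, k) i = a /\ kcode (others i) (g (a, k)) = k by have [] := gf (a, k).
rewrite (reindex (fun k => g (a, k)))/=; last first.
  exists (fun x => kcode (others i) x) => [k _|x /eqP <-]; first by have [] := ga k.
  exact: fg.
apply: eq_big => [k|k _]; first by have [-> _] := ga k; rewrite eqxx.
have [gai gak] := ga k; have := unfoldE i Y (g (a, k)).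
rewrite mxE gai gak => ->.
by case: ifP; rewrite ?mulr0 // mulrC.
Qed.

End Unfolding.

(** * Compression, lifting and the telescoping error *)

Section Core.
Variables (R : realType) (d : nat) (n ell : 'I_d -> nat).
Local Notation stage := (stage n ell).
Implicit Type Q : factors R n ell.

Lemma stage_pos k j : (0 < n j)%N -> (0 < ell j)%N -> (0 < stage k j)%N.
Proof. by move=> nj lj; rewrite /Defs.stage; case: ifP => // _; rewrite leq_min nj. Qed.

Lemma lift_core_adj (X : tensor R n) Q k (kd : (k <= d)%N) (Z : tensor R (stage k)) :
  ip X (lift_core Q kd Z) = ip (core X Q kd) Z.
Proof.
elim: k kd Z => [|k ih] kd Z //=.
by rewrite ih (modeprod_adj _ (@stageSV d n ell (Ordinal kd))) trmxK.
Qed.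

Lemma lift_core_isometry Q k (kd : (k <= d)%N) (Z : tensor R (stage k)) :
  (forall i, (Q i)^T *m Q i = 1%:M) -> ip (lift_core Q kd Z) (lift_core Q kd Z) = ip Z Z.
Proof.
move=> QQ; elim: k kd Z => [|k ih] kd Z //=.
rewrite ih modeprod_sqn (ip_sqn (Ordinal kd)) !sqn_tr trmx_mul -mulmxA (mulmxA (Q _)^T).
by rewrite QQ mul1mx.
Qed.

Lemma ip_sub (m : 'I_d -> nat) (X Y : tensor R m) :
  ip (X - Y) (X - Y) = ip X X - 2 * ip X Y + ip Y Y.
Proof.
rewrite /ip mulr_sumr -sumrB -big_split; apply: eq_bigr => x _ /=.
by rewrite !ffunE; ring.
Qed.

Lemma fnorm_sthosvd (X : tensor R n) Q : (forall i, (Q i)^T *m Q i = 1%:M) ->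
  fnorm (X - sthosvd_approx X Q) ^+ 2 = ip X X - ip (core X Q (leqnn d)) (core X Q (leqnn d)).
Proof.
move=> QQ; rewrite fnorm_sqr ip_sub /sthosvd_approx lift_core_adj lift_core_isometry//.
by ring.
Qed.

Definition step_error (X : tensor R n) Q (i : 'I_d) : R :=
  let U := unfold i (core X Q (ltnW (ltn_ord i))) in sqn U - sqn ((Q i)^T *m U).

Lemma step_error_core (X : tensor R n) Q k (kd : (k < d)%N) :
  step_error X Q (Ordinal kd) =
  ip (core X Q (ltnW kd)) (core X Q (ltnW kd)) - ip (core X Q kd) (core X Q kd).
Proof.
rewrite /step_error (eq_irrelevance (ltnW (ltn_ord (Ordinal kd))) (ltnW kd)).
by rewrite /= modeprod_sqn (ip_sqn (Ordinal kd)).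
Qed.

Lemma sthosvd_error (X : tensor R n) Q : (forall i, (Q i)^T *m Q i = 1%:M) ->
  fnorm (X - sthosvd_approx X Q) ^+ 2 = \sum_i step_error X Q i.
Proof.
move=> QQ; rewrite fnorm_sthosvd//.
(* The step error as a function of a natural number, 0 out of range, so that the telescoping is a
   plain induction. *)
pose E k := if @idP (k < d)%N is ReflectT kd then step_error X Q (Ordinal kd) else 0.
have E_ord (i : 'I_d) : E i = step_error X Q i.
  rewrite /E; case: {-}_ / idP => [kd|]; last by rewrite ltn_ord.
  by congr step_error; apply: val_inj.
suff H k (kd : (k <= d)%N) :
    ip X X - ip (core X Q kd) (core X Q kd) = \sum_(0 <= i < k) E i.
  by rewrite H big_mkord; apply: eq_bigr => i _.
elim: k kd => [|k ih] kd; first by rewrite big_geq// subrr.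
rewrite big_nat_recr//= -(ih (ltnW kd)) -[k in E k]/(val (Ordinal kd)) E_ord.
by rewrite step_error_core; ring.
Qed.

Lemma core_contraction (X : tensor R n) Q k (kd : (k <= d)%N) :
  (forall i, (Q i)^T *m Q i = 1%:M) -> ip (core X Q kd) (core X Q kd) <= ip X X.
Proof.
move=> QQ; elim: k kd => [//|k ih] kd; apply: le_trans (ih (ltnW kd)).
by rewrite -subr_ge0 -step_error_core /step_error -sqnB_proj; [exact: sqn_ge0|exact: QQ].
Qed.

Lemma unfold_core Q (i : 'I_d) k (kd : (k <= d)%N) : (forall j, 0 < n j)%N ->
  (forall j, 0 < ell j)%N -> (k <= i)%N ->
  exists Kr : 'M[R]_(kdim n (others i), kdim (stage k) (others i)),
  forall (X : tensor R n) (a : 'I_(n i)) (a' : 'I_(stage k i)) c, a = a' :> nat ->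
    unfold i (core X Q kd) a' c = (unfold i X *m Kr) a c.
Proof.
move=> n0 l0; elim: k kd => [|k ih] kd ki.
  exists 1%:M => X a a' c aa'; rewrite mulmx1 /=.
  by have -> : a = a' by exact: val_inj.
have [Kr KrP] := ih (ltnW kd) (ltnW ki).
have ik : i != Ordinal kd by apply: contraTneq ki => ->; rewrite ltnn.
have [Kr' KrP'] := unfold_modeprod_other (@stageS d n ell (Ordinal kd))
  (Q (Ordinal kd))^T ik (stage_pos k (n0 i) (l0 i)).
exists (Kr *m Kr') => X a a' c aa'.
have stk : stage k i = n i by rewrite /Defs.stage ltnNge (ltnW ki).
pose a1 : 'I_(stage k i) := cast_ord (esym stk) a.
rewrite /= (KrP' _ a1)// mulmxA !mxE; apply: eq_bigr => k' _.
by rewrite (KrP _ a).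
Qed.

(** One [Kr] serves all tensors, so applying the formula to the tensor that folds [B] turns the
    contraction property of the core into [sqn (B *m Kr) <= sqn B]. *)
Lemma core_unfolding Q (i : 'I_d) : (forall j, 0 < n j)%N ->
  (forall j, 0 < ell j)%N -> (forall i, (Q i)^T *m Q i = 1%:M) ->
  exists Kr : 'M[R]_(kdim n (others i), kdim (stage i) (others i)),
    (forall B : 'M[R]_(n i, _), sqn (B *m Kr) <= sqn B) /\
    exists e : n i = stage i i, forall (X : tensor R n),
      unfold i (core X Q (ltnW (ltn_ord i))) = castmx (e, erefl) (unfold i X *m Kr).
Proof.
move=> n0 l0 QQ; have [Kr KrP] := unfold_core Q (ltnW (ltn_ord i)) n0 l0 (leqnn i).
have e : n i = stage i i by rewrite /Defs.stage ltnn.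
have UE X : unfold i (core X Q (ltnW (ltn_ord i))) = castmx (e, erefl) (unfold i X *m Kr).
  apply/matrixP => a c; rewrite castmxE/= cast_ord_id; apply: KrP.
  by [].
exists Kr; split; last by exists e.
move=> B; have := core_contraction (fold B) (ltnW (ltn_ord i)) QQ.
rewrite !(ip_sqn i) UE foldK.
by move: (e); move: (stage i i) => ni e'; case: ni / e'; rewrite castmx_id.
Qed.

End Core.

(** * Independence *)

Section Independence.
Local Open Scope ereal_scope.
Context (R : realType) (dd : measure_display) (T : measurableType dd).
Variable P : probability T R.
Variables (I : finType) (X : I -> {RV P >-> R}).

(* Unlike the preimages of single variables, these are closed under intersection. *)
Definition cylinders (D : {set I}) : set (set T) :=
  [set A | exists2 B : I -> set R, (forall e, measurable (B e)) &
           A = \bigcap_(e in [set` D]) X e @^-1` B e].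

(** The points of [T] with the sigma-algebra generated by the draws in [D]. A separate type for each
    [D] makes products of two such spaces available. *)
Definition sub_space (D : {set I}) := g_sigma_algebraType (cylinders D).
HB.instance Definition _ D := Measurable.on (sub_space D).

Lemma cylinders_setI D : setI_closed (cylinders D).
Proof.
move=> _ _ [B mB ->] [B' mB' ->]; exists (fun e => B e `&` B' e).
  by move=> e; apply: measurableI.
by rewrite -bigcapI; apply: eq_bigcapr => e _; rewrite preimage_setI.
Qed.

Lemma cylinders_setT D : cylinders D setT.
Proof. by exists (fun=> setT) => //; rewrite bigcapT. Qed.

Lemma cylinders_measurable D : cylinders D `<=` measurable.
Proof.
move=> _ [B mB ->]; apply: fin_bigcap_measurable => // e _.
by rewrite -[_ @^-1` _]setTI; apply: (measurable_funPT (X e)).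
Qed.

Lemma sub_space_measurable D (A : set T) :
  measurable (A : set (sub_space D)) -> measurable A.
Proof. exact: (smallest_sub (@sigma_algebra_measurable _ T) (@cylinders_measurable D)). Qed.

Lemma draw_measurable_sub (D : {set I}) e : e \in D ->
  measurable_fun setT (X e : sub_space D -> R).
Proof.
move=> eD _ B mB; rewrite setTI; apply: sub_sigma_algebra.
exists (fun f => if f == e then B else setT); first by move=> f; case: ifP.
apply/seteqP; split => [w Bw f fD /=|w /(_ e eD)/=]; last by rewrite eqxx.
by case: eqP => // ->.
Qed.

Lemma sub_space_mono (D1 D2 : {set I}) (A : set T) : D1 \subset D2 ->
  measurable (A : set (sub_space D1)) -> measurable (A : set (sub_space D2)).
Proof.
move=> D12; apply: smallest_sub; first exact: sigma_algebra_measurable.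
move=> _ [B mB ->]; apply: fin_bigcap_measurable => // e eD1.
rewrite -[_ @^-1` _]setTI; apply: (draw_measurable_sub (D := D2)) => //.
exact: (fintype.subsetP D12).
Qed.

Lemma sub_space_funS (D1 D2 : {set I}) d' (Y : measurableType d') (f : T -> Y) :
  D1 \subset D2 ->
  measurable_fun setT (f : sub_space D1 -> Y) ->
  measurable_fun setT (f : sub_space D2 -> Y).
Proof.
by move=> D12 mf mT B mB; apply: (sub_space_mono D12); apply: mf.
Qed.

Lemma sub_space_fun D d' (Y : measurableType d') (f : T -> Y) :
  measurable_fun setT (f : sub_space D -> Y) -> measurable_fun setT f.
Proof. by move=> mf mT B mB; apply: (@sub_space_measurable D); apply: mf. Qed.

Variable D0 : {set I}.
Hypothesis indepX : mutually_independent P D0 X.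

Lemma cylinders_indep (D1 D2 : {set I}) A1 A2 : D1 \subset D0 -> D2 \subset D0 ->
  [disjoint D1 & D2]%B -> cylinders D1 A1 -> cylinders D2 A2 ->
  P (A1 `&` A2) = P A1 * P A2.
Proof.
move=> D10 D20 D12 [B1 mB1 ->] [B2 mB2 ->].
pose B e := if e \in D1 then B1 e else B2 e.
have mB e : measurable (B e) by rewrite /B; case: ifP.
have E1 : \bigcap_(e in [set` D1]) X e @^-1` B1 e =
          \bigcap_(e in [set` D1]) X e @^-1` B e.
  by apply: eq_bigcapr => e /= eD1; rewrite /B eD1.
have E2 : \bigcap_(e in [set` D2]) X e @^-1` B2 e =
          \bigcap_(e in [set` D2]) X e @^-1` B e.
  apply: eq_bigcapr => e /= eD2; rewrite /B.
  by move: D12; rewrite disjoint_sym => /disjointFr ->.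
rewrite E1 E2 -bigcap_setU.
rewrite (_ : [set` D1] `|` [set` D2] = [set` D1 :|: D2]%SET); last first.
  by apply/seteqP; split => e /=; rewrite !inE => /orP.
rewrite !indepX ?finset.subUset ?D10//.
rewrite (eq_bigl [predU D1 & D2]); last by move=> e; rewrite !inE.
by rewrite bigU.
Qed.

Lemma cover_cst_setT : \bigcup_(k : nat) (fun=> [set: T]) k = setT.
Proof. by rewrite bigcup_const//; exists 0%N. Qed.

(** With B fixed, the finite measures P (A inter B) and P B * P A of the set A agree on cylinders, a
    generating class closed under intersection, hence on the whole sigma-algebra. A first pass frees
    one set from being a cylinder, a second pass the other. *)
Lemma sub_space_indep (D1 D2 : {set I}) (A1 A2 : set T) : D1 \subset D0 -> D2 \subset D0 ->
  [disjoint D1 & D2]%B -> measurable (A1 : set (sub_space D1)) ->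
  measurable (A2 : set (sub_space D2)) -> P (A1 `&` A2) = P A1 * P A2.
Proof.
move=> D10 D20 D12 mA1 mA2.
have scale_cyl (D D' : {set I}) (B A : set T) : measurable B ->
    (forall A', cylinders D A' -> P (A' `&` B) = P B * P A') ->
    measurable (A : set (sub_space D)) -> P (A `&` B) = P B * P A.
  move=> mB BD mA.
  have PBfin : P B \is a fin_num by exact: fin_num_measure.
  pose m1 := mrestr P mB.
  pose c := NngNum (fine_ge0 (measure_ge0 P B)).
  pose m2 := mscale c P.
  have H : forall A', <<s cylinders D >> A' -> m1 A' = m2 A'.
    apply: (g_sigma_algebra_measure_unique (cylinders D)
              (@cylinders_measurable D) (fun=> setT)) => //.
    - by move=> _; exact: cylinders_setT.
    - exact: cover_cst_setT.
    - exact: cylinders_setI.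
    - move=> A' cA'; transitivity (P (A' `&` B)) => //.
      by rewrite BD// -[in LHS](fineK PBfin).
    - move=> k; apply: (@le_lt_trans _ _ (P setT)); last by rewrite probability_setT ltry.
      by apply: le_measure; rewrite ?inE//; apply: measurableI.
  transitivity (m1 A) => //.
  by rewrite (H A mA) -[in RHS](fineK PBfin).
rewrite setIC muleC.
have step1 A1' : cylinders D1 A1' -> P (A2 `&` A1') = P A1' * P A2.
  move=> cA1; apply: (scale_cyl D2 D1) => //.
    exact: (@cylinders_measurable D1).
  by move=> A2' cA2; rewrite setIC (cylinders_indep D10 D20 D12).
rewrite setIC; apply: (scale_cyl D1 D2) => //.
  exact: (@sub_space_measurable D2).
by move=> A' cA'; rewrite setIC step1// muleC.
Qed.

(** As a random variable, the identity has as its law the restriction of [P] to the coarser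
    sigma-algebra. *)
Definition id_sub D : T -> sub_space D := idfun.

Lemma id_sub_measurable D : measurable_fun setT (@id_sub D).
Proof. by move=> _ B mB; rewrite setTI; exact: (@sub_space_measurable D). Qed.
HB.instance Definition _ D :=
  isMeasurableFun.Build _ _ _ _ (@id_sub D) (@id_sub_measurable D).

Definition diag_sub D1 D2 (w : T) : sub_space D1 * sub_space D2 := (w, w).

Lemma diag_sub_measurable D1 D2 : measurable_fun setT (@diag_sub D1 D2).
Proof.
by apply/measurable_fun_pairP; split; [exact: (@id_sub_measurable D1)|exact: (@id_sub_measurable D2)].
Qed.
HB.instance Definition _ D1 D2 :=
  isMeasurableFun.Build _ _ _ _ (@diag_sub D1 D2) (@diag_sub_measurable D1 D2).

(** Independence makes the law of [diag_sub] the product of the two marginal laws, because both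
    measures agree on rectangles; iterating the product integral then gives two separate
    variables. *)
Lemma decouple (D1 D2 : {set I}) (F : T * T -> \bar R) :
  D1 \subset D0 -> D2 \subset D0 -> [disjoint D1 & D2]%B ->
  (forall z, 0 <= F z) ->
  measurable_fun setT (F : sub_space D1 * sub_space D2 -> \bar R) ->
  \int[P]_w F (w, w) = \int[P]_w \int[P]_w' F (w, w').
Proof.
move=> D10 D20 D12 F0 mF.
pose m1 : probability (sub_space D1) R := distribution P (@id_sub D1).
pose m2 : probability (sub_space D2) R := distribution P (@id_sub D2).
pose m : probability _ R := distribution P (@diag_sub D1 D2).
have E : \int[m]_z F z = \int[m1 \x m2]_z F z.
  apply: eq_measure_integral => A mA _; apply/esym.
  apply: product_measure_unique => // A1 A2 mA1 mA2.
  rewrite /m /m1 /m2 /distribution /pushforward/=.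
  by rewrite -(sub_space_indep D10 D20 D12 mA1 mA2).
have -> : \int[P]_w F (w, w) = \int[m]_z F z.
  by rewrite ge0_integral_distribution.
pose F' : sub_space D1 * sub_space D2 -> \bar R := F.
have F'0 z : 0 <= F' z by exact: F0.
have inner x : \int[m2]_y F' (x, y) = \int[P]_y F (x, y).
  rewrite ge0_integral_distribution//.
  exact: (measurableT_comp mF (measurable_pair1 x)).
rewrite E (@fubini_tonelli1 _ _ _ _ _ m1 m2 F' mF F'0).
transitivity (\int[m1]_x \int[P]_y F (x, y)); first by apply: eq_integral => x _; rewrite -inner.
rewrite ge0_integral_distribution//.
  have := @measurable_fun_fubini_tonelli_F _ _ _ _ _ m2 F' mF F'0.
  by apply: eq_measurable_fun => x _; rewrite -inner.
by move=> x; apply: integral_ge0.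
Qed.

Lemma measurable_partial_integral (D1 D2 : {set I}) (F : T * T -> \bar R) :
  (forall z, 0 <= F z) ->
  measurable_fun setT (F : sub_space D1 * sub_space D2 -> \bar R) ->
  measurable_fun setT (fun w => \int[P]_w' F (w, w')).
Proof.
move=> F0 mF; apply: (@sub_space_fun D1).
pose m2 : probability (sub_space D2) R := distribution P (@id_sub D2).
have := @measurable_fun_fubini_tonelli_F _ _ _ _ _ m2
  (F : sub_space D1 * sub_space D2 -> \bar R) mF F0.
apply: eq_measurable_fun => x _; rewrite /fubini_F ge0_integral_distribution//.
exact: (measurableT_comp mF (measurable_pair1 x)).
Qed.

Lemma measurable_fst_sub (D1 D2 : {set I}) (f : T -> R) :
  measurable_fun setT (f : sub_space D1 -> R) ->
  measurable_fun setT ((fun z => f z.1) : sub_space D1 * sub_space D2 -> R).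
Proof. by move=> mf; exact: (measurableT_comp mf measurable_fst). Qed.

Lemma measurable_snd_sub (D1 D2 : {set I}) (f : T -> R) :
  measurable_fun setT (f : sub_space D2 -> R) ->
  measurable_fun setT ((fun z => f z.2) : sub_space D1 * sub_space D2 -> R).
Proof. by move=> mf; exact: (measurableT_comp mf measurable_snd). Qed.

Lemma integral_mul_indep (D1 D2 : {set I}) (f g : T -> R) :
  D1 \subset D0 -> D2 \subset D0 -> [disjoint D1 & D2]%B ->
  (forall w, 0 <= f w)%R -> (forall w, 0 <= g w)%R ->
  measurable_fun setT (f : sub_space D1 -> R) ->
  measurable_fun setT (g : sub_space D2 -> R) ->
  \int[P]_w (f w * g w)%:E = \int[P]_w (f w)%:E * \int[P]_w (g w)%:E.
Proof.
move=> D10 D20 D12 f0 g0 mf mg.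
rewrite (decouple (F := fun z => (f z.1 * g z.2)%:E) D10 D20 D12).
- transitivity (\int[P]_w ((f w)%:E * \int[P]_w' (g w')%:E)).
    apply: eq_integral => w _.
    rewrite -ge0_integralZl_EFin//; first by move=> x _; rewrite lee_fin.
    exact/measurable_EFinP/(sub_space_fun mg).
  rewrite ge0_integralZr//.
  + exact/measurable_EFinP/(sub_space_fun mf).
  + by move=> x _; rewrite lee_fin.
  + by apply: integral_ge0 => x _; rewrite lee_fin.
- by move=> z; rewrite lee_fin mulr_ge0.
- apply/measurable_EFinP.
  by apply: measurable_funM; [exact: measurable_fst_sub|exact: measurable_snd_sub].
Qed.

Lemma big_setU_sub (J : eqType) (D : J -> {set I}) (A : {set I}) (s : seq J) :
  (forall c, c \in s -> D c \subset A) ->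
  (\bigcup_(c <- s) D c)%SET \subset A.
Proof.
move=> DA; rewrite big_seq; apply: (big_ind (fun B : {set I} => B \subset A)) => //.
  exact: finset.sub0set.
by move=> B C BA CA; rewrite finset.subUset BA.
Qed.

Lemma integral_prod_indep (J : eqType) (D : J -> {set I}) (f : J -> T -> R)
    (s : seq J) :
  uniq s -> (forall c, c \in s -> D c \subset D0) ->
  {in s &, forall c c', c != c' -> [disjoint D c & D c']%B} ->
  (forall c w, 0 <= f c w)%R ->
  (forall c, c \in s -> measurable_fun setT (f c : sub_space (D c) -> R)) ->
  \int[P]_w (\prod_(c <- s) f c w)%:E = \prod_(c <- s) \int[P]_w (f c w)%:E.
Proof.
move=> us DD0 Ddis f0 mf.
elim: s us DD0 Ddis mf => [_ _ _ _|c s ih /= /andP[cs us] DD0 Ddis mf].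
  by under eq_integral do rewrite big_nil; rewrite big_nil integral_cst//= mul1e; exact: probability_setT.
under eq_integral do rewrite big_cons.
have DD0' c' : c' \in s -> D c' \subset D0.
  by move=> c's; apply: DD0; rewrite inE c's orbT.
have mf' c' : c' \in s -> measurable_fun setT (f c' : sub_space (D c') -> R).
  by move=> c's; apply: mf; rewrite inE c's orbT.
rewrite big_cons -ih//; last first.
  by move=> a b sa sb; apply: Ddis; rewrite inE ?sa ?sb orbT.
pose D' := (\bigcup_(c' <- s) D c')%SET.
apply: (@integral_mul_indep (D c) D') => //.
- by apply: DD0; rewrite mem_head.
- by apply: big_setU_sub => c' /DD0'.
- rewrite disjoint_sym finset.disjoints_subset; apply: big_setU_sub => c' c's.
  rewrite -finset.disjoints_subset; apply: Ddis; rewrite ?mem_head// ?inE ?c's ?orbT//.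
  by apply: contraNneq cs => <-.
- by move=> w; apply: prodr_ge0.
- by apply: mf; rewrite mem_head.
- apply: measurable_prod => c' c's.
  apply: sub_space_funS (mf' c' c's); rewrite /D' (big_rem c')//=.
  exact: finset.subsetUl.
Qed.

End Independence.

(** * Sub-Gaussian moments *)

Section RealBounds.
Variable R : realType.
Implicit Types x y : R.

(** Valid for every negative [x], so the lower tail of a nonnegative variable needs only two
    moments; the range up to 1/2 serves the truncated upper tail. *)
Lemma expR_le_quad x : x <= 2^-1 -> expR x <= 1 + x + 2 * x ^+ 2.
Proof.
move=> x2; have x1 : 0 < 1 - x by lra.
have : expR x <= (1 - x)^-1.
  rewrite -[x in expR x]opprK expRN lef_pV2 ?posrE ?expR_gt0//.
  by rewrite (le_trans _ (expR_ge1Dx _)).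
move=> /le_trans; apply; rewrite -div1r ler_pdivrMr//.
have : 0 <= x ^+ 2 * (1 - 2 * x) by rewrite mulr_ge0 ?sqr_ge0//; lra.
by rewrite (_ : (1 + x + 2 * x ^+ 2) * (1 - x) = 1 + x ^+ 2 * (1 - 2 * x)); [lra|ring].
Qed.

(** The isolated [x] disappears in the mean of a centred variable and leaves only an exponential of
    the square. *)
Lemma expR_le_subgaussian x : expR x <= x + expR (2 * x ^+ 2).
Proof.
have [x2|x2] := leP x 2^-1.
  apply: le_trans (expR_le_quad x2) _.
  have := expR_ge1Dx (2 * x ^+ 2); lra.
have : expR x <= expR (2 * x ^+ 2) by rewrite ler_expR; nra.
lra.
Qed.

Lemma expR_convex (t x : R) : 0 <= t <= 1 -> expR (t * x) <= 1 - t + t * expR x.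
Proof.
move=> /andP[t0 t1]; set y := t * x.
have H z : expR y * (1 + (z - y)) <= expR z.
  rewrite -[z in leRHS](subrKC y) expRD ler_pM2l ?expR_gt0//.
  by rewrite (le_trans _ (expR_ge1Dx _)).
have := H x; have := H 0; rewrite expR0 => H0 Hx.
have {}H0 := ler_wpM2l (_ : 0 <= 1 - t) H0; have {}Hx := ler_wpM2l t0 Hx.
have -> : expR y = (1 - t) * (expR y * (1 + (0 - y))) + t * (expR y * (1 + (x - y))).
  by rewrite /y; ring.
apply: lerD => //; rewrite -[leRHS]mulr1; apply: H0; lra.
Qed.

End RealBounds.

Lemma ge0_le_integral_EFin (R : realType) (dd : measure_display)
    (T : measurableType dd) (P : {measure set T -> \bar R}) (f g : T -> R) :
  (forall w, 0 <= f w) -> (forall w, f w <= g w) ->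
  measurable_fun setT f -> measurable_fun setT g ->
  (\int[P]_w (f w)%:E <= \int[P]_w (g w)%:E)%E.
Proof.
move=> f0 fg mf mg; apply: ge0_le_integral => //.
- by move=> w _; rewrite lee_fin.
- exact/measurable_EFinP.
- exact/measurable_EFinP.
- by move=> w _; rewrite lee_fin.
Qed.

Lemma integral_prob_cst (R : realType) (dd : measure_display)
    (T : measurableType dd) (P : probability T R) (c : R) :
  (\int[P]_w c%:E = c%:E)%E.
Proof.
rewrite integral_cst//; set p := (X in (_ * X)%E).
by have -> : p = 1%E; [exact: probability_setT|rewrite mule1].
Qed.

Section SubGaussian.
Local Open Scope ereal_scope.
Context (R : realType) (dd : measure_display) (T : measurableType dd).
Variable P : probability T R.
Variables (K : R) (X : {RV P >-> R}).
Hypothesis hK : (1 <= K)%R.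
Hypothesis meanX : 'E_P[X] = 0.
Hypothesis varX : 'V_P[X] = 1.
Hypothesis psi2X : subgaussian_norm P X <= K%:E.

Let K0 : (0 < K)%R. Proof. by rewrite (lt_le_trans _ hK). Qed.

(** The norm is an infimum, which provides an admissible [t] only below any strictly larger value;
    hence [2 * K] in place of [K]. *)
Lemma integral_expR_sqr :
  \int[P]_w (expR ((X w) ^+ 2 / (2 * K) ^+ 2))%:E <= 2%:E.
Proof.
have K0' := K0.
have : subgaussian_norm P X < (2 * K)%:E.
  by apply: le_lt_trans psi2X _; rewrite lte_fin; have := K0; have := hK; lra.
move=> /ereal_inf_lt[_ [t [t0 Et] <-]]; rewrite lte_fin => tK.
apply: le_trans Et; rewrite unlock.
apply: ge0_le_integral_EFin => [w|w||]; first exact: expR_ge0.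
- rewrite ler_expR real_normK ?num_real//.
  rewrite ler_wpM2l ?sqr_ge0// lef_pV2 ?posrE ?exprn_gt0//; last by lra.
  by rewrite lerXn2r ?nnegrE//; lra.
- apply: measurableT_comp => //.
  by apply: measurable_funM => //; exact: measurable_funX.
- apply: measurableT_comp => //.
  apply: measurable_funM => //; apply: measurable_funX.
  exact: measurableT_comp.
Qed.

Let mE : measurable_fun setT (fun w => expR ((X w) ^+ 2 / (2 * K) ^+ 2)).
Proof.
apply: measurableT_comp => //.
by apply: measurable_funM => //; exact: measurable_funX.
Qed.

Lemma integrable_expR_sqr :
  P.-integrable setT (fun w => (expR ((X w) ^+ 2 / (2 * K) ^+ 2))%:E).
Proof.
apply/integrableP; split; first exact/measurable_EFinP.
under eq_integral do rewrite gee0_abs ?lee_fin ?expR_ge0//.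
exact: le_lt_trans integral_expR_sqr (ltry _).
Qed.

Lemma integrable_sqr : P.-integrable setT (fun w => ((X w) ^+ 2)%:E).
Proof.
have K0' := K0.
apply: (@le_integrable _ _ _ P _ measurableT _ (fun w =>
   ((2 * K) ^+ 2)%:E * (expR ((X w) ^+ 2 / (2 * K) ^+ 2))%:E)).
- by apply/measurable_EFinP; exact: measurable_funX.
- move=> w _; rewrite -EFinM !gee0_abs ?lee_fin ?sqr_ge0//.
    rewrite mulrC -ler_pdivrMr ?exprn_gt0//; last by lra.
    by have := expR_ge1Dx (X w ^+ 2 / (2 * K) ^+ 2)%R; lra.
  by rewrite mulr_ge0 ?expR_ge0 ?sqr_ge0.
- exact: integrableZl integrable_expR_sqr.
Qed.

Lemma integrable_RV : P.-integrable setT (EFin \o X).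
Proof.
apply: (@le_integrable _ _ _ P _ measurableT _ (fun w =>
   1%:E + ((X w) ^+ 2)%:E)).
- exact/measurable_EFinP.
- move=> w _; rewrite -EFinD /= lee_fin [leRHS]ger0_norm; last first.
    by rewrite addr_ge0 ?sqr_ge0.
  by rewrite -[in leRHS]real_normK ?num_real//; have := sqr_ge0 (`|X w| - 1)%R; nra.
- apply: integrableD => //; last exact: integrable_sqr.
  exact: finite_measure_integrable_cst.
Qed.

Lemma integral_RV : \int[P]_w (X w)%:E = 0.
Proof. by rewrite -expectation_def. Qed.

Lemma integral_RV_sqr : \int[P]_w ((X w) ^+ 2)%:E = 1.
Proof.
rewrite -varX /variance unlock meanX/= unlock.
by apply: eq_integral => w _ /=; congr EFin; rewrite !fctE /= subr0 expr2.
Qed.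

Lemma integral_affine_sqr (a b : R) :
  \int[P]_w ((a * X w + b) ^+ 2)%:E = (a ^+ 2 + b ^+ 2)%:E.
Proof.
transitivity (\int[P]_w ((a ^+ 2)%:E * ((X w) ^+ 2)%:E +
   ((2 * a * b)%:E * (X w)%:E + (b ^+ 2)%:E))).
  by apply: eq_integral => w _; rewrite -!EFinM -!EFinD; congr EFin; ring.
have i1 : P.-integrable setT (fun w => (2 * a * b)%:E * (X w)%:E).
  exact: integrableZl integrable_RV.
have i2 : P.-integrable setT (cst (b ^+ 2)%:E).
  exact: finite_measure_integrable_cst.
rewrite integralD//; last 2 first.
- exact: integrableZl integrable_sqr.
- exact: integrableD.
rewrite integralD// !integralZl//; [|exact: integrable_RV|exact: integrable_sqr].
rewrite integral_RV integral_RV_sqr mule0 add0e mule1 integral_prob_cst.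
by rewrite -EFinD.
Qed.

(** For [t <= 1], [expR_le_subgaussian] and convexity leave a mean of at most [1 + t], below
    [expR t]. For [t > 1] the crude factor 2 is itself below [expR t]. The 9 is the 8 of [t] plus 1
    from the completed square. *)
Lemma mgf_subgaussian (l : R) :
  \int[P]_w (expR (l * X w))%:E <= (expR (9 * K ^+ 2 * l ^+ 2))%:E.
Proof.
have K0' := K0.
pose E w := expR ((X w) ^+ 2 / (2 * K) ^+ 2).
(* Chosen so that 2 l^2 x^2 = t x^2 / (2 K)^2. *)
pose t := (8 * K ^+ 2 * l ^+ 2)%R.
have t0 : (0 <= t)%R by rewrite /t -mulrA -exprMn mulr_ge0// sqr_ge0.
have ml : measurable_fun setT (fun w => expR (l * X w)).
  by apply: measurableT_comp => //; apply: measurable_funM.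
have [t1|t1] := leP t 1%R.
  apply: (@le_trans _ _ (\int[P]_w (l%:E * (X w)%:E + ((1 - t)%:E + t%:E * (E w)%:E)))).
    have iR : P.-integrable setT (fun w => l%:E * (X w)%:E + ((1 - t)%:E + t%:E * (E w)%:E)).
      apply: integrableD => //; first exact: integrableZl integrable_RV.
      apply: integrableD => //; first exact: finite_measure_integrable_cst.
      exact: integrableZl integrable_expR_sqr.
    have H w : ((expR (l * X w)) <= l * X w + ((1 - t) + t * E w))%R.
      apply: le_trans (expR_le_subgaussian _) _; rewrite lerD2l.
      have t01 : (0 <= t <= 1)%R by rewrite t0 t1.
      have := expR_convex (X w ^+ 2 / (2 * K) ^+ 2)%R t01; apply: le_trans.
      by rewrite ler_expR /t le_eqVlt; apply/orP; left; apply/eqP; field; lra.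
    apply: ge0_le_integral => //.
    - exact/measurable_EFinP.
    - exact: measurable_int iR.
    - by move=> w _; rewrite -!EFinM -!EFinD lee_fin H.
  rewrite integralD//; last 2 first.
  - exact: integrableZl integrable_RV.
  - apply: integrableD => //; first exact: finite_measure_integrable_cst.
    exact: integrableZl integrable_expR_sqr.
  rewrite integralZl//; last exact: integrable_RV.
  rewrite integral_RV mule0 add0e integralD//; last 2 first.
  - exact: finite_measure_integrable_cst.
  - exact: integrableZl integrable_expR_sqr.
  rewrite integralZl//; last exact: integrable_expR_sqr.
  rewrite integral_prob_cst.
  apply: (@le_trans _ _ ((1 - t)%:E + t%:E * 2%:E)).
    by rewrite leeD2l// lee_wpmul2l ?lee_fin//; exact: integral_expR_sqr.
  rewrite -EFinM -EFinD lee_fin.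
  apply: (@le_trans _ _ (expR t)); first by have := expR_ge1Dx t; lra.
  by rewrite ler_expR /t; have := sqr_ge0 (K * l)%R; rewrite exprMn; lra.
(* l x <= K^2 l^2 + x^2 / (4 K^2) *)
apply: (@le_trans _ _ (\int[P]_w ((expR (K ^+ 2 * l ^+ 2))%:E * (E w)%:E))).
  under [leRHS]eq_integral do rewrite -EFinM.
  apply: ge0_le_integral_EFin => [w|w||].
  - exact: expR_ge0.
  - rewrite -expRD ler_expR -subr_ge0.
    by rewrite (_ : _ - _ = (K * l - X w / (2 * K)) ^+ 2)%R ?sqr_ge0//; field; lra.
  - exact: ml.
  - exact: measurable_funM.
rewrite ge0_integralZl_EFin ?expR_ge0//; last 2 first.
- by move=> w _; rewrite lee_fin expR_ge0.
- exact/measurable_EFinP.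
apply: (@le_trans _ _ ((expR (K ^+ 2 * l ^+ 2))%:E * 2%:E)).
  by rewrite lee_wpmul2l ?lee_fin ?expR_ge0//; exact: integral_expR_sqr.
rewrite -EFinM lee_fin (_ : 9 * _ * _ = K ^+ 2 * l ^+ 2 + t)%R; last by rewrite /t; ring.
rewrite expRD ler_wpM2l ?expR_ge0//.
by have := expR_ge1Dx t; lra.
Qed.

End SubGaussian.

Section PowerBounds.
Variable R : realType.

Lemma expr_tangent (x m : R) p : 0 <= x -> 0 <= m ->
  m ^+ p + p%:R * m ^+ p.-1 * (x - m) <= x ^+ p.
Proof.
move=> x0 m0; elim: p => [|p ih]; first by rewrite mul0r mul0r addr0.
rewrite [x ^+ _]exprS; apply: (le_trans _ (ler_wpM2l x0 ih)); rewrite -subr_ge0.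
have : 0 <= p%:R * m ^+ p.-1 * (x - m) ^+ 2.
  by rewrite mulr_ge0 ?sqr_ge0// mulr_ge0 ?ler0n ?exprn_ge0.
congr (_ <= _) => //=; case: p ih => [|p] ih; first by rewrite expr1; ring.
by rewrite /= !exprS -[p.+2%:R]natr1; ring.
Qed.

Lemma jensen_expr (J : Type) (s : seq J) (w x : J -> R) p :
  (forall i, 0 <= w i) -> (forall i, 0 <= x i) -> \sum_(i <- s) w i = 1 ->
  (\sum_(i <- s) w i * x i) ^+ p <= \sum_(i <- s) w i * x i ^+ p.
Proof.
move=> w0 x0 w1; set m := \sum_(i <- s) w i * x i.
have m0 : 0 <= m by apply: sumr_ge0 => i _; rewrite mulr_ge0.
apply: (@le_trans _ _ (\sum_(i <- s) w i * (m ^+ p + p%:R * m ^+ p.-1 * (x i - m)))).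
  rewrite le_eqVlt; apply/orP; left; apply/eqP.
  under eq_bigr do rewrite mulrDr.
  rewrite big_split/= -mulr_suml w1 mul1r.
  under eq_bigr do rewrite mulrCA mulrBr.
  by rewrite -mulr_sumr sumrB -mulr_suml w1 mul1r subrr mulr0 addr0.
by apply: ler_sum => i _; apply: ler_wpM2l => //; exact: expr_tangent.
Qed.

Lemma expr_le_fact_expR (x : R) p :
  x ^+ (2 * p) <= (2 * p)`!%:R * (expR x + expR (- x)).
Proof.
have H (y : R) n : 0 <= y -> y ^+ n <= n`!%:R * expR y.
  move=> y0; rewrite mulrC -ler_pdivrMr ?ltr0n ?fact_gt0//.
  case: n => [|n].
    by rewrite expr0 fact0 divr1; have := expR_ge1Dx y; lra.
  by have := expR_ge1Dxn n y0; lra.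
have e0 (y : R) := expR_ge0 y.
have [x0|x0] := leP 0 x.
  by apply: le_trans (H x _ x0) _; rewrite ler_wpM2l// lerDl.
rewrite -[x ^+ _](_ : (- x) ^+ (2 * p) = _); last by rewrite !exprM sqrrN.
apply: le_trans (H (- x) _ _) _; first by rewrite oppr_ge0 ltW.
by rewrite ler_wpM2l// lerDr.
Qed.

Lemma fact_le_expn n : (n`! <= n ^ n)%N.
Proof.
elim: n => // n ih; rewrite factS expnS leq_mul2l/=.
by apply: leq_trans ih _; case: n => // n; rewrite leq_exp2r.
Qed.

End PowerBounds.

(** 72 = 9 * 4 * 2: the 9 of [mgf_subgaussian], the 4 of (2 p)! <= (4 p^2)^p, and a 2 absorbing the
    two signs of the exponential. *)
Definition moment_cst (R : realType) (K : R) : R := 72 * expR 1 * K ^+ 2.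

Section Family.
Local Open Scope ereal_scope.
Context (R : realType) (dd : measure_display) (T : measurableType dd).
Variable P : probability T R.
Variables (I : finType) (X : I -> {RV P >-> R}) (D0 : {set I}) (K : R).
Hypothesis indepX : mutually_independent P D0 X.
Hypothesis hK : (1 <= K)%R.
Hypothesis meanX : forall e, e \in D0 -> 'E_P[X e] = 0.
Hypothesis varX : forall e, e \in D0 -> 'V_P[X e] = 1.
Hypothesis psi2X : forall e, e \in D0 -> subgaussian_norm P (X e) <= K%:E.

Lemma lee_prod_EFin (J : eqType) (s : seq J) (f : J -> \bar R) (g : J -> R) :
  (forall c, c \in s -> 0 <= f c <= (g c)%:E) ->
  0 <= \prod_(c <- s) f c <= (\prod_(c <- s) g c)%:E.
Proof.
elim: s => [|c s ih] fg; first by rewrite !big_nil lee01 lexx.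
have /andP[f0 fgc] := fg c (mem_head _ _).
have /andP[p0 pg] : 0 <= \prod_(c <- s) f c <= (\prod_(c <- s) g c)%:E.
  by apply: ih => d ds; apply: fg; rewrite inE ds orbT.
by rewrite !big_cons mule_ge0//= EFinM lee_pmul.
Qed.

Section LinComb.
Variables (J : eqType) (f : J -> I).
Hypothesis finj : injective f.

Lemma measurable_lincomb (D : {set I}) (s : seq J) (w : J -> R) :
  (forall b, b \in s -> f b \in D) ->
  measurable_fun setT ((fun z => \sum_(b <- s) w b * X (f b) z)%R : sub_space X D -> R).
Proof.
elim: s => [|b s ih] sD.
  by under eq_fun do rewrite big_nil; exact: measurable_cst.
under eq_fun do rewrite big_cons; apply: measurable_funD.
  apply: measurable_funM; first exact: measurable_cst.
  by apply: draw_measurable_sub; apply: sD; rewrite mem_head.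
by apply: ih => c cs; apply: sD; rewrite inE cs orbT.
Qed.

Lemma mgf_lincomb (s : seq J) (w : J -> R) (l : R) :
  uniq s -> (forall b, b \in s -> f b \in D0) ->
  \int[P]_z (expR (l * \sum_(b <- s) w b * X (f b) z))%:E <=
    (expR (9 * K ^+ 2 * l ^+ 2 * \sum_(b <- s) w b ^+ 2))%:E.
Proof.
move=> us sD0.
rewrite [leLHS](_ : _ = \int[P]_z (\prod_(b <- s) expR (l * w b * X (f b) z))%:E); last first.
  apply: eq_integral => z _; rewrite mulr_sumr expR_sum; congr EFin.
  by apply: eq_bigr => b _; rewrite mulrA.
rewrite (@integral_prod_indep _ _ _ _ _ X D0 indepX J (fun b => [set f b]%SET)) //.
- rewrite mulr_sumr expR_sum.
  apply: proj2; apply/andP; apply: lee_prod_EFin => b bs.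
  rewrite integral_ge0/=; last by move=> z _; rewrite lee_fin expR_ge0.
  apply: le_trans (mgf_subgaussian hK (meanX (sD0 _ bs)) (psi2X (sD0 _ bs)) _) _.
  by rewrite lee_fin ler_expR le_eqVlt; apply/orP; left; apply/eqP; ring.
- by move=> b bs; rewrite finset.sub1set sD0.
- move=> b c _ _ bc; rewrite finset.disjoints1 inE.
  by apply: contra bc => /eqP /finj ->.
- move=> b bs; apply: measurableT_comp => //; apply: measurable_funM; first exact: measurable_cst.
  by apply: draw_measurable_sub; rewrite inE.
Qed.

Lemma moment_lincomb (s : seq J) (w : J -> R) (p : nat) :
  uniq s -> (forall b, b \in s -> f b \in D0) -> (0 < p)%N ->
  \int[P]_z (((\sum_(b <- s) w b * X (f b) z) ^+ 2) ^+ p)%:E <=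
    ((moment_cst K * p%:R * \sum_(b <- s) w b ^+ 2) ^+ p)%:E.
Proof.
move=> us sD0 p0; set S := (\sum_(b <- s) w b ^+ 2)%R.
have S0 : (0 <= S)%R by apply: sumr_ge0 => b _; rewrite sqr_ge0.
have K0 : (0 < K)%R by exact: lt_le_trans ltr01 hK.
have [S_eq0|S_neq0] := eqVneq S 0%R.
  have w0 b : b \in s -> w b = 0%R.
    move=> bs; apply/eqP; rewrite -sqrf_eq0; apply/eqP.
    move: S_eq0 => /eqP; rewrite psumr_eq0; last by move=> ? _; rewrite sqr_ge0.
    by move=> /allP/(_ b bs)/=/eqP.
  rewrite S_eq0 mulr0 expr0n gtn_eqF//=.
  rewrite (eq_integral (fun=> 0)) ?integral0// => z _.
  rewrite big_seq big1 => [|b bs]; last by rewrite w0// mul0r.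
  by rewrite !expr0n/= gtn_eqF.
have {}S0 : (0 < S)%R by rewrite lt_def S_neq0.
have p0' : (0 < p%:R :> R)%R by rewrite ltr0n.
(* With this [l] the exponent in the bound on the moment generating function is exactly [p]. *)
pose l := Num.sqrt (p%:R / (9 * K ^+ 2 * S)).
have c0 : (0 < 9 * K ^+ 2 * S)%R by rewrite mulr_gt0// mulr_gt0// exprn_gt0.
have l2 : (l ^+ 2 = p%:R / (9 * K ^+ 2 * S))%R by rewrite sqr_sqrtr// divr_ge0// ltW.
have l20 : (0 < l ^+ 2)%R by rewrite l2 divr_gt0.
pose Y z := (\sum_(b <- s) w b * X (f b) z)%R.
have mY : measurable_fun setT Y.
  by apply: (@sub_space_fun _ _ _ _ _ X D0); exact: measurable_lincomb.
have mexp (c : R) : measurable_fun setT (fun z => expR (c * Y z)).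
  by apply: measurableT_comp => //; exact: measurable_funM.
have mgf (c : R) : (c ^+ 2 = l ^+ 2)%R -> \int[P]_z (expR (c * Y z))%:E <= (expR p%:R)%:E.
  move=> cl; apply: le_trans (mgf_lincomb _ _ us sD0) _.
  rewrite lee_fin ler_expR cl l2 -/S le_eqVlt; apply/orP; left; apply/eqP.
  by field; rewrite !gt_eqF.
pose A := ((l ^+ 2) ^- p * (2 * p)`!%:R)%R.
have A0 : (0 <= A)%R by rewrite mulr_ge0// invr_ge0 exprn_ge0// ltW.
apply: (@le_trans _ _ (\int[P]_z (A%:E * ((expR (l * Y z))%:E + (expR (- l * Y z))%:E)))).
  under [leRHS]eq_integral do rewrite -EFinD -EFinM.
  apply: ge0_le_integral_EFin => [z|z||].
  - by rewrite exprn_ge0// sqr_ge0.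
  - rewrite /A -mulrA ler_pdivlMl; last exact: exprn_gt0 l20.
    have := expr_le_fact_expR (l * Y z) p; rewrite -mulNr; apply: le_trans.
    by rewrite -/(Y z) exprM [((l * Y z) ^+ 2)%R]exprMn [leRHS]exprMn.
  - exact: (measurable_funX p (measurable_funX 2 mY)).
  - by apply: measurable_funM => //; exact: measurable_funD.
have mEFin c : measurable_fun setT (fun z => (expR (c * Y z))%:E) by exact/measurable_EFinP.
rewrite (@ge0_integralZl_EFin _ _ _ P setT measurableT _ _ _ _ A0); last 2 first.
- by move=> z _; rewrite -EFinD lee_fin addr_ge0 ?expR_ge0.
- exact: emeasurable_funD.
rewrite (@ge0_integralD _ _ _ P setT measurableT _ _ _ (mEFin _) _ (mEFin _)); last 2 first.
- by move=> z _; rewrite lee_fin expR_ge0.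
- by move=> z _; rewrite lee_fin expR_ge0.
apply: (@le_trans _ _ (A%:E * ((expR p%:R)%:E + (expR p%:R)%:E))).
  by rewrite lee_wpmul2l// leeD// mgf// sqrrN.
rewrite -EFinD -EFinM lee_fin.
have fact_bound : ((2 * p)`!%:R <= (4 * p%:R ^+ 2) ^+ p :> R)%R.
  rewrite (_ : (4 * p%:R ^+ 2) ^+ p = ((2 * p) ^ (2 * p))%:R :> R)%R.
    by rewrite ler_nat fact_le_expn.
  by rewrite natrX natrM exprM; congr (_ ^+ p)%R; ring.
apply: (@le_trans _ _ ((l ^+ 2) ^- p * (4 * p%:R ^+ 2) ^+ p * (2 * expR 1 ^+ p)))%R.
  have -> : (expR p%:R = expR 1 ^+ p :> R)%R by rewrite -expRM_natr mul1r.
  rewrite -mulr2n -[(_ *+ 2)%R]mulr_natl ler_wpM2r ?mulr_ge0 ?exprn_ge0 ?expR_ge0//.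
  by rewrite /A ler_wpM2l// invr_ge0 exprn_ge0// ltW.
apply: (@le_trans _ _ ((l ^+ 2) ^- p * (4 * p%:R ^+ 2) ^+ p * (2 ^+ p * expR 1 ^+ p)))%R.
  rewrite ler_wpM2l//; first by apply: mulr_ge0; [rewrite invr_ge0 exprn_ge0// ltW|rewrite exprn_ge0// mulr_ge0// sqr_ge0].
  rewrite ler_wpM2r ?exprn_ge0 ?expR_ge0//.
  by rewrite -[leLHS]expr1 ler_weXn2l// ler1n.
rewrite -exprVn -!exprMn l2 /moment_cst le_eqVlt; apply/orP; left; apply/eqP.
congr (_ ^+ p)%R; field; rewrite !gt_eqF//.
Qed.

(** With the other variables frozen, the mean of (a X + b)^2 is a^2 + b^2. Splitting off one
    variable at a time keeps the integrands nonnegative, as [decouple] requires. *)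
Lemma second_moment_lincomb (s : seq J) (w : J -> R) :
  uniq s -> (forall b, b \in s -> f b \in D0) ->
  \int[P]_z ((\sum_(b <- s) w b * X (f b) z) ^+ 2)%:E = (\sum_(b <- s) w b ^+ 2)%:E.
Proof.
elim: s => [_ _|b s ih /= /andP[bs us] sD0].
  rewrite big_nil (eq_integral (fun=> 0)) ?integral0// => z _.
  by rewrite big_nil expr0n.
have sD0' c : c \in s -> f c \in D0 by move=> cs; rewrite sD0// inE cs orbT.
have bD0 : f b \in D0 by rewrite sD0// mem_head.
pose Y z := (\sum_(b <- s) w b * X (f b) z)%R.
pose D1 := [set e | e \in map f s]%SET.
pose F (z : T * T) := ((w b * X (f b) z.2 + Y z.1) ^+ 2)%:E.
have mY : measurable_fun setT (Y : sub_space X D1 -> R).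
  by apply: measurable_lincomb => c cs; rewrite inE map_f.
rewrite (eq_integral (fun z => F (z, z))); last first.
  by move=> z _; rewrite /F/= big_cons.
rewrite (@decouple _ _ _ _ _ X D0 indepX D1 [set f b]%SET).
- transitivity (\int[P]_z ((w b ^+ 2)%:E + (Y z ^+ 2)%:E)).
    apply: eq_integral => z _; rewrite /F/= -EFinD.
    exact: (integral_affine_sqr hK (meanX bD0) (varX bD0) (psi2X bD0)).
  rewrite ge0_integralD; [|exact: measurableT|by move=> z _; rewrite lee_fin sqr_ge0
    |exact: measurable_cst|by move=> z _; rewrite lee_fin sqr_ge0|]; last first.
    by apply/measurable_EFinP; exact: (measurable_funX 2 (sub_space_fun mY)).
  rewrite integral_prob_cst ih// big_cons EFinD//.
- by apply/fintype.subsetP => e; rewrite inE => /mapP[c cs ->]; exact: sD0'.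
- by rewrite finset.sub1set.
- rewrite disjoint_sym finset.disjoints1 inE.
  by apply: contra bs => /mapP[c cs /finj ->].
- by move=> z; rewrite lee_fin sqr_ge0.
- apply/measurable_EFinP; apply: (measurable_funX 2); apply: measurable_funD.
    apply: measurable_funM; first exact: measurable_cst.
    apply: (@measurable_snd_sub _ _ _ _ _ X D1 _ (X (f b))).
    by apply: draw_measurable_sub; rewrite inE.
  exact: (@measurable_fst_sub _ _ _ _ _ X D1 _ Y).
Qed.

(** Jensen's inequality with weights [Sm m / S] reduces the sum of squares to single linear forms at
    no cost in the constant. [M] is an arbitrary finite type because it is later instantiated by
    pairs. *)
Lemma moment_quad (M : finType) (s : seq J) (v : M -> J -> R) (p : nat) :
  uniq s -> (forall b, b \in s -> f b \in D0) -> (0 < p)%N ->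
  \int[P]_z ((\sum_m (\sum_(b <- s) v m b * X (f b) z) ^+ 2) ^+ p)%:E <=
    ((moment_cst K * p%:R * \sum_m \sum_(b <- s) v m b ^+ 2) ^+ p)%:E.
Proof.
move=> us sD0 p0.
pose Sm m := (\sum_(b <- s) v m b ^+ 2)%R; pose S := (\sum_m Sm m)%R.
pose Y m z := (\sum_(b <- s) v m b * X (f b) z)%R.
have mY m : measurable_fun setT (Y m).
  by apply: (@sub_space_fun _ _ _ _ _ X D0); exact: measurable_lincomb.
have Sm0 m : (0 <= Sm m)%R by apply: sumr_ge0 => b _; rewrite sqr_ge0.
have S0 : (0 <= S)%R by exact: sumr_ge0.
have Y0 m z : Sm m = 0%R -> Y m z = 0%R.
  move=> /eqP; rewrite psumr_eq0 => [|b _]; last exact: sqr_ge0.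
  move=> /allP v0; rewrite /Y big_seq big1// => b /v0/=.
  by rewrite sqrf_eq0 => /eqP ->; rewrite mul0r.
rewrite -/S; have [S_eq0|S_neq0] := eqVneq S 0%R.
  rewrite S_eq0 mulr0 expr0n gtn_eqF//=.
  rewrite (eq_integral (fun=> 0)) ?integral0// => z _.
  rewrite big1 => [|m _]; first by rewrite expr0n gtn_eqF.
  rewrite -/(Y m z) Y0 ?expr0n//.
  by apply: (psumr_eq0P _ S_eq0) => // i _; exact: Sm0.
have {}S0 : (0 < S)%R by rewrite lt_def S_neq0.
(* When [Sm m = 0] the linear form vanishes, and division by 0 yields the coefficient 0. *)
pose c m := (Sm m / S * (S / Sm m) ^+ p)%R.
have c0 m : (0 <= c m)%R by rewrite mulr_ge0 ?exprn_ge0 ?divr_ge0 ?(ltW S0).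
have H z : ((\sum_m Y m z ^+ 2) ^+ p <= \sum_m c m * (Y m z ^+ 2) ^+ p)%R.
  have E m : (Y m z ^+ 2 = Sm m / S * (Y m z ^+ 2 * (S / Sm m)))%R.
    have [Sm_eq0|Sm_neq0] := eqVneq (Sm m) 0%R.
      by rewrite Y0// Sm_eq0 !mul0r expr0n.
    by field; rewrite Sm_neq0.
  under eq_bigr do rewrite E.
  apply: le_trans (jensen_expr _ _ _ _) _ => [m|m||].
  - by rewrite divr_ge0 ?(ltW S0).
  - by rewrite mulr_ge0 ?sqr_ge0// divr_ge0 ?(ltW S0).
  - by rewrite -mulr_suml divff.
  - apply: ler_sum => m _; rewrite /c exprMn [((Y m z ^+ 2) ^+ p * _)%R]mulrC.
    by rewrite mulrA.
apply: (@le_trans _ _ (\int[P]_z (\sum_m c m * (Y m z ^+ 2) ^+ p)%:E)).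
  apply: ge0_le_integral_EFin => // [z||].
  - by rewrite exprn_ge0// sumr_ge0// => m _; rewrite sqr_ge0.
  - apply: (measurable_funX p); apply: measurable_sum => m.
    exact: (measurable_funX 2 (mY m)).
  - apply: measurable_sum => m; apply: measurable_funM => //.
    exact: (measurable_funX p (measurable_funX 2 (mY m))).
under eq_integral do rewrite -sumEFin.
have mY2 m : measurable_fun setT (fun z => ((Y m z ^+ 2) ^+ p)%:E).
  by apply/measurable_EFinP; exact: (measurable_funX p (measurable_funX 2 (mY m))).
rewrite (@ge0_integral_sum _ _ _ P setT measurableT _
  (fun m z => (c m * (Y m z ^+ 2) ^+ p)%:E)); last 2 first.
- move=> m; under eq_fun do rewrite EFinM.
  by apply: measurable_funeM; exact: mY2.
- by move=> m z _; rewrite lee_fin mulr_ge0// exprn_ge0// sqr_ge0.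
have -> : ((moment_cst K * p%:R * S) ^+ p =
    \sum_m Sm m / S * (moment_cst K * p%:R * S) ^+ p)%R.
  by rewrite -mulr_suml -mulr_suml divff// mul1r.
rewrite -sumEFin; apply: lee_sum => m _.
under eq_integral do rewrite EFinM.
rewrite (@ge0_integralZl_EFin _ _ _ P setT measurableT _ _ (mY2 m) _ (c0 m)); last first.
  by move=> z _; rewrite lee_fin exprn_ge0// sqr_ge0.
apply: (@le_trans _ _ ((c m)%:E * ((moment_cst K * p%:R * Sm m) ^+ p)%:E)).
  by rewrite lee_wpmul2l ?lee_fin//; exact: moment_lincomb.
rewrite -EFinM lee_fin /c.
have [Sm_eq0|Sm_neq0] := eqVneq (Sm m) 0%R; first by rewrite Sm_eq0 !mul0r.
rewrite -[leLHS]mulrA -exprMn le_eqVlt; apply/orP; left; apply/eqP.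
by congr (_ * _ ^+ p)%R; field.
Qed.

End LinComb.
End Family.

(** * Concentration of Khatri-Rao sketches *)

Lemma sum_mxtens (R : nmodType) (m n : nat) (F : 'I_(m * n) -> R) :
  \sum_k F k = \sum_a \sum_b F (mxtens_index (a, b)).
Proof.
rewrite pair_big; apply: (reindex (fun p : 'I_m * 'I_n => mxtens_index (p.1, p.2))).
by exists (@mxtens_unindex m n) => [[a b]|k] _; rewrite ?mxtens_indexK// -surjective_pairing mxtens_unindexK.
Qed.

Fixpoint kcol (R : realType) d (m : 'I_d -> nat) (x : forall j, 'I_(m j) -> R)
    (s : seq 'I_d) : 'I_(kdim m s) -> R :=
  if s is j :: s' then
    fun k => @kcol R d m x s' (mxtens_unindex k).1 * x j (mxtens_unindex k).2
  else fun=> 1.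
Arguments kcol {R d m} x s k.

Lemma krps_kcol (R : realType) d (m : 'I_d -> nat) l
    (W : forall j, 'M[R]_(m j, l)) s k c :
  krps W s k c = kcol (fun j b => W j b c) s k.
Proof.
elim: s k => [|j s ih] k /=; first by rewrite mxE.
by rewrite !mxE -ih.
Qed.

Section Columns.
Local Open Scope ereal_scope.
Context (R : realType) (dd : measure_display) (T : measurableType dd).
Variable P : probability T R.
Variables (I : finType) (X : I -> {RV P >-> R}) (D0 : {set I}) (K : R).
Hypothesis indepX : mutually_independent P D0 X.
Hypothesis hK : (1 <= K)%R.
Hypothesis meanX : forall e, e \in D0 -> 'E_P[X e] = 0.
Hypothesis varX : forall e, e \in D0 -> 'V_P[X e] = 1.
Hypothesis psi2X : forall e, e \in D0 -> subgaussian_norm P (X e) <= K%:E.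

Variables (d : nat) (m : 'I_d -> nat) (e : forall j : 'I_d, 'I_(m j) -> I).
Hypothesis einj : forall j, injective (e (j := j)).
Hypothesis edisj : forall j j' b b', e (j := j) b = e (j := j') b' -> j = j'.
Variable s0 : seq 'I_d.
Hypothesis eD0 : forall j b, j \in s0 -> e (j := j) b \in D0.

Let x (z : T) j (b : 'I_(m j)) : R := X (e b) z.

Definition mode_entries (s : seq 'I_d) : {set I} :=
  [set a | [exists j : 'I_d, (j \in s) && [exists b : 'I_(m j), a == e b]]]%SET.

Lemma mode_entriesP s a :
  reflect (exists2 j, j \in s & exists b : 'I_(m j), a = e b) (a \in mode_entries s).
Proof.
rewrite inE; apply: (iffP existsP) => [[j /andP[js /existsP[b /eqP ->]]]|[j js [b ->]]].
  by exists j => //; exists b.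
by exists j; rewrite js; apply/existsP; exists b.
Qed.

Lemma measurable_kcol s k :
  measurable_fun setT ((fun z => kcol (x z) s k) : sub_space X (mode_entries s) -> R).
Proof.
elim: s k => [|j s ih] k /=; first exact: measurable_cst.
apply: measurable_funM; last first.
  apply: draw_measurable_sub; apply/mode_entriesP; exists j; first exact: mem_head.
  by eexists.
apply: sub_space_funS (ih _).
apply/fintype.subsetP => a /mode_entriesP[j' j's [b ->]].
by apply/mode_entriesP; exists j'; [rewrite inE j's orbT|exists b].
Qed.

(** This is |B x|^2, where x is the Kronecker product of the vectors of draws of the modes in
    [s]. *)
Definition kquad (M : finType) s (B : M -> 'I_(kdim m s) -> R) (z : T) : R :=
  (\sum_a (\sum_k B a k * kcol (x z) s k) ^+ 2)%R.

Lemma kquad_ge0 (M : finType) s (B : M -> 'I_(kdim m s) -> R) z : (0 <= kquad B z)%R.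
Proof. by apply: sumr_ge0 => a _; exact: sqr_ge0. Qed.

Lemma measurable_kquad (M : finType) s (B : M -> 'I_(kdim m s) -> R) :
  measurable_fun setT (kquad B : sub_space X (mode_entries s) -> R).
Proof.
apply: measurable_sum => a; apply: (measurable_funX 2); apply: measurable_sum => k.
by apply: measurable_funM; [exact: measurable_cst|exact: measurable_kcol].
Qed.

Section Step.
Variables (M : finType) (j : 'I_d) (s : seq 'I_d).
Variable B : M -> 'I_(kdim m (j :: s)) -> R.

(** [Bc z] is [B] contracted with the draws of mode [j]. [B'] has the entries of [B], regrouped so
    that this contraction becomes a family of linear forms in those draws. *)
Let Bc (z : T) (a : M) (k : 'I_(kdim m s)) : R :=
  (\sum_b B a (mxtens_index (k, b)) * x z b)%R.

Let B' (ak : M * 'I_(kdim m s)) (b : 'I_(m j)) : R := B ak.1 (mxtens_index (ak.2, b)).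

Lemma kquad_cons z z' :
  (\sum_a (\sum_k B a k * (kcol (x z') s (mxtens_unindex k).1 * x z (mxtens_unindex k).2)) ^+ 2)%R =
  kquad (Bc z) z'.
Proof.
apply: eq_bigr => a _; congr (_ ^+ 2)%R; rewrite sum_mxtens; apply: eq_bigr => k _.
rewrite /Bc mulr_suml; apply: eq_bigr => b _; rewrite mxtens_indexK/=.
by ring.
Qed.

Lemma Bc_sqr z : (\sum_a \sum_k Bc z a k ^+ 2)%R =
  (\sum_ak (\sum_b B' ak b * X (e b) z) ^+ 2)%R.
Proof. by rewrite pair_bigA. Qed.

Lemma B'_sqr : (\sum_ak \sum_b B' ak b ^+ 2)%R = (\sum_a \sum_k B a k ^+ 2)%R.
Proof.
rewrite -(pair_bigA _ (fun a k => \sum_b B a (mxtens_index (k, b)) ^+ 2)%R)/=.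
by apply: eq_bigr => a _; rewrite sum_mxtens.
Qed.

Let F p (z : T * T) := ((kquad (Bc z.1) z.2) ^+ p)%:E.

Let F0 p z : 0 <= F p z.
Proof. by rewrite lee_fin exprn_ge0// kquad_ge0. Qed.

Let mF p : measurable_fun setT
  (F p : sub_space X (mode_entries [:: j]) * sub_space X (mode_entries s) -> \bar R).
Proof.
apply/measurable_EFinP; apply: (measurable_funX p).
apply: measurable_sum => a; apply: (measurable_funX 2); apply: measurable_sum => k.
apply: measurable_funM.
  apply: (@measurable_fst_sub _ _ _ _ _ X _ _ (fun z => Bc z a k)).
  apply: measurable_sum => b; apply: measurable_funM; first exact: measurable_cst.
  apply: draw_measurable_sub; apply/mode_entriesP; exists j; first exact: mem_head.
  by exists b.
apply: (@measurable_snd_sub _ _ _ _ _ X _ _ (fun z => kcol (x z) s k)).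
exact: measurable_kcol.
Qed.

Lemma measurable_integral_Bc p :
  measurable_fun setT (fun z => \int[P]_z' ((kquad (Bc z) z') ^+ p)%:E).
Proof. exact: (measurable_partial_integral (F0 p) (@mF p)). Qed.

Lemma integral_kquad_cons (p : nat) : j \notin s -> {subset j :: s <= s0} ->
  \int[P]_z ((kquad B z) ^+ p)%:E =
  \int[P]_z \int[P]_z' ((kquad (Bc z) z') ^+ p)%:E.
Proof.
move=> js sub.
have H D : {subset D <= s0} -> mode_entries D \subset D0.
  by move=> Ds; apply/fintype.subsetP => a /mode_entriesP[j' j's [b ->]]; apply/eD0/Ds.
rewrite (eq_integral (fun z => F p (z, z))); last first.
  by move=> z _; rewrite /F/= -kquad_cons.
rewrite (@decouple _ _ _ _ _ X D0 indepX (mode_entries [:: j]) (mode_entries s))//.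
- by apply: H => i; rewrite inE => /eqP ->; apply: sub; rewrite mem_head.
- by apply: H => i si; apply: sub; rewrite inE si orbT.
- rewrite -setI_eq0; apply/eqP/finset.setP => a; rewrite !inE.
  apply/negP => /andP[/existsP[j1 /andP[]]]; rewrite inE => /eqP -> /existsP[b /eqP ->].
  case/existsP => j2 /andP[j2s /existsP[b2 /eqP /edisj jj2]].
  by rewrite -jj2 (negPf js) in j2s.
Qed.

End Step.

(** With mode [j] frozen, the induction hypothesis bounds the inner integral by a power of the sum
    of squares of [Bc], again a quadratic form in the draws of [j], to which [moment_quad] applies.
    Each mode costs one factor [moment_cst K * p%:R]. *)
Lemma moment_kquad (s : seq 'I_d) (p : nat) (M : finType) (B : M -> 'I_(kdim m s) -> R) :
  uniq s -> {subset s <= s0} -> (0 < p)%N ->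
  \int[P]_z ((kquad B z) ^+ p)%:E <=
    (((moment_cst K * p%:R) ^+ size s * \sum_a \sum_k B a k ^+ 2) ^+ p)%:E.
Proof.
move=> us ss p0; elim: s us ss M B => [_ _|j s ih /= /andP[js us] ss] M B.
  rewrite (eq_integral (cst ((\sum_a \sum_k B a k ^+ 2) ^+ p)%:E)); last first.
    move=> z _; congr ((_ ^+ p)%:E)%R; apply: eq_bigr => a _ /=.
    by rewrite !big_ord1 mulr1.
  by rewrite integral_prob_cst expr0 mul1r.
rewrite integral_kquad_cons//.
have ss' : {subset s <= s0} by move=> i si; apply: ss; rewrite inE si orbT.
pose c := ((moment_cst K * p%:R) ^+ size s)%R.
pose B' (ak : M * 'I_(kdim m s)) (b : 'I_(m j)) : R := B ak.1 (mxtens_index (ak.2, b)).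
have c0 : (0 <= c ^+ p)%R.
  rewrite !exprn_ge0// mulr_ge0// /moment_cst mulr_ge0 ?sqr_ge0// mulr_ge0 ?expR_ge0//.
have mlin ak : measurable_fun setT (fun z => \sum_b B' ak b * X (e b) z)%R.
  by apply: measurable_sum => b; apply: measurable_funM.
have mq : measurable_fun setT (fun z => ((\sum_ak (\sum_b B' ak b * X (e b) z) ^+ 2) ^+ p)%:E).
  apply/measurable_EFinP; apply: (measurable_funX p); apply: measurable_sum => ak.
  exact: (measurable_funX 2 (mlin ak)).
apply: (@le_trans _ _ (\int[P]_z ((c ^+ p)%:E *
    ((\sum_ak (\sum_b B' ak b * X (e b) z) ^+ 2) ^+ p)%:E))).
  apply: ge0_le_integral => //.
  - by move=> z _; apply: integral_ge0 => z' _; rewrite lee_fin exprn_ge0// kquad_ge0.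
  - exact: measurable_integral_Bc.
  - exact: measurable_funeM.
  - by move=> z _; rewrite -EFinM -exprMn -Bc_sqr; exact: ih.
have q0 z : 0 <= ((\sum_ak (\sum_b B' ak b * X (e b) z) ^+ 2) ^+ p)%:E.
  by rewrite lee_fin exprn_ge0// sumr_ge0// => ak _; rewrite sqr_ge0.
rewrite (@ge0_integralZl_EFin _ _ _ P setT measurableT _ (fun z _ => q0 z) mq _ c0).
have jD0 b : b \in index_enum 'I_(m j) -> e b \in D0.
  by move=> _; apply/eD0/ss; rewrite mem_head.
have := moment_quad indepX hK meanX psi2X (@einj j) B' (index_enum_uniq _) jD0 p0.
move=> /(lee_wpmul2l (_ : 0 <= (c ^+ p)%:E)) => /(_ _)/le_trans; apply; first by rewrite lee_fin.
rewrite -EFinM -exprMn lee_fin (@B'_sqr M j s B) le_eqVlt; apply/orP; left; apply/eqP.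
by congr (_ ^+ p)%R; rewrite /c exprS; ring.
Qed.

Lemma mean_kquad (s : seq 'I_d) (M : finType) (B : M -> 'I_(kdim m s) -> R) :
  uniq s -> {subset s <= s0} ->
  \int[P]_z (kquad B z)%:E = (\sum_a \sum_k B a k ^+ 2)%:E.
Proof.
elim: s M B => [|j s ih] M B.
  move=> _ _; rewrite (eq_integral (cst (\sum_a \sum_k B a k ^+ 2)%:E)) ?integral_prob_cst// => z _.
  by congr EFin; apply: eq_bigr => a _ /=; rewrite !big_ord1 mulr1.
move=> /= /andP[js us] ss.
have ss' : {subset s <= s0} by move=> i si; apply: ss; rewrite inE si orbT.
have := integral_kquad_cons B 1 js ss; under eq_integral do rewrite expr1; move=> ->.
under eq_integral => z _ do (under eq_integral do rewrite expr1; rewrite ih//).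
pose B' (ak : M * 'I_(kdim m s)) (b : 'I_(m j)) : R := B ak.1 (mxtens_index (ak.2, b)).
transitivity (\int[P]_z (\sum_ak ((\sum_b B' ak b * X (e b) z) ^+ 2)%:E)).
  by apply: eq_integral => z _; rewrite Bc_sqr sumEFin.
rewrite (@ge0_integral_sum _ _ _ P setT measurableT _
  (fun ak z => ((\sum_b B' ak b * X (e b) z) ^+ 2)%:E)); last 2 first.
- move=> ak; apply/measurable_EFinP; apply: (measurable_funX 2).
  by apply: measurable_sum => b; apply: measurable_funM.
- by move=> ak z _; rewrite lee_fin sqr_ge0.
have jD0 b : b \in index_enum 'I_(m j) -> e b \in D0.
  by move=> _; apply/eD0/ss; rewrite mem_head.
rewrite -(@B'_sqr M j s B) -sumEFin; apply: eq_bigr => ak _.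
exact: (second_moment_lincomb indepX hK meanX varX psi2X (@einj j) (B' ak) (index_enum_uniq _) jD0).
Qed.

End Columns.

Lemma probability_le_integral (R : realType) (dd : measure_display)
    (T : measurableType dd) (P : probability T R) (A : set T) (g : T -> R) :
  measurable A -> (forall w, 0 <= g w) -> (forall w, A w -> 1 <= g w) ->
  measurable_fun setT g -> (P A <= \int[P]_w (g w)%:E)%E.
Proof.
move=> mA g0 g1 mg.
rewrite -[A]setIT -integral_indic//.
apply: ge0_le_integral_EFin => // w.
by rewrite indicE; case: (boolP (w \in A)) => [/set_mem/g1|_].
Qed.

(** * Tails of sums of independent nonnegative variables *)

Section Tails.
Local Open Scope ereal_scope.
Context (R : realType) (dd : measure_display) (T : measurableType dd).
Variable P : probability T R.
Variables (I : finType) (X : I -> {RV P >-> R}) (D0 : {set I}).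
Hypothesis indepX : mutually_independent P D0 X.
Variables (l : nat) (D : 'I_l -> {set I}) (Z : 'I_l -> T -> R) (D2 : R).
Hypothesis D_sub : forall c, D c \subset D0.
Hypothesis D_disj : forall c c', c != c' -> [disjoint D c & D c']%B.
Hypothesis Z0 : forall c w, (0 <= Z c w)%R.
Hypothesis mZ : forall c, measurable_fun setT (Z c : sub_space X (D c) -> R).
Hypothesis meanZ : forall c, \int[P]_w (Z c w)%:E = 1.
Hypothesis sndZ : forall c, \int[P]_w ((Z c w) ^+ 2)%:E <= D2%:E.

Let mZT c : measurable_fun setT (Z c). Proof. by apply: (@sub_space_fun _ _ _ _ _ X (D c)); exact: mZ. Qed.

Lemma chernoff_sum (f : R -> R) (a b : R) :
  measurable_fun setT f ->
  (forall c, \int[P]_w (expR (f (Z c w)))%:E <= (expR b)%:E) ->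
  \int[P]_w (expR (a + \sum_c f (Z c w)))%:E <= (expR (a + l%:R * b))%:E.
Proof.
move=> mf fb.
have mfT c : measurable_fun setT (fun w => expR (f (Z c w)) : R).
  by apply: measurableT_comp => //; apply: measurableT_comp.
under eq_integral => w _ do rewrite expRD expR_sum EFinM.
rewrite (@ge0_integralZl_EFin _ _ _ P setT measurableT
   (fun w => (\prod_c expR (f (Z c w)))%:E)) ?expR_ge0//; last 2 first.
- by move=> w _; rewrite lee_fin prodr_ge0// => c _; exact: expR_ge0.
- by apply/measurable_EFinP; apply: measurable_prod.
rewrite expRD EFinM lee_wpmul2l ?lee_fin ?expR_ge0//.
rewrite (integral_prod_indep indepX (D := D) (f := fun c w => expR (f (Z c w)))) ?index_enum_uniq//; last 2 first.
- by move=> c c' _ _; exact: D_disj.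
- by move=> c _; apply: measurableT_comp => //; apply: measurableT_comp.
have -> : expR (l%:R * b) = (\prod_(c < l) expR b)%R.
  by rewrite prodr_const card_ord -expRM_natl.
have := @lee_prod_EFin R _ (index_enum 'I_l) (fun c => \int[P]_w (expR (f (Z c w)))%:E) (fun=> expR b).
case/(_ _)/andP => // c _; rewrite fb andbT.
by apply: integral_ge0 => w _; rewrite lee_fin expR_ge0.
Qed.

Lemma lower_tail : (0 < D2)%R ->
  P [set w | (\sum_c Z c w <= 3 / 4 * l%:R)%R] <= (expR (- (l%:R / (128 * D2))))%:E.
Proof.
(* The minimizer of 2 lam^2 D2 - lam / 4, the exponent per variable; the minimum is -1 / (128
   D2). *)
move=> D20; pose lam := ((16 * D2)^-1)%R.
have lam0 : (0 < lam)%R by rewrite invr_gt0 mulr_gt0.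
have mS : measurable_fun setT (fun w => \sum_c Z c w)%R by exact: measurable_sum.
pose b := (2 * lam ^+ 2 * D2 - lam)%R.
apply: (@le_trans _ _ (\int[P]_w (expR (lam * (3 / 4 * l%:R) + \sum_c - (lam * Z c w)))%:E)).
  apply: probability_le_integral.
  - rewrite (_ : [set w | _] = (fun w => \sum_c Z c w)%R @^-1` `]-oo, (3 / 4 * l%:R)%R]).
      by rewrite -[_ @^-1` _]setTI; exact: mS.
    by apply/seteqP; split => w /=; rewrite in_itv.
  - by move=> w; exact: expR_ge0.
  - move=> w /= Sw; rewrite -[leLHS]expR0 ler_expR sumrN -mulr_sumr -mulrBr.
    by rewrite mulr_ge0 ?(ltW lam0)// subr_ge0.
  - apply: measurableT_comp => //; apply: measurable_funD => //.
    by apply: measurable_sum => c; apply: measurableT_comp => //; apply: measurable_funM.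
apply: le_trans (@chernoff_sum (fun z => - (lam * z))%R _ b _ _) _.
- by apply: measurableT_comp => //; apply: measurable_funM.
- move=> c; apply: (@le_trans _ _ (1 + b)%:E); last by rewrite lee_fin expR_ge1Dx.
  have mE : measurable_fun setT (fun w => expR (- (lam * Z c w)) : R).
    by apply: measurableT_comp => //; apply: measurableT_comp => //; apply: measurable_funM.
  (* The linear term stands on the left so that both integrands are nonnegative; its mean [lam] is
     subtracted afterwards. *)
  have : \int[P]_w (expR (- (lam * Z c w)) + lam * Z c w)%:E <=
         \int[P]_w (1 + 2 * lam ^+ 2 * Z c w ^+ 2)%:E.
    apply: ge0_le_integral_EFin => [w|w||].
    + by rewrite addr_ge0 ?expR_ge0// mulr_ge0// ltW.
    + have y0 : (0 <= lam * Z c w)%R by rewrite mulr_ge0// ltW.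
      have := @expR_le_quad R (- (lam * Z c w)).
      rewrite sqrrN exprMn; move: y0; set y := (lam * Z c w)%R; set e := expR _.
      by move=> y0 H; have := H ltac:(lra); lra.
    + by apply: measurable_funD => //; apply: measurable_funM.
    + apply: measurable_funD => //; apply: measurable_funM => //.
      exact: (measurable_funX 2 (mZT c)).
  have mZe : measurable_fun setT (fun w => (Z c w)%:E) by exact/measurable_EFinP.
  have mZ2 : measurable_fun setT (fun w => (Z c w ^+ 2)%:E).
    by apply/measurable_EFinP; exact: (measurable_funX 2 (mZT c)).
  under eq_integral do rewrite EFinD EFinM.
  rewrite (@ge0_integralD _ _ _ P setT measurableT); last 4 first.
  + by move=> w _; rewrite lee_fin expR_ge0.
  + exact/measurable_EFinP.
  + by move=> w _; rewrite -EFinM lee_fin mulr_ge0// ltW.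
  + exact: measurable_funeM.
  rewrite (@ge0_integralZl_EFin _ _ _ P setT measurableT _ _ mZe _ (ltW lam0)); last first.
    by move=> w _; rewrite lee_fin.
  rewrite meanZ mule1.
  under [leRHS]eq_integral do rewrite EFinD EFinM.
  have l2 : (0 <= 2 * lam ^+ 2)%R by rewrite mulr_ge0 ?sqr_ge0.
  rewrite (@ge0_integralD _ _ _ P setT measurableT); last 4 first.
  + by move=> w _; rewrite lee_fin.
  + exact: measurable_cst.
  + by move=> w _; rewrite -EFinM lee_fin mulr_ge0 ?sqr_ge0.
  + exact: measurable_funeM.
  rewrite (@ge0_integralZl_EFin _ _ _ P setT measurableT _ _ mZ2 _ l2); last first.
    by move=> w _; rewrite lee_fin sqr_ge0.
  rewrite integral_prob_cst -leeBrDr// => /le_trans; apply.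
  apply: (@le_trans _ _ (1%:E + (2 * lam ^+ 2)%:E * D2%:E - lam%:E)).
    by rewrite leeB// leeD2l// lee_wpmul2l// lee_fin.
  by rewrite -[leLHS]/((1 + 2 * lam ^+ 2 * D2 - lam)%:E) lee_fin /b addrA.
- rewrite lee_fin ler_expR /b /lam le_eqVlt; apply/orP; left; apply/eqP.
  by field; rewrite gt_eqF.
Qed.

(* Chernoff's bound for the variables truncated at M, Markov's for the excesses. *)
Lemma upper_tail (p : nat) (M lam s B : R) :
  (0 < M)%R -> (0 <= lam)%R -> (lam * M <= 2^-1)%R ->
  (forall c, \int[P]_w ((Z c w) ^+ p)%:E <= B%:E) ->
  P [set w | (s < \sum_c Z c w)%R] <=
   (expR (l%:R * (lam + 2 * lam ^+ 2 * D2) - lam * s) + l%:R * (B / M ^+ p))%:E.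
Proof.
move=> M0 lam0 lamM BZ.
pose m z : R := Num.min z M.
have mm : measurable_fun setT m by apply: measurable_minr.
have mS : measurable_fun setT (fun w => \sum_c Z c w)%R by exact: measurable_sum.
have mp c : measurable_fun setT (fun w => (Z c w ^+ p)%:E).
  by apply/measurable_EFinP; exact: (measurable_funX p (mZT c)).
have Zp0 c w : (0 <= Z c w ^+ p)%R by rewrite exprn_ge0.
have Mp0 : (0 < M ^+ p)%R by rewrite exprn_gt0.
have mE : measurable_fun setT (fun w => expR (- (lam * s) + \sum_c lam * m (Z c w)) : R).
  apply: measurableT_comp => //; apply: measurable_funD => //.
  by apply: measurable_sum => c; apply: measurable_funM => //; apply: measurableT_comp.
have mP : measurable_fun setT (fun w => \sum_c (M ^+ p)^-1 * Z c w ^+ p)%R.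
  by apply: measurable_sum => c; apply: measurable_funM => //; exact: (measurable_funX p (mZT c)).
have P0 w : (0 <= \sum_c (M ^+ p)^-1 * Z c w ^+ p)%R.
  by apply: sumr_ge0 => c _; rewrite mulr_ge0 ?invr_ge0 ?(ltW Mp0).
apply: (@le_trans _ _ (\int[P]_w (expR (- (lam * s) + \sum_c lam * m (Z c w)) +
     \sum_c (M ^+ p)^-1 * Z c w ^+ p)%:E)).
  apply: probability_le_integral.
  - rewrite (_ : [set w | _] = (fun w => \sum_c Z c w)%R @^-1` `]s, +oo[).
      by rewrite -[_ @^-1` _]setTI; exact: mS.
    by apply/seteqP; split => w /=; rewrite in_itv/= andbT.
  - by move=> w; rewrite addr_ge0 ?expR_ge0.
  (* Either no variable exceeds [M] and truncation changes nothing, or one does and its Markov term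
     alone is at least 1. *)
  - move=> w /= Sw; have [/forallP big|] := boolP [forall c, Z c w <= M]%R.
      rewrite -[leLHS]addr0 lerD//.
      rewrite -[leLHS]expR0 ler_expR -mulr_sumr addrC -mulrBr mulr_ge0//.
      rewrite subr_ge0 (le_trans (ltW Sw))//; apply: ler_sum => c _.
      by rewrite /m min_l.
    rewrite negb_forall => /existsP[c]; rewrite -ltNge => Mc.
    rewrite -[leLHS]add0r lerD ?expR_ge0// (bigD1 c)//= -[leLHS]addr0 lerD//.
      by rewrite mulrC ler_pdivlMr// mul1r lerXn2r// ?nnegrE ?(ltW M0)// ltW.
    by apply: sumr_ge0 => c' _; rewrite mulr_ge0 ?invr_ge0 ?(ltW Mp0).
  - exact: measurable_funD.
under eq_integral do rewrite EFinD.
rewrite (@ge0_integralD _ _ _ P setT measurableT); last 4 first.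
- by move=> w _; rewrite lee_fin expR_ge0.
- exact/measurable_EFinP.
- by move=> w _; rewrite lee_fin.
- exact/measurable_EFinP.
rewrite EFinD; apply: leeD.
  apply: le_trans (@chernoff_sum (fun z => lam * m z)%R _ (lam + 2 * lam ^+ 2 * D2)%R _ _) _.
  - by apply: measurable_funM.
  - move=> c; apply: (@le_trans _ _ (1 + (lam + 2 * lam ^+ 2 * D2))%:E); last by rewrite lee_fin expR_ge1Dx.
    have mZe : measurable_fun setT (fun w => (Z c w)%:E) by exact/measurable_EFinP.
    have mZ2 : measurable_fun setT (fun w => (Z c w ^+ 2)%:E).
      by apply/measurable_EFinP; exact: (measurable_funX 2 (mZT c)).
    have l2 : (0 <= 2 * lam ^+ 2)%R by rewrite mulr_ge0 ?sqr_ge0.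
    apply: (@le_trans _ _ (\int[P]_w (1 + (lam * Z c w + 2 * lam ^+ 2 * Z c w ^+ 2))%:E)).
      apply: ge0_le_integral_EFin => [w|w||].
      + exact: expR_ge0.
      + have m0 : (0 <= m (Z c w))%R by rewrite /m le_min Z0 ltW.
        have mZw : (m (Z c w) <= Z c w)%R by rewrite /m ge_min lexx.
        apply: le_trans (@expR_le_quad R (lam * m (Z c w)) _) _.
          by apply: le_trans lamM; rewrite ler_wpM2l// /m ge_min lexx orbT.
        rewrite -addrA lerD2l lerD// ?ler_wpM2l// exprMn mulrA ler_wpM2l//.
        by rewrite lerXn2r ?nnegrE.
      + by apply: measurableT_comp => //; apply: measurable_funM => //; apply: measurableT_comp.
      + apply: measurable_funD => //; apply: measurable_funD; apply: measurable_funM => //.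
        exact: (measurable_funX 2 (mZT c)).
    under eq_integral do rewrite EFinD EFinD EFinM [X in (_ + (_ + X))%E]EFinM.
    have n1 w : 0 <= lam%:E * (Z c w)%:E by rewrite -EFinM lee_fin mulr_ge0.
    have n2 w : 0 <= (2 * lam ^+ 2)%:E * (Z c w ^+ 2)%:E.
      by rewrite -EFinM lee_fin mulr_ge0// sqr_ge0.
    have m1 : measurable_fun setT (fun w => lam%:E * (Z c w)%:E) by exact: measurable_funeM.
    have m2 : measurable_fun setT (fun w => (2 * lam ^+ 2)%:E * (Z c w ^+ 2)%:E).
      exact: measurable_funeM.
    rewrite (@ge0_integralD _ _ _ P setT measurableT); last 4 first.
    + by move=> w _; rewrite lee_fin.
    + exact: measurable_cst.
    + by move=> w _; exact: adde_ge0.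
    + exact: emeasurable_funD.
    rewrite (@ge0_integralD _ _ _ P setT measurableT)//.
    rewrite (@ge0_integralZl_EFin _ _ _ P setT measurableT _ _ mZe _ lam0); last first.
      by move=> w _; rewrite lee_fin.
    rewrite (@ge0_integralZl_EFin _ _ _ P setT measurableT _ _ mZ2 _ l2); last first.
      by move=> w _; rewrite lee_fin sqr_ge0.
    rewrite meanZ mule1 integral_prob_cst EFinD EFinD leeD2l// leeD2l//.
    by rewrite (EFinM (2 * lam ^+ 2)) lee_wpmul2l ?lee_fin.
  - by rewrite addrC.
under eq_integral do rewrite -sumEFin.
have Mi0 : (0 <= (M ^+ p)^-1)%R by rewrite invr_ge0 ltW.
rewrite (@ge0_integral_sum _ _ _ P setT measurableT _
  (fun c w => ((M ^+ p)^-1 * Z c w ^+ p)%:E)); last 2 first.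
- by move=> c; under eq_fun do rewrite EFinM; apply: measurable_funeM.
- by move=> c w _; rewrite lee_fin mulr_ge0.
rewrite (_ : (l%:R * (B / M ^+ p))%:E = \sum_(c < l) ((M ^+ p)^-1 * B)%:E); last first.
  by rewrite sumEFin sumr_const card_ord mulr_natl [(B / _)%R]mulrC.
apply: lee_sum => c _; under eq_integral do rewrite EFinM.
rewrite (@ge0_integralZl_EFin _ _ _ P setT measurableT _ _ (mp c) _ Mi0); last first.
  by move=> w _; rewrite lee_fin.
by rewrite (EFinM _ B) lee_wpmul2l ?lee_fin.
Qed.

End Tails.

(** * Choice of the truncation level and of the other tail parameters *)

Section Arith.
Variable R : realType.
Implicit Types L G c x : R.

Lemma expR1_ge2 : 2 <= expR 1 :> R.
Proof. by have := expR_ge1Dx (1 : R); lra. Qed.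

Lemma expR1_le4 : expR 1 <= 4 :> R.
Proof.
have h : 2^-1 <= expR (- 2^-1) :> R by have := expR_ge1Dx (- 2^-1 : R); lra.
have : expR 2^-1 <= 2 :> R.
  by rewrite -[2^-1]opprK expRN -[leRHS]invrK lef_pV2 ?posrE ?expR_gt0// invr_gt0.
move=> h2; rewrite [in leLHS](_ : 1 = 2^-1 + 2^-1); last by lra.
rewrite expRD (_ : 4 = 2 * 2); last by ring.
by rewrite ler_pM ?expR_ge0.
Qed.

Lemma expRN2_le L : 2 <= L -> expR (- (2 * L)) <= expR (- L) / 4.
Proof.
move=> L2; rewrite (_ : - (2 * L) = - L + - L); last by ring.
rewrite expRD ler_pM2l ?expR_gt0// expRN lef_pV2 ?posrE ?expR_gt0//.
apply: (@le_trans _ _ (expR (1 + 1))); last by rewrite ler_expR; lra.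
by rewrite expRD; have := expR1_ge2; nra.
Qed.

(* Parameters for [upper_tail].  The choice lam = 3 L / (l G) makes the linear term of the
   exponent -3 L.  If l <= exp (3 L (k + 1)), then M = (e c0 p)^k with p of order 8 L turns
   Markov's bound into exp (- k p); for larger l the eighth moment is enough, with M of
   order l^(1/4). *)
Lemma upper_tail_params c0 L G (k l : nat) : 1 <= c0 -> 2 <= L -> (0 < k)%N -> (0 < l)%N ->
  let C := 9 * expR 1 * c0 in
  C ^+ k.+1 * Num.max (Num.sqrt L / Num.sqrt l%:R) (L ^+ k.+1 / l%:R) <= G ->
  exists p M lam, [/\ (0 < p)%N, 0 < M, 0 <= lam, lam * M <= 2^-1 &
    expR (l%:R * (lam + 2 * lam ^+ 2 * ((c0 * 2) ^+ k) ^+ 2) - lam * (l%:R * (1 + G)))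
     + l%:R * (((c0 * p%:R) ^+ k) ^+ p / M ^+ p) <= expR (- L) / 2].
Proof.
move=> c1 L2 k0 l0 C; set D2 := ((c0 * 2) ^+ k) ^+ 2.
have l0' : 0 < l%:R :> R by rewrite ltr0n.
have e2 := expR1_ge2.
have L0 : 0 < L by lra.
have C18 : 18 * c0 <= C by rewrite /C; nra.
have C1 : 18 <= C by lra.
have C0 : 0 < C by lra.
have Ck0 n : 0 < C ^+ n by rewrite exprn_gt0.
rewrite maxr_pMr ?(ltW (Ck0 _))// ge_max => /andP[G1 G2].
have G0 : 0 < G.
  by apply: lt_le_trans G2; rewrite mulr_gt0// divr_gt0// exprn_gt0.
have lG : 0 < l%:R * G by rewrite mulr_gt0.
(* Makes the quadratic term of the exponent at most [L], which turns -3 L into -2 L. *)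
have ii : 18 * L * D2 <= l%:R * G ^+ 2.
  have : (C ^+ k.+1 * (Num.sqrt L / Num.sqrt l%:R)) ^+ 2 <= G ^+ 2.
    by rewrite lerXn2r ?nnegrE ?(ltW G0)// mulr_ge0 ?divr_ge0 ?sqrtr_ge0 ?(ltW (Ck0 _)).
  rewrite exprMn expr_div_n !sqr_sqrtr ?(ltW L0)// => H.
  apply: le_trans (ler_wpM2l (ltW l0') H).
  rewrite (_ : l%:R * _ = L * (C ^+ k.+1) ^+ 2); last by field; rewrite gt_eqF.
  rewrite [18 * L]mulrC -mulrA ler_pM2l// [C ^+ k.+1]exprS exprMn.
  have D20 : 0 <= D2 by rewrite sqr_ge0.
  have D2C : D2 <= (C ^+ k) ^+ 2.
    rewrite /D2 lerXn2r ?nnegrE ?exprn_ge0//; try lra.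
    by rewrite lerXn2r ?nnegrE; lra.
  have C2 : 18 <= C ^+ 2 by rewrite expr2; nra.
  exact: ler_pM.
pose lam := 3 * L / (l%:R * G).
have lam0 : 0 <= lam by rewrite divr_ge0 ?(ltW lG)//; lra.
have expo : expR (l%:R * (lam + 2 * lam ^+ 2 * D2) - lam * (l%:R * (1 + G))) <= expR (- L) / 4.
  apply: le_trans (expRN2_le L2); rewrite ler_expR.
  rewrite (_ : _ - _ = L * (18 * L * D2) / (l%:R * G ^+ 2) - 3 * L); last first.
    by rewrite /lam; field; rewrite !gt_eqF.
  have : L * (18 * L * D2) / (l%:R * G ^+ 2) <= L.
    by rewrite ler_pdivrMr ?mulr_gt0 ?exprn_gt0// ler_pM2l.
  lra.
suff [p [M [p0 M0 i tail]]] : exists p M, [/\ (0 < p)%N, 0 < M, 6 * L * M <= l%:R * G &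
    l%:R * (((c0 * p%:R) ^+ k) ^+ p / M ^+ p) <= expR (- L) / 4].
  exists p, M, lam; split => //.
    rewrite /lam mulrAC ler_pdivrMr//; lra.
  by lra.
have lGC : (C * L) ^+ k.+1 <= l%:R * G.
  apply: le_trans (ler_wpM2l (ltW l0') G2); rewrite exprMn le_eqVlt; apply/orP; left; apply/eqP.
  by field; rewrite gt_eqF.
have [lsmall|lbig] := leP l%:R (expR (3 * L * k.+1%:R)).
(* The bound p <= 9 L is the origin of the 9 in [C]. From p >= 8 L, the Markov term is at most exp
   (3 L (k + 1) - 8 L k), and k >= 1 brings it below exp (-2 L). *)
- pose p := (Num.truncn (8 * L)).+1.
  have [p8 p9] : 8 * L <= p%:R /\ p%:R <= 9 * L.
    have := @truncn_itv R (8 * L) ltac:(lra) => /andP[H1 H2]; rewrite /p; split; first exact: ltW.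
    by rewrite -natr1; lra.
  have cp0 : 0 < c0 * p%:R by rewrite mulr_gt0 ?ltr0n//; lra.
  exists p, ((expR 1 * (c0 * p%:R)) ^+ k); split => //.
  + by rewrite exprn_gt0// mulr_gt0// expR_gt0.
  + apply: le_trans lGC; rewrite exprS; apply: ler_pM.
    * by lra.
    * by rewrite exprn_ge0// mulr_ge0 ?expR_ge0 ?(ltW cp0).
    * by rewrite ler_wpM2r ?(ltW L0)//; lra.
    * have b0 : 0 <= expR 1 * (c0 * p%:R) by rewrite mulr_ge0 ?expR_ge0 ?(ltW cp0).
      have b1 : 0 <= C * L by rewrite mulr_ge0 ?(ltW C0) ?(ltW L0).
      rewrite lerXn2r ?nnegrE// /C.
      rewrite (_ : 9 * expR 1 * c0 * L = expR 1 * (c0 * (9 * L))); last by ring.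
      by rewrite ler_wpM2l ?expR_ge0// ler_wpM2l//; lra.
  + rewrite (_ : l%:R * _ = l%:R * expR (- (k%:R * p%:R))); last first.
      congr (_ * _); rewrite (exprMn k (expR 1)) (exprMn p (expR 1 ^+ k)).
      rewrite invfM mulrCA divff ?expf_neq0 ?gt_eqF// mulr1 expRN; congr (_^-1).
      by rewrite -expRM_natl -expRM_natl; congr expR; ring.
    apply: le_trans (expRN2_le L2).
    apply: (@le_trans _ _ (expR (3 * L * k.+1%:R) * expR (- (k%:R * p%:R)))).
      by rewrite ler_wpM2r// expR_ge0.
    rewrite -expRD ler_expR.
    have k1 : 1 <= k%:R :> R by rewrite ler1n.
    have : k%:R * (8 * L) <= k%:R * p%:R by rewrite ler_wpM2l.
    rewrite -natr1; nra.
(* With the fourth root of [l], the eighth power of [M] contributes l^2 and leaves 1 / l in Markov's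
   bound. *)
- pose q : R := Num.sqrt (Num.sqrt l%:R).
  have q0 : 0 < q by rewrite !sqrtr_gt0.
  have q4 : q ^+ 4 = l%:R by rewrite (exprM _ 2 2) !sqr_sqrtr// sqrtr_ge0.
  have Lq : L <= q.
    rewrite -(@ler_pXn2r _ 4)// ?nnegrE ?(ltW L0) ?(ltW q0)// q4.
    apply: le_trans (ltW lbig).
    apply: (@le_trans _ _ (expR L ^+ 4)).
      rewrite lerXn2r ?nnegrE ?expR_ge0 ?(ltW L0)//.
      by have := expR_ge1Dx L; lra.
    rewrite -expRM_natl ler_expR.
    have k1 : 1 <= k%:R :> R by rewrite ler1n.
    by rewrite -natr1; nra.
  exists 8%N, ((c0 * 8) ^+ k * q); split => //.
  + by rewrite mulr_gt0// exprn_gt0// mulr_gt0//; lra.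
  + apply: (@le_trans _ _ (C ^+ k.+1 * q ^+ 2)).
      rewrite exprS expr2 (_ : 6 * L * _ = (6 * (c0 * 8) ^+ k) * (L * q)); last by ring.
      apply: ler_pM.
      * by rewrite mulr_ge0// exprn_ge0//; lra.
      * by rewrite mulr_ge0// ltW.
      * apply: ler_pM => //; [by rewrite exprn_ge0//; lra|lra|].
        by rewrite lerXn2r ?nnegrE//; lra.
      * by rewrite ler_pM2r.
    apply: le_trans (ler_wpM2l (ltW l0') G1).
    rewrite [leRHS]mulrCA ler_pM2l//.
    rewrite -[in leRHS]q4 (_ : Num.sqrt (q ^+ 4) = q ^+ 2); last first.
      by rewrite (exprM _ 2 2) sqrtr_sqr ger0_norm ?sqr_ge0.
    rewrite (_ : q ^+ 4 * _ = q ^+ 2 * Num.sqrt L); last by field; rewrite gt_eqF.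
    rewrite ler_pMr ?exprn_gt0// -[leLHS](sqrtr1 R) ler_sqrt//; lra.
  + rewrite (exprMn 8 ((c0 * 8) ^+ k)) invfM [X in _ * X]mulrA divff ?mul1r; last first.
      by rewrite !expf_neq0// mulf_neq0//; lra.
    rewrite (exprM _ 4 2) q4 (_ : _ * _ = l%:R^-1); last by field; rewrite gt_eqF.
    apply: le_trans (expRN2_le L2).
    apply: (@le_trans _ _ (expR (- (3 * L * k.+1%:R)))).
      by rewrite expRN lef_pV2 ?posrE ?expR_gt0// ltW.
    rewrite ler_expR.
    have k1 : 1 <= k%:R :> R by rewrite ler1n.
    by rewrite -natr1; nra.
Qed.

End Arith.

Section ColumnTails.
Local Open Scope ereal_scope.
Context (R : realType) (dd : measure_display) (T : measurableType dd).
Variable P : probability T R.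
Variables (I : finType) (X : I -> {RV P >-> R}) (D0 : {set I}) (K : R).
Hypothesis indepX : mutually_independent P D0 X.
Hypothesis hK : (1 <= K)%R.
Hypothesis meanX : forall e, e \in D0 -> 'E_P[X e] = 0.
Hypothesis varX : forall e, e \in D0 -> 'V_P[X e] = 1.
Hypothesis psi2X : forall e, e \in D0 -> subgaussian_norm P (X e) <= K%:E.

Variables (d l : nat) (m : 'I_d -> nat) (e : 'I_l -> forall j : 'I_d, 'I_(m j) -> I).
Variable s : seq 'I_d.
Hypothesis us : uniq s.
Hypothesis einj : forall c j, injective (e c (j := j)).
Hypothesis edisj : forall c c' j j' b b',
  e c (j := j) b = e c' (j := j') b' -> c = c' /\ j = j'.
Hypothesis eD0 : forall c j b, j \in s -> e c (j := j) b \in D0.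

Local Notation c0 := (moment_cst K).

Lemma moment_cst_ge1 : (1 <= c0)%R.
Proof.
rewrite /moment_cst; have K2 : (1 <= K ^+ 2)%R by rewrite exprn_ege1.
have e1 : (1 <= expR 1 :> R)%R by have := expR1_ge2 R; lra.
by rewrite mulr_ege1// mulr_ege1// ler1n.
Qed.

Section Quad.
Variables (M : finType) (B : M -> 'I_(kdim m s) -> R).
Let beta := (\sum_a \sum_k B a k ^+ 2)%R.
(** The squared norm of [B] times the whole sketching matrix, as a sum over its independent columns;
    see [sum_kquad_sqn]. *)
Definition sum_kquad (w : T) := (\sum_c kquad X (e c) B w)%R.

Let Dc c := mode_entries (e c) s.

Let Dc_sub c : Dc c \subset D0.
Proof. by apply/fintype.subsetP => a /mode_entriesP[j js [b ->]]; exact: eD0. Qed.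

Let Dc_disj c c' : c != c' -> [disjoint Dc c & Dc c']%B.
Proof.
move=> cc'; rewrite -setI_eq0; apply/eqP/finset.setP => a; rewrite finset.in_setI finset.in_set0.
apply/negP => /andP[/mode_entriesP[j _ [b ->]] /mode_entriesP[j' _ [b' /edisj[]]]].
by move=> cc; rewrite cc eqxx in cc'.
Qed.

Let mq c : measurable_fun setT (kquad X (e c) B : sub_space X (Dc c) -> R).
Proof. exact: measurable_kquad. Qed.

Lemma measurable_sum_kquad : measurable_fun setT sum_kquad.
Proof.
apply: measurable_sum => c; apply: (@sub_space_fun _ _ _ _ _ X (Dc c)); exact: mq.
Qed.

Let mqT c : measurable_fun setT (kquad X (e c) B).
Proof. by apply: (@sub_space_fun _ _ _ _ _ X (Dc c)); exact: mq. Qed.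

Let beta0 : (0 <= beta)%R.
Proof. by apply: sumr_ge0 => a _; apply: sumr_ge0 => k _; exact: sqr_ge0. Qed.

Lemma kquad_eq0 c w : beta = 0%R -> kquad X (e c) B w = 0%R.
Proof.
move=> /psumr_eq0P b0; apply: big1 => a _.
have /psumr_eq0P ba : (\sum_k B a k ^+ 2 = 0)%R.
  by apply: b0 => // i _; apply: sumr_ge0 => k _; exact: sqr_ge0.
rewrite big1 ?expr0n// => k _; have /eqP := ba (fun k _ => sqr_ge0 _) k isT.
by rewrite sqrf_eq0 => /eqP ->; rewrite mul0r.
Qed.

Section Pos.
Hypothesis bpos : (0 < beta)%R.
Let Z c w := (beta^-1 * kquad X (e c) B w)%R.

Let Z0 c w : (0 <= Z c w)%R.
Proof. by rewrite mulr_ge0 ?invr_ge0// kquad_ge0. Qed.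

Let mZ c : measurable_fun setT (Z c : sub_space X (Dc c) -> R).
Proof. by apply: measurable_funM; [exact: measurable_cst|exact: mq]. Qed.

Let bi0 : (0 <= beta^-1)%R. Proof. by rewrite invr_ge0. Qed.

Let meanZ c : \int[P]_w (Z c w)%:E = 1.
Proof.
have mqE : measurable_fun setT (fun w => (kquad X (e c) B w)%:E) by exact/measurable_EFinP.
under eq_integral do rewrite EFinM.
rewrite (@ge0_integralZl_EFin _ _ _ P setT measurableT _ _ mqE _ bi0); last first.
  by move=> w _; rewrite lee_fin kquad_ge0.
rewrite (@mean_kquad _ _ _ P _ X D0 K indepX hK meanX varX psi2X d m (e c) (einj (c := c)) _ s)//.
- by rewrite -EFinM mulVf// gt_eqF.
- by move=> j j' b b' /edisj[].
- by move=> j b; exact: eD0.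
Qed.

Let momZ c p : (0 < p)%N -> \int[P]_w (Z c w ^+ p)%:E <= (((c0 * p%:R) ^+ size s) ^+ p)%:E.
Proof.
move=> p0; have mqE : measurable_fun setT (fun w => (kquad X (e c) B w ^+ p)%:E).
  by apply/measurable_EFinP; exact: (measurable_funX p (mqT c)).
under eq_integral do rewrite exprMn EFinM.
rewrite (@ge0_integralZl_EFin _ _ _ P setT measurableT _ _ mqE); last 2 first.
- by move=> w _; rewrite lee_fin exprn_ge0// kquad_ge0.
- by rewrite exprn_ge0.
have := @moment_kquad _ _ _ P _ X D0 K indepX hK meanX psi2X d m (e c) (einj (c := c)) _ s _ s p M B us _ p0.
move=> /(_ (fun j j' b b' h => proj2 (edisj h)) (fun j b => eD0 c b) (fun _ => id)).
have bp0 : 0 <= (beta^-1 ^+ p)%:E by rewrite lee_fin exprn_ge0.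
move=> /(lee_wpmul2l bp0)/le_trans; apply.
rewrite -EFinM lee_fin -exprMn -/beta le_eqVlt; apply/orP; left; apply/eqP.
by congr (_ ^+ p)%R; rewrite mulrCA mulVf ?mulr1// gt_eqF.
Qed.

Let sumZ w : (\sum_c Z c w)%R = (sum_kquad w / beta)%R.
Proof. by rewrite -mulr_sumr mulrC. Qed.

Lemma kquad_lower_pos :
  P [set w | (sum_kquad w <= 3 / 4 * l%:R * beta)%R] <=
    (expR (- (l%:R / (128 * ((c0 * 2) ^+ size s) ^+ 2))))%:E.
Proof.
have := @lower_tail _ _ _ P _ X D0 indepX l Dc Z (((c0 * 2) ^+ size s) ^+ 2)%R Dc_sub Dc_disj Z0 mZ meanZ.
move=> /(_ (fun c => momZ c (isT : 0 < 2)%N)).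
have D20 : (0 < ((c0 * 2) ^+ size s) ^+ 2)%R.
  by rewrite !exprn_gt0// mulr_gt0// (lt_le_trans ltr01 moment_cst_ge1).
move=> /(_ D20); congr (_ <= _); congr (P _); apply/seteqP; split => w /=;
  by rewrite sumZ ler_pdivrMr.
Qed.

Lemma kquad_upper_pos (L G : R) : (2 <= L)%R -> (0 < size s)%N -> (0 < l)%N ->
  ((9 * expR 1 * c0) ^+ (size s).+1 *
     Num.max (Num.sqrt L / Num.sqrt l%:R) (L ^+ (size s).+1 / l%:R) <= G)%R ->
  P [set w | ((1 + G) * (l%:R * beta) < sum_kquad w)%R] <= (expR (- L) / 2)%:E.
Proof.
move=> L2 s0 l0 HG.
have [p [M' [lam [p0 M0 lam0 lamM H]]]] := upper_tail_params moment_cst_ge1 L2 s0 l0 HG.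
have := @upper_tail _ _ _ P _ X D0 indepX l Dc Z (((c0 * 2) ^+ size s) ^+ 2)%R Dc_sub Dc_disj Z0 mZ meanZ.
move=> /(_ (fun c => momZ c (isT : 0 < 2)%N)).
move=> /(_ p M' lam (l%:R * (1 + G))%R _ M0 lam0 lamM (fun c => momZ c p0)).
move=> /le_trans => /(_ (expR (- L) / 2)%:E); rewrite lee_fin => /(_ H).
congr (_ <= _); congr (P _); apply/seteqP; split => w /=;
  by rewrite sumZ ltr_pdivlMr//; congr (_ < _)%R; ring.
Qed.

End Pos.

(** The strict inequality makes the event empty when [beta = 0], the case excluded by the
    normalization by [beta] in [kquad_lower_pos]. *)
Lemma kquad_lower :
  P [set w | (sum_kquad w < 3 / 4 * l%:R * beta)%R] <=
    (expR (- (l%:R / (128 * ((c0 * 2) ^+ size s) ^+ 2))))%:E.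
Proof.
have mS (B' : set R) : measurable B' -> measurable (sum_kquad @^-1` B').
  by move=> mB; rewrite -[_ @^-1` _]setTI; exact: measurable_sum_kquad.
have [b0|b0] := eqVneq beta 0%R.
  rewrite (_ : [set w | _] = set0) ?measure0 ?lee_fin ?expR_ge0//.
  apply/seteqP; split => // w /=; rewrite b0 mulr0 ltNge.
  by rewrite sumr_ge0// => c _; exact: kquad_ge0.
have bpos : (0 < beta)%R by rewrite lt_def b0.
apply: le_trans (kquad_lower_pos bpos); apply: le_measure; rewrite ?inE.
- rewrite (_ : [set w | _] = sum_kquad @^-1` `]-oo, (3 / 4 * l%:R * beta)%R[); first exact: mS.
  by apply/seteqP; split => w /=; rewrite in_itv.
- rewrite (_ : [set w | _] = sum_kquad @^-1` `]-oo, (3 / 4 * l%:R * beta)%R]); first exact: mS.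
  by apply/seteqP; split => w /=; rewrite in_itv.
- by move=> w /=; exact: ltW.
Qed.

Lemma kquad_upper (L G : R) : (2 <= L)%R -> (0 < size s)%N -> (0 < l)%N ->
  ((9 * expR 1 * c0) ^+ (size s).+1 *
     Num.max (Num.sqrt L / Num.sqrt l%:R) (L ^+ (size s).+1 / l%:R) <= G)%R ->
  P [set w | ((1 + G) * (l%:R * beta) < sum_kquad w)%R] <= (expR (- L) / 2)%:E.
Proof.
move=> L2 s0 l0 HG; have [b0|b0] := eqVneq beta 0%R; last first.
  by apply: kquad_upper_pos => //; rewrite lt_def b0.
rewrite (_ : [set w | _] = set0) ?measure0 ?lee_fin ?divr_ge0 ?expR_ge0//.
apply/seteqP; split => // w /=; rewrite b0 !mulr0 /sum_kquad big1 ?ltxx// => c _.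
exact: kquad_eq0.
Qed.

End Quad.
End ColumnTails.

Lemma probability_le_sum (R : realType) (dd : measure_display)
    (T : measurableType dd) (P : probability T R) (J : finType)
    (A : J -> set T) (B : set T) :
  (forall i, measurable (A i)) -> measurable B -> (forall w, B w -> exists i, A i w) ->
  (P B <= \sum_i P (A i))%E.
Proof.
move=> mA mB BA; pose g w : R := \sum_i \1_(A i) w.
apply: (@le_trans _ _ (\int[P]_w (g w)%:E)%E).
  apply: probability_le_integral => //.
  - by move=> w; apply: sumr_ge0 => i _; rewrite indicE.
  - move=> w /BA[i Aiw]; rewrite /g (bigD1 i)//= indicE mem_set// lerDl.
    by apply: sumr_ge0 => j _; rewrite indicE.
  - by apply: measurable_sum => i; exact: measurable_indic.
rewrite /g; under eq_integral do rewrite -sumEFin.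
rewrite ge0_integral_sum//.
- by apply: lee_sum => i _; rewrite integral_indic// setIT.
- by move=> i; apply/measurable_EFinP; exact: measurable_indic.
Qed.

(** * Numerical consequences of the lower bound on the sketch size *)

Section SizeBounds.
Variable R : realType.
Variables (c0 L Lr l : R) (d r : nat).
Local Notation C1 := (9 * expR 1 * c0).
Hypotheses (c1 : 1 <= c0) (L2 : 2 <= L) (Lr_ge : L + r%:R <= Lr) (d2 : (2 <= d)%N).
Hypothesis hsize : (C1 ^+ 2) ^+ d * Lr ^+ d <= l.

Let e2 : 2 <= expR 1 :> R. Proof. exact: expR1_ge2. Qed.

Let C1_ge : 18 * c0 <= C1.
Proof. by have := e2; have := c1 => h1 h2; nra. Qed.

Let LLr : L <= Lr.
Proof. by apply: le_trans Lr_ge; rewrite lerDl. Qed.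

Lemma size_pos : 0 < l.
Proof.
have [[[h1 h2] h3] h4] := (C1_ge, c1, LLr, L2).
by apply: lt_le_trans hsize; rewrite mulr_gt0// !exprn_gt0//; lra.
Qed.

(** The square-root term is what requires [C1 ^+ 2] in the size condition. A deviation of at most 1
    keeps the squared norm of V Om below 2 l t, as the grid argument requires. *)
Lemma deviation_le1 : C1 ^+ d * Num.max (Num.sqrt L / Num.sqrt l) (L ^+ d / l) <= 1.
Proof.
have [[[h1 h2] h3] h4] := (C1_ge, c1, LLr, L2); have l0 := size_pos.
have C0 : 0 < C1 by lra.
have Cd0 : 0 < C1 ^+ d by rewrite exprn_gt0.
have L0 : 0 < L by lra.
have LLd : (C1 ^+ d) ^+ 2 * L ^+ d <= l.
  apply: le_trans hsize; rewrite -!exprM mulnC; apply: ler_wpM2l.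
    by rewrite exprn_ge0 ?(ltW C0).
  by rewrite lerXn2r ?nnegrE//; lra.
have C1d : 1 <= C1 ^+ d by rewrite exprn_ege1//; lra.
rewrite maxr_pMr ?(ltW Cd0)// ge_max; apply/andP; split.
  rewrite mulrA ler_pdivrMr ?sqrtr_gt0// mul1r.
  rewrite -(@ler_pXn2r _ 2)// ?nnegrE ?mulr_ge0 ?sqrtr_ge0 ?(ltW Cd0)//.
  rewrite exprMn !sqr_sqrtr ?(ltW L0) ?(ltW l0)//.
  apply: le_trans LLd; rewrite ler_wpM2l ?sqr_ge0//.
  case: d d2 => // d' _; rewrite exprS ler_peMr ?(ltW L0)// exprn_ege1//; lra.
rewrite mulrA ler_pdivrMr// mul1r; apply: le_trans LLd.
rewrite ler_wpM2r ?exprn_ge0 ?(ltW L0)// expr2 ler_peMr ?(ltW Cd0)//.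
Qed.

(* The exponent is of order Lr^d with d >= 2, which beats the exp (O(r^2)) grid points. *)
Lemma net_union_bound t : (t <= r)%N ->
  ((2 * (20 * t)).+1 ^ t)%:R * expR (- (l / (128 * ((c0 * 2) ^+ d.-1) ^+ 2))) <=
    expR (- L) / 4.
Proof.
move=> tr; have [[[h1 h2] h3] h4] := (C1_ge, c1, LLr, L2); have l0 := size_pos.
set D2 := ((c0 * 2) ^+ d.-1) ^+ 2.
have D20 : 0 < D2 by rewrite !exprn_gt0//; lra.
have Lr0 : 0 < Lr by lra.
(* 205 < 324 * 81 / 128: here 324 = 18^2 bounds one factor [C1 ^+ 2], and 81 compares the remaining
   ones with [D2], since 18 c0 = 9 (2 c0). *)
have lD : 205 * Lr ^+ 2 <= l / (128 * D2).
  rewrite ler_pdivlMr; last by rewrite mulr_gt0.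
  apply: le_trans hsize.
  have -> : (C1 ^+ 2) ^+ d = C1 ^+ 2 * (C1 ^+ 2) ^+ d.-1 by case: d d2 => // d' _; rewrite exprS.
  have C2 : 324 <= C1 ^+ 2 by rewrite expr2; nra.
  have Ck : 81 * D2 <= (C1 ^+ 2) ^+ d.-1.
    have k0 : (0 < d.-1)%N by case: d d2 => [|[]].
    apply: (@le_trans _ _ ((81 * (c0 * 2) ^+ 2) ^+ d.-1)).
      rewrite exprMn /D2 -!exprM [(2 * d.-1)%N]mulnC ler_wpM2r ?exprn_ge0//; first lra.
      by rewrite ler_eXnr// ler1n.
    rewrite lerXn2r ?nnegrE ?sqr_ge0//; first by rewrite mulr_ge0// sqr_ge0.
    rewrite (_ : 81 * (c0 * 2) ^+ 2 = (18 * c0) ^+ 2); last by ring.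
    by rewrite lerXn2r ?nnegrE; lra.
  have Lrd : Lr ^+ 2 <= Lr ^+ d.
    by apply: ler_weXn2l => //; lra.
  have : 324 * (81 * D2) * Lr ^+ 2 <= C1 ^+ 2 * (C1 ^+ 2) ^+ d.-1 * Lr ^+ d.
    have D81 : 0 <= 81 * D2 by rewrite mulr_ge0// ltW.
    have n324 : 0 <= 324 :> R by exact: ler0n.
    exact: ler_pM (mulr_ge0 n324 D81) (sqr_ge0 _) (ler_pM n324 D81 C2 Ck) Lrd.
  have : 0 <= D2 * Lr ^+ 2 by rewrite mulr_ge0 ?sqr_ge0 ?(ltW D20).
  lra.
have cardN : ((2 * (20 * t)).+1 ^ t)%:R <= expR (40 * r%:R ^+ 2) :> R.
  rewrite natrX; apply: (@le_trans _ _ (expR (40 * t%:R) ^+ t)).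
    rewrite lerXn2r ?nnegrE ?expR_ge0//.
    by apply: le_trans (expR_ge1Dx _); rewrite -natr1 !natrM; lra.
  rewrite -expRM_natl ler_expR.
  have : t%:R ^+ 2 <= r%:R ^+ 2 :> R by rewrite lerXn2r ?nnegrE// ler_nat.
  by rewrite !expr2; lra.
apply: le_trans (expRN2_le L2).
apply: (@le_trans _ _ (expR (40 * r%:R ^+ 2) * expR (- (205 * Lr ^+ 2)))).
  by apply: ler_pM => //; rewrite ?expR_ge0// ler_expR lerN2.
rewrite -expRD ler_expR.
have : (L + r%:R) ^+ 2 <= Lr ^+ 2 by rewrite lerXn2r ?nnegrE ?addr_ge0//; lra.
have r0 : 0 <= r%:R :> R by [].
have := sqr_ge0 (r%:R : R); have : 0 <= L * r%:R by rewrite mulr_ge0//; lra.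
have : 2 * L <= L ^+ 2 by rewrite expr2 ler_wpM2r//; lra.
rewrite sqrrD; lra.
Qed.

End SizeBounds.

(** * One step of the algorithm on a fixed matrix *)

Section StepBound.
Local Open Scope ereal_scope.
Context (R : realType) (dd : measure_display) (T : measurableType dd).
Variable P : probability T R.
Variables (I : finType) (X : I -> {RV P >-> R}) (D0 : {set I}) (K : R).
Hypothesis indepX : mutually_independent P D0 X.
Hypothesis hK : (1 <= K)%R.
Hypothesis meanX : forall e, e \in D0 -> 'E_P[X e] = 0.
Hypothesis varX : forall e, e \in D0 -> 'V_P[X e] = 1.
Hypothesis psi2X : forall e, e \in D0 -> subgaussian_norm P (X e) <= K%:E.

Variables (d l : nat) (m : 'I_d -> nat) (e : 'I_l -> forall j : 'I_d, 'I_(m j) -> I).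
Variable s : seq 'I_d.
Hypothesis us : uniq s.
Hypothesis einj : forall c j, injective (e c (j := j)).
Hypothesis edisj : forall c c' j j' b b',
  e c (j := j) b = e c' (j := j') b' -> c = c' /\ j = j'.
Hypothesis eD0 : forall c j b, j \in s -> e c (j := j) b \in D0.

Definition krp_mx (w : T) : 'M[R]_(kdim m s, l) :=
  \matrix_(k, c) kcol (fun j b => X (e c (j := j) b) w) s k.

Lemma sum_kquad_sqn p (B : 'M[R]_(p, kdim m s)) w :
  sum_kquad X e (fun a k => B a k) w = sqn (B *m krp_mx w).
Proof.
rewrite /sum_kquad /kquad exchange_big; apply: eq_bigr => a _; apply: eq_bigr => c _.
by rewrite mxE; congr (_ ^+ 2)%R; apply: eq_bigr => k _; rewrite mxE.
Qed.

Local Notation C1 := (9 * expR 1 * moment_cst K)%R.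

(** The exceptional set collects three failures: the residual is inflated, V Om is too large in
    norm, or some grid vector is shortened too much. Exhibiting a measurable set that contains them
    avoids treating the existence of [Z] as an event. *)
Lemma sketch_succeeds p (r k : nat) (L Lr tau : R) (G : 'M[R]_(p, kdim m s))
    (H : 'M[R]_(p, k)) (F : 'M[R]_(k, kdim m s)) :
  (2 <= L)%R -> (L + r%:R <= Lr)%R -> (0 < size s)%N ->
  ((C1 ^+ 2) ^+ (size s).+1 * Lr ^+ (size s).+1 <= l%:R)%R ->
  (k <= r)%N -> (sqn (G - H *m F) <= tau)%R ->
  exists U : set T, [/\ measurable U, P U <= (2 * expR (- L))%:E &
    forall w, ~ U w -> exists Z : 'M[R]_(l, kdim m s),
      (sqn (G - G *m krp_mx w *m Z) <=
       (1 + 2 * (1 + C1 ^+ (size s).+1 *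
          Num.max (Num.sqrt L / Num.sqrt l%:R) (L ^+ (size s).+1 / l%:R))) * tau)%R].
Proof.
move=> L2 LLr s0 hsize kr HF.
set g := (C1 ^+ (size s).+1 * _)%R.
have c1 : (1 <= moment_cst K)%R := moment_cst_ge1 hK.
have d2 : (2 <= (size s).+1)%N by rewrite ltnS.
have l0 : (0 < l)%N by rewrite -(ltr0n R); exact: (size_pos c1 L2 LLr hsize).
have g1 : (g <= 1)%R := deviation_le1 c1 L2 LLr d2 hsize.
have g0 : (0 <= g)%R.
  have C0 : (0 <= C1)%R.
    by apply: mulr_ge0; [rewrite mulr_ge0 ?expR_ge0|exact: le_trans ler01 c1].
  by rewrite mulr_ge0 ?exprn_ge0// le_max divr_ge0 ?sqrtr_ge0.
have [t [V [tk VV FV]]] := gram_schmidt F.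
have tr : (t <= r)%N := leq_trans tk kr.
pose G2 := (G - G *m V^T *m V)%R.
have G2tau : (sqn G2 <= tau)%R.
  apply: le_trans HF.
  (* Since [F *m V^T *m V = F], subtracting [H *m F] from [G] does not change what the projection
     leaves over. *)
  have -> : G2 = (G - H *m F - (G - H *m F) *m V^T *m V)%R.
    by rewrite !mulmxBl -(mulmxA H) -(mulmxA H) FV /G2 opprB addrA subrK.
  by rewrite sqn_projr// gerBl sqn_ge0.
have sqnV : sqn V = t%:R by rewrite sqn_trl VV mxtrace1.
have tails (M : finType) (B : M -> 'I_(kdim m s) -> R) :
    P [set w | ((1 + g) * (l%:R * \sum_a \sum_k B a k ^+ 2) < sum_kquad X e B w)%R] <=
      (expR (- L) / 2)%:E.
  exact: (kquad_upper indepX hK meanX varX psi2X us einj edisj eD0 B L2 s0 l0 (lexx _)).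
have lows (M : finType) (B : M -> 'I_(kdim m s) -> R) :
    P [set w | (sum_kquad X e B w < 3 / 4 * l%:R * \sum_a \sum_k B a k ^+ 2)%R] <=
      (expR (- (l%:R / (128 * ((moment_cst K * 2) ^+ size s) ^+ 2))))%:E.
  exact: (kquad_lower indepX hK meanX varX psi2X us einj edisj eD0 B).
pose A1 := [set w | ((1 + g) * (l%:R * sqn G2) < sum_kquad X e (fun a k => G2 a k) w)%R].
(* Outside this event, [g <= 1] gives the crude norm bound 2 l t needed by [grid_lower_bound]. *)
pose A2 := [set w | ((1 + g) * (l%:R * sqn V) < sum_kquad X e (fun a k => V a k) w)%R].
pose n := (20 * t)%N.
pose A3 (f : {ffun 'I_t -> 'I_(2 * n).+1}) := [set w |
  (sum_kquad X e (fun a k => (grid_point R f *m V) a k) w <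
   3 / 4 * l%:R * sqn (grid_point R f *m V))%R].
have mU q (B : 'M[R]_(q, kdim m s)) c :
    measurable [set w | (c < sum_kquad X e (fun a k => B a k) w)%R].
  rewrite (_ : [set w | _] = (sum_kquad X e (fun a k => B a k)) @^-1` `]c, +oo[).
    by rewrite -[_ @^-1` _]setTI; exact: measurable_sum_kquad.
  by apply/seteqP; split => w /=; rewrite in_itv/= andbT.
have mA3 f : measurable (A3 f).
  rewrite (_ : A3 f = (sum_kquad X e (fun a k => (grid_point R f *m V) a k))
     @^-1` `]-oo, (3 / 4 * l%:R * sqn (grid_point R f *m V))%R[).
    by rewrite -[_ @^-1` _]setTI; exact: measurable_sum_kquad.
  by apply/seteqP; split => w /=; rewrite in_itv/=.
pose A3U := \bigcup_(f in [set: {ffun 'I_t -> 'I_(2 * n).+1}]) A3 f.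
have mA3U : measurable A3U by apply: fin_bigcup_measurable => // f _; exact: mA3.
have PA3U : P A3U <= (expR (- L) / 4)%:E.
  apply: (le_trans (probability_le_sum P mA3 mA3U _)).
    by move=> w [f _ fw]; exists f.
  apply: (@le_trans _ _ (\sum_(f : {ffun 'I_t -> 'I_(2 * n).+1})
     (expR (- (l%:R / (128 * ((moment_cst K * 2) ^+ size s) ^+ 2))))%:E)).
    by apply: lee_sum => f _; exact: lows.
  rewrite sumEFin sumr_const card_ffun !card_ord lee_fin -[leLHS]mulr_natl.
  exact: (net_union_bound c1 L2 LLr d2 hsize tr).
exists (A1 `|` A2 `|` A3U); split.
- by apply: measurableU => //; apply: measurableU; exact: mU.
- apply: le_trans (measureU2 _ _ _) _ => //; first by apply: measurableU; exact: mU.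
  apply: (@le_trans _ _ ((expR (- L) / 2)%:E + (expR (- L) / 2)%:E + (expR (- L) / 4)%:E)).
    apply: leeD => //; apply: le_trans (measureU2 _ _ _) _; try exact: mU.
    by apply: leeD; exact: tails.
  by rewrite -!EFinD lee_fin; have := expR_ge0 (- L); lra.
- move=> w /not_orP[/not_orP[nA1 nA2] nA3].
  apply: (@sketch_bound R p _ l t G V (krp_mx w) tau (1 + g)%R l0 _ VV G2tau).
  + by rewrite addr_ge0.
  + move=> u; rewrite -[(u *m V *m _)%R]mulmxA; apply: grid_lower_bound => //.
      rewrite -sum_kquad_sqn leNgt; apply/negP => h; apply: nA2; apply: le_lt_trans h.
      by rewrite sqnV ler_wpM2r ?mulr_ge0//; lra.
    move=> f; rewrite leNgt; apply/negP => h; apply: nA3; exists f => //.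
    rewrite /A3/= sum_kquad_sqn -mulmxA (_ : sqn (grid_point R f *m V) = sqn (grid_point R f))//.
    by rewrite !sqn_trl trmx_mul -mulmxA (mulmxA V) VV mul1mx.
  + by rewrite -sum_kquad_sqn leNgt; apply/negP => h; apply: nA1.
Qed.

End StepBound.

(** * Runs of the algorithm *)

Lemma size_others d (i : 'I_d) : (size (others i)).+1 = d.
Proof.
have d0 : (0 < d)%N by apply: leq_ltn_trans (ltn_ord i).
have -> : others i = rem i (enum 'I_d) by rewrite rem_filter ?enum_uniq.
by rewrite size_rem ?mem_enum// size_enum_ord prednK.
Qed.

(** Lets an infimum over real matrices be tested on the countably many rational ones. *)
Lemma sqn_rat_approx (R : realType) p q l (A : 'M[R]_(p, q)) (N : 'M[R]_(p, l))
    (Z : 'M[R]_(l, q)) (eps : R) : 0 < eps ->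
  exists Z' : 'M[rat]_(l, q), sqn (A - N *m map_mx ratr Z') < sqn (A - N *m Z) + eps.
Proof.
move=> eps0; set A0 := A - N *m Z.
(* [eta] and [kap] allot half of [eps] each to the excess of Young's inequality over [sqn A0] and to
   the perturbation [N *m D]. The added 1 keeps the denominators positive. *)
pose eta := eps / (2 * (sqn A0 + 1)).
have sA0 := sqn_ge0 A0; have sN0 := sqn_ge0 N.
have eta0 : 0 < eta by rewrite divr_gt0// mulr_gt0//; lra.
have etaA : eta * sqn A0 < eps / 2.
  have p0 : 0 < 2 * (sqn A0 + 1) by lra.
  by rewrite /eta mulrAC ltr_pdivrMr//; lra.
pose c := (1 + eta^-1) * sqn N * (l * q)%:R + 1.
have c0 : 0 < c by rewrite ltr_wpDl// mulr_ge0// mulr_ge0// addr_ge0// invr_ge0 ltW.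
pose kap := Num.sqrt (eps / (2 * c)).
have ec0 : 0 < eps / (2 * c) by rewrite divr_gt0// mulr_gt0.
have kap0 : 0 < kap by rewrite sqrtr_gt0.
have close a b : exists r : rat, (ratr r - Z a b) ^+ 2 <= kap ^+ 2.
  have [r] := @rat_in_itvoo R (Z a b - kap) (Z a b + kap) ltac:(lra).
  rewrite in_itv /= => /andP[r1 r2]; exists r.
  by rewrite -[leLHS]real_normK ?num_real// lerXn2r ?nnegrE ?(ltW kap0)// ler_norml; lra.
have /choice[z zP] (ab : 'I_l * 'I_q) := close ab.1 ab.2.
exists (\matrix_(a, b) z (a, b)).
pose D := map_mx ratr (\matrix_(a, b) z (a, b)) - Z.
have -> : A - N *m map_mx ratr (\matrix_(a, b) z (a, b)) = A0 - N *m D.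
  by rewrite /A0 /D mulmxBr opprB addrA subrK.
have sD : sqn D <= (l * q)%:R * kap ^+ 2.
  apply: (@le_trans _ _ (\sum_(a < l) \sum_(b < q) kap ^+ 2)).
    by apply: ler_sum => a _; apply: ler_sum => b _; rewrite !mxE; exact: (zP (a, b)).
  rewrite !sumr_const !card_ord -mulrnA mulnC -[leLHS]mulr_natl lexx//.
have young (A1 B1 : 'M[R]_(p, q)) :
    sqn (A1 - B1) <= (1 + eta) * sqn A1 + (1 + eta^-1) * sqn B1.
  rewrite /sqn !mulr_sumr -big_split; apply: ler_sum => a _ /=.
  rewrite !mulr_sumr -big_split; apply: ler_sum => b _ /=; rewrite !mxE.
  rewrite -subr_ge0 (_ : _ - _ = eta^-1 * (eta * A1 a b + B1 a b) ^+ 2).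
    by rewrite mulr_ge0 ?sqr_ge0// invr_ge0 ltW.
  by field; rewrite gt_eqF.
have := young A0 (N *m D).
have sND : (1 + eta^-1) * sqn (N *m D) <= c * kap ^+ 2.
  have e1 : 0 <= 1 + eta^-1 by rewrite addr_ge0// invr_ge0 ltW.
  apply: (@le_trans _ _ ((1 + eta^-1) * (sqn N * ((l * q)%:R * kap ^+ 2)))).
    by rewrite ler_wpM2l//; apply: le_trans (sqn_mulmx _ _) _; rewrite ler_wpM2l.
  rewrite (_ : _ * (_ * _) = (c - 1) * kap ^+ 2); last by rewrite /c; ring.
  by rewrite ler_wpM2r ?sqr_ge0//; lra.
have ck : c * kap ^+ 2 = eps / 2.
  by rewrite sqr_sqrtr ?(ltW ec0)//; field; rewrite gt_eqF.
move=> Y; lra.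
Qed.

Lemma measurable_core (R : realType) (d : nat) (n ell : 'I_d -> nat) dd
    (T : measurableType dd) (X : tensor R n)
    (Q : T -> factors R n ell) (i : nat) :
  (forall k : 'I_d, (k < i)%N -> forall a b, measurable_fun setT (fun w => Q w k a b)) ->
  forall k (kd : (k <= d)%N), (k <= i)%N -> forall y,
    measurable_fun setT (fun w => core X (Q w) kd y).
Proof.
move=> mQ; elim=> [|k ih] kd ki y /=; first exact: measurable_cst.
under eq_fun do rewrite modeprodE big_mkcond/=.
apply: measurable_sum => x; case: (same_off _ x y); last exact: measurable_cst.
apply: measurable_funM; last by apply: ih; exact: ltnW.
by under eq_fun do rewrite mxE; apply: mQ.
Qed.

Lemma measurable_unfold (R : realType) (d : nat) (n : 'I_d -> nat) dd
    (T : measurableType dd) (X : T -> tensor R n) i a c :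
  (forall y, measurable_fun setT (fun w => X w y)) ->
  measurable_fun setT (fun w => unfold i (X w) a c).
Proof.
move=> mX; have [x [<- <-]] := mode_splitP a c.
by under eq_fun do rewrite unfoldE; exact: mX.
Qed.

Lemma measurable_mulmx (R : realType) dd (T : measurableType dd) p q r
    (A : T -> 'M[R]_(p, q)) (B : T -> 'M[R]_(q, r)) :
  (forall a b, measurable_fun setT (fun w => A w a b)) ->
  (forall a b, measurable_fun setT (fun w => B w a b)) ->
  forall a b, measurable_fun setT (fun w => (A w *m B w) a b).
Proof.
move=> mA mB a b; under eq_fun do rewrite mxE.
by apply: measurable_sum => k; exact: measurable_funM.
Qed.

Lemma measurable_sqn (R : realType) dd (T : measurableType dd) p q (A : T -> 'M[R]_(p, q)) :
  (forall a b, measurable_fun setT (fun w => A w a b)) ->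
  measurable_fun setT (fun w => sqn (A w)).
Proof.
move=> mA; apply: measurable_sum => a; apply: measurable_sum => b.
exact: (measurable_funX 2 (mA a b)).
Qed.

Section Run.
Local Open Scope ereal_scope.
Context (R : realType) (dd : measure_display) (T : measurableType dd).
Variables (P : probability T R) (d : nat) (n ell : 'I_d -> nat) (K : R).
Variables (X : tensor R n) (omega : draws P n ell).
Variable Q : forall i : 'I_d, T -> 'M[R]_(stage n ell i i, stage n ell i.+1 i).
Hypothesis hK : (1 <= K)%R.
Hypothesis hrun : rsthosvd_krp K X omega Q.
Hypothesis n0 : forall j, (0 < n j)%N.
Hypothesis ell0 : forall j, (0 < ell j)%N.
Hypothesis d2 : (2 <= d)%N.

Let Qw w : factors R n ell := fun i => Q i w.

Definition entry_rv (e : entry n ell) : {RV P >-> R} :=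
  @omega (tag e).1 (tag e).2 (tagged e).1 (tagged e).2.

Lemma factor_orth w i : (Q i w)^T *m Q i w = 1%:M.
Proof. by have [S []] := factors_qr hrun i w. Qed.

Definition past (i : nat) : {set entry n ell} :=
  [set e in drawn n ell | (val (tag e).1 < i)%N]%SET.

Definition current (i : 'I_d) : {set entry n ell} :=
  [set e in drawn n ell | (tag e).1 == i]%SET.

Lemma measurable_factor_past (i : nat) (k : 'I_d) a b : (k < i)%N ->
  measurable_fun setT ((fun w => Q k w a b) : sub_space entry_rv (past i) -> R).
Proof.
move=> ki _ B mB; rewrite setTI; have := factors_meas hrun a b mB.
apply: smallest_sub; first exact: sigma_algebra_measurable.
move=> _ [e [ed ek [B' mB' ->]]].
rewrite -[_ @^-1` _]setTI; apply: (draw_measurable_sub (X := entry_rv) (D := past i)) => //.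
by rewrite !inE in ed *; rewrite ed/= (leq_ltn_trans ek).
Qed.

Lemma measurable_step_error (i : 'I_d) :
  measurable_fun setT (fun w => step_error X (Qw w) i).
Proof.
have mQ (k : 'I_d) a b : measurable_fun setT (fun w => Q k w a b).
  by apply: (@sub_space_fun _ _ _ _ _ entry_rv (past d)); apply: measurable_factor_past.
have mU a c : measurable_fun setT
    (fun w => unfold i (core X (Qw w) (ltnW (ltn_ord i))) a c).
  apply: measurable_unfold => y.
  by apply: (@measurable_core _ _ _ _ _ _ _ _ i) => // k _ a' b'; exact: mQ.
rewrite /step_error; apply: measurable_funB; first exact: measurable_sqn.
apply: measurable_sqn; apply: measurable_mulmx => // a b.
by under eq_fun do rewrite mxE; exact: mQ.
Qed.

Section Step.
Variable i : 'I_d.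
Let U w := unfold i (core X (Qw w) (ltnW (ltn_ord i))).
Let Om w := krps (fun j => draw_mx omega i j w) (others i).

Definition step_entry (c : 'I_(ell i)) (j : 'I_d) (b : 'I_(stage n ell i j)) : entry n ell :=
  Tagged (fun ij : 'I_d * 'I_d => ('I_(stage n ell ij.1 ij.2) * 'I_(ell ij.1))%type)
    (i := (i, j)) (b, c).

Lemma step_entry_inj c j : injective (step_entry c (j := j)).
Proof.
move=> b b' /(congr1 (fun e : entry n ell => val (tagged e).1)) /= bb.
exact: val_inj.
Qed.

Lemma step_entry_disj c c' j j' (b : 'I_(stage n ell i j)) (b' : 'I_(stage n ell i j')) :
  step_entry c b = step_entry c' b' -> c = c' /\ j = j'.
Proof.
move=> E; split; last by have := congr1 (fun e : entry n ell => (tag e).2) E.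
by apply: val_inj; have := congr1 (fun e : entry n ell => val (tagged e).2) E.
Qed.

Lemma step_entry_drawn c j (b : 'I_(stage n ell i j)) : j \in others i ->
  step_entry c b \in current i.
Proof. by rewrite mem_filter => /andP[ji _]; rewrite !inE /= ji eqxx. Qed.

Lemma krps_krp_mx w : Om w = krp_mx entry_rv step_entry (others i) w.
Proof.
apply/matrixP => k c; rewrite /Om krps_kcol mxE.
have E (s : seq 'I_d) (k' : 'I_(kdim (stage n ell i) s)) :
    kcol (fun j b => draw_mx omega i j w b c) s k' =
    kcol (fun j b => entry_rv (step_entry c b) w) s k'.
  by elim: s k' => //= j s ih k'; rewrite ih mxE.
exact: E.
Qed.

Lemma step_error_le w Z : (step_error X (Qw w) i <= sqn (U w - U w *m Om w *m Z))%R.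
Proof.
have [S [_ QQ _ YE]] := factors_qr hrun i w.
exact: (range_finder_error Z QQ YE).
Qed.

Let D1 := past i.
Let D2 := current i.

Let mU a c : measurable_fun setT ((fun w => U w a c) : sub_space entry_rv D1 -> R).
Proof.
apply: measurable_unfold => y.
apply: (@measurable_core _ _ _ _ _ (sub_space entry_rv D1) X Qw i) => // k ki a' b'.
exact: measurable_factor_past.
Qed.

Let mOm a c : measurable_fun setT ((fun w => Om w a c) : sub_space entry_rv D2 -> R).
Proof.
have -> : (fun w => Om w a c) =
    (fun w => kcol (fun j b => entry_rv (step_entry c (j := j) b) w) (others i) a).
  by apply/funext => w; rewrite krps_krp_mx mxE.
apply: (@sub_space_funS _ _ _ _ _ entry_rv (mode_entries (step_entry c) (others i)) D2).
  by apply/fintype.subsetP => x /mode_entriesP[j jo [b ->]]; exact: step_entry_drawn.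
exact: measurable_kcol.
Qed.

(* [b < step_error] forces |U - U Om Z|^2 > b for all Z; restricting to rational Z makes this
   a measurable event of the pair (past draws, current draws). *)
Lemma step_error_tail (b eps : R) :
  (forall G : 'M[R]_(stage n ell i i, kdim (stage n ell i) (others i)), forall w,
     G = U w -> exists V : set T, [/\ measurable V, P V <= eps%:E &
     forall w', ~ V w' -> exists Z, (sqn (G - G *m Om w' *m Z) <= b)%R]) ->
  P [set w | (b < step_error X (Qw w) i)%R] <= eps%:E.
Proof.
move=> HV.
pose Phi (Z : 'M[rat]_(ell i, kdim (stage n ell i) (others i))) (z : T * T) :=
  sqn (U z.1 - U z.1 *m Om z.2 *m map_mx ratr Z).
(* [pickle] numbers the rational matrices; a number that codes none gives the full set, neutral in
   the intersection. The margin [q.+1%:R^-1] stands for the strict inequality and pays for the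
   rational approximation. *)
pose S (q k : nat) : set (T * T) :=
  if unpickle k is Some Z then [set z | (b + q.+1%:R^-1 <= Phi Z z)%R] else setT.
pose E : set (T * T) := \bigcup_q \bigcap_k S q k.
have mE : measurable (E : set (sub_space entry_rv D1 * sub_space entry_rv D2)).
  apply: bigcupT_measurable => q; apply: bigcapT_measurable => k.
  rewrite /S; case: unpickle => [Z|]; last exact: measurableT.
  have mUz a c : measurable_fun setT
      ((fun z => U z.1 a c) : sub_space entry_rv D1 * sub_space entry_rv D2 -> R).
    exact: (measurable_fst_sub (D2 := D2) (mU a c)).
  have mPhi : measurable_fun setT
      (Phi Z : sub_space entry_rv D1 * sub_space entry_rv D2 -> R).
    apply: (@measurable_sqn _ _ (sub_space entry_rv D1 * sub_space entry_rv D2)%type) => a c.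
    under eq_fun do rewrite mxE; apply: measurable_funD => //.
    under eq_fun do rewrite mxE; apply: measurableT_comp => //.
    apply: (@measurable_mulmx _ _ (sub_space entry_rv D1 * sub_space entry_rv D2)%type) => //.
    apply: (@measurable_mulmx _ _ (sub_space entry_rv D1 * sub_space entry_rv D2)%type) => //.
    by move=> a' c'; exact: (measurable_snd_sub (D1 := D1) (mOm a' c')).
  rewrite (_ : [set z | _] = Phi Z @^-1` `[(b + q.+1%:R^-1)%R, +oo[).
    by rewrite -[_ @^-1` _]setTI; exact: mPhi.
  by apply/seteqP; split => z /=; rewrite in_itv/= andbT.
pose A := [set w | (b < step_error X (Qw w) i)%R].
have mA : measurable A.
  rewrite (_ : A = (fun w => step_error X (Qw w) i) @^-1` `]b, +oo[).
    by rewrite -[_ @^-1` _]setTI; exact: measurable_step_error.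
  by apply/seteqP; split => w /=; rewrite in_itv/= andbT.
have mEi : measurable_fun setT
    ((fun z => (\1_E z)%:E) : sub_space entry_rv D1 * sub_space entry_rv D2 -> \bar R).
  apply/measurable_EFinP.
  exact: (@measurable_indic _ (sub_space entry_rv D1 * sub_space entry_rv D2)%type).
have AE w : A w -> E (w, w).
  move=> Aw; have d0 : (0 < step_error X (Qw w) i - b)%R by rewrite subr_gt0.
  have [q _ qb] := near_infty_natSinv_lt (PosNum d0).
  exists q => // k _; rewrite /S; case: unpickle => // Z /=.
  apply: le_trans (step_error_le _ _).
  have qb' : (q.+1%:R^-1 < step_error X (Qw w) i - b)%R := qb q (leqnn q).
  by rewrite addrC -lerBrDr ltW.
apply: (@le_trans _ _ (\int[P]_w (\1_E (w, w))%:E)).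
  apply: probability_le_integral => //.
  - by move=> w /AE; rewrite indicE => /mem_set ->.
  - have mEd := measurableT_comp mEi (@diag_sub_measurable _ _ _ P _ entry_rv D1 D2).
    exact/measurable_EFinP.
have sub1 : D1 \subset drawn n ell by apply/fintype.subsetP => x; rewrite inE => /andP[].
have sub2 : D2 \subset drawn n ell by apply/fintype.subsetP => x; rewrite inE => /andP[].
have dis : [disjoint D1 & D2]%B.
  rewrite -setI_eq0; apply/eqP/finset.setP => x; rewrite !inE.
  apply/negP => /andP[/andP[_ xi] /andP[_ /eqP xi']].
  by rewrite xi' ltnn in xi.
(* From here the current draws are integrated separately, with [U w] fixed. *)
rewrite (decouple (X := entry_rv) (F := fun z => (\1_E z)%:E) (draws_indep hrun) sub1 sub2 dis _ mEi); last first.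
  by move=> z; rewrite lee_fin.
apply: (@le_trans _ _ (\int[P]_w eps%:E)); last by rewrite integral_prob_cst.
apply: ge0_le_integral => //.
- by move=> w _; apply: integral_ge0 => w' _; rewrite lee_fin.
- by apply: (measurable_partial_integral _ mEi) => z; rewrite lee_fin.
move=> w _; have [V [mV PV VZ]] := HV (U w) w erefl.
apply: le_trans PV; rewrite -[V]setIT -integral_indic//.
apply: ge0_le_integral_EFin => [w'|w'||].
- by [].
- rewrite !indicE; have [Vw|nVw] := pselect (V w'); first by rewrite (mem_set Vw); case: (_ \in _).
  (* Outside [V] some real [Z] achieves [b], and a rational one comes within the margin, which
     contradicts membership in [E]. *)
  rewrite memNset// => -[q _ Sq]; have [Z HZ] := VZ w' nVw.
  have q0 : (0 < q.+1%:R^-1 :> R)%R by rewrite invr_gt0.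
  have [Z' HZ'] := sqn_rat_approx (U w) (U w *m Om w') Z q0.
  have := Sq (pickle Z') I; rewrite /S pickleK /Phi/= leNgt => /negP; apply.
  by apply: lt_le_trans HZ' _; rewrite lerD2r.
- have := measurableT_comp mEi (@measurable_pair1 _ _ (sub_space entry_rv D1) (sub_space entry_rv D2) w).
  move=> /measurable_EFinP; exact: sub_space_fun.
- exact: measurable_indic.
Qed.

Local Notation C1 := (9 * expR 1 * moment_cst K)%R.

(** The low-rank factorization is that of the unfolding of [X], carried to the core by the
    contraction [Kr]; this is why [tau] is deterministic although the core is random. *)
Lemma step_error_tail_bound (r : nat) (L Lr g : R) : (r <= n i)%N ->
  (2 <= L)%R -> (L + r%:R <= Lr)%R -> ((C1 ^+ 2) ^+ d * Lr ^+ d <= (ell i)%:R)%R ->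
  g = (C1 ^+ d * Num.max (Num.sqrt L / Num.sqrt (ell i)%:R) (L ^+ d / (ell i)%:R))%R ->
  P [set w | ((1 + 2 * (1 + g)) * (\sum_(r.+1 <= j < (n i).+1) singular_value (unfold i X) j ^+ 2)
     < step_error X (Qw w) i)%R] <= (2 * expR (- L))%:E.
Proof.
move=> rn L2 LLr hsize gE; set tau := (\sum_(_ <= _ < _) _)%R.
apply: step_error_tail => G w ->.
have [Kr [Kr_contr [e UE]]] := core_unfolding i n0 ell0 (factor_orth w).
have [k [H [F [kr HF]]]] := eckart_young (unfold i X) rn.
pose H' := castmx (e, erefl) H.
have UHF : (sqn (U w - H' *m (F *m Kr)) <= tau)%R.
  apply: le_trans HF; apply: le_trans (Kr_contr _).
  rewrite /U UE /H' mulmxBl -[(H *m F *m Kr)%R]mulmxA.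
  by move: (e); move: (stage n ell i i) => ni e'; case: ni / e'; rewrite !castmx_id.
have sd : (size (others i)).+1 = d := size_others i.
have s0 : (0 < size (others i))%N by rewrite -ltnS sd.
have hsize' : ((C1 ^+ 2) ^+ (size (others i)).+1 * Lr ^+ (size (others i)).+1 <= (ell i)%:R)%R.
  by rewrite sd.
have uo : uniq (others i) by rewrite filter_uniq// enum_uniq.
have drawnE j c (b : 'I_(stage n ell i j)) : j \in others i -> step_entry c b \in drawn n ell.
  by move=> /(step_entry_drawn c b); rewrite inE => /andP[].
have [V [mV PV VZ]] := sketch_succeeds (X := entry_rv) (draws_indep hrun) hK (draws_mean hrun)
  (draws_var hrun) (draws_subgaussian hrun) uo step_entry_inj step_entry_disj
  (fun c j b => drawnE j c b) L2 LLr s0 hsize' kr UHF.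
exists V; split => // w' /VZ[Z HZ]; exists Z.
by rewrite krps_krp_mx gE; move: HZ; rewrite sd.
Qed.

End Step.

Lemma fnorm_error_event (tau : 'I_d -> R) (delta : R) :
  (forall i, P [set w | (tau i < step_error X (Qw w) i)%R] <= (delta / d%:R)%:E) ->
  (1 - delta)%:E <= P [set w |
    (fnorm (X - sthosvd_approx X (fun i => Q i w)) ^+ 2 <= \sum_(i < d) tau i)%R].
Proof.
move=> Ptau; set A := [set w | _].
have d0 : (0 < d%:R :> R)%R by rewrite ltr0n (leq_trans _ d2).
have AE : A = [set w | (\sum_(i < d) step_error X (Qw w) i <= \sum_(i < d) tau i)%R].
  apply/seteqP; split => w; rewrite /A /= -(sthosvd_error X (factor_orth w))//.
have mA : measurable A.
  rewrite AE (_ : [set w | _] = (fun w => \sum_(i < d) step_error X (Qw w) i)%R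
      @^-1` `]-oo, (\sum_(i < d) tau i)%R]).
    rewrite -[_ @^-1` _]setTI.
    by apply: measurable_sum => // i; exact: measurable_step_error.
  by apply/seteqP; split => w /=; rewrite in_itv.
have mB i : measurable [set w | (tau i < step_error X (Qw w) i)%R].
  rewrite (_ : [set w | _] = (fun w => step_error X (Qw w) i) @^-1` `]tau i, +oo[).
    by rewrite -[_ @^-1` _]setTI; exact: measurable_step_error.
  by apply/seteqP; split => w /=; rewrite in_itv/= andbT.
have PAC : P (~` A) <= delta%:E.
  apply: (le_trans (probability_le_sum P mB (measurableC mA) _)).
    move=> w nA; have : ~ (\sum_(i < d) step_error X (Qw w) i <= \sum_(i < d) tau i)%R.
      by rewrite AE in nA.
    move=> nle; apply: contrapT => /forallNP H; apply: nle.
    by apply: ler_sum => i _; rewrite leNgt; apply/negP; exact: H.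
  apply: (@le_trans _ _ (\sum_(i < d) (delta / d%:R)%:E)); first exact: lee_sum.
  rewrite sumEFin sumr_const card_ord -[X in X%:E]mulr_natl lee_fin.
  by rewrite mulrCA divff ?mulr1// gt_eqF.
rewrite probability_setC// in PAC.
have Pfin : P A \is a fin_num by exact: fin_num_measure.
move: PAC; rewrite -(fineK Pfin) -EFinB !lee_fin; lra.
Qed.

End Run.

Theorem theorem5p2 (R : realType) (K : R) (hK : 1 <= K) :
  exists C C' : nat -> R,
    (forall i, 0 < C i) /\ (forall i, 0 < C' i) /\
    forall (d : nat) (hd : (2 <= d)%N) (n : 'I_d -> nat) (X : tensor R n)
      (r : 'I_d -> nat) (hr : forall i, (1 <= r i <= n i)%N) (p : nat)
      (ell : 'I_d -> nat) (hell : forall i, ell i = (r i + p)%N)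
      (dd : measure_display) (T : measurableType dd) (P : probability T R)
      (omega : draws P n ell)
      (Q : forall i : 'I_d, T -> 'M[R]_(stage n ell i i, stage n ell i.+1 i))
      (hrun : rsthosvd_krp K X omega Q)
      (delta : R) (hdelta0 : 0 < delta)
      (hdelta : delta <= Num.min 1 (2 * d%:R * expR (- 2)))
      (hsize : forall i : 'I_d,
        C i ^+ d * ln (2 * d%:R * 9 ^+ r i / delta) ^+ d <= (ell i)%:R),
    let Gamma (i : 'I_d) :=
      C' i ^+ d * Num.max
        (Num.sqrt (ln (2 * d%:R / delta)) / Num.sqrt (ell i)%:R)
        (ln (2 * d%:R / delta) ^+ d / (ell i)%:R) in
    ((1 - delta)%:E <= P [set w |
       (fnorm (X - sthosvd_approx X (fun i => Q i w)) ^+ 2 <=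
        \sum_(i < d) (1 + 2 * (1 + Gamma i)) *
          \sum_((r i).+1 <= j < (n i).+1) singular_value (unfold i X) j ^+ 2)%R])%E.
Proof.
pose C1 : R := 9 * expR 1 * moment_cst K.
have C1_gt0 : 0 < C1.
  apply: mulr_gt0; last exact: lt_le_trans ltr01 (moment_cst_ge1 hK).
  by rewrite mulr_gt0 ?expR_gt0.
(* Both sequences are constant: [C1 ^+ 2] is the size constant and [C1] the deviation constant of
   [step_error_tail_bound], and they depend on [K] only. *)
exists (fun=> C1 ^+ 2), (fun=> C1); split; first by move=> _; rewrite exprn_gt0.
split=> // d hd n X r hr p ell hell dd T P omega Q hrun delta delta0 hdelta hsize.
cbv zeta.
have n0 j : (0 < n j)%N by have /andP[r1 rn] := hr j; exact: leq_trans rn.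
have ell0 j : (0 < ell j)%N by have /andP[r1 _] := hr j; rewrite hell addn_gt0 r1.
have d0 : 0 < d%:R :> R by rewrite ltr0n (leq_trans _ hd).
have dd0 : 0 < 2 * d%:R / delta by rewrite divr_gt0// mulr_gt0.
pose L := ln (2 * d%:R / delta).
(* This is the assumption delta <= 2 d exp (-2), rewritten. *)
have L2 : 2 <= L.
  rewrite -(expRK 2) ler_ln ?posrE ?expR_gt0// ler_pdivlMr//.
  move: hdelta; rewrite le_min => /andP[_]; rewrite expRN ler_pdivlMr ?expR_gt0//.
  by rewrite mulrC.
(* The failure probability of one step is an equal share of [delta]. *)
have expL : 2 * expR (- L) = delta / d%:R.
  by rewrite expRN lnK ?posrE//; field; rewrite !gt_eqF.
apply: (fnorm_error_event hrun hd) => i; rewrite -expL.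
have /andP[_ rn] := hr i.
apply: (step_error_tail_bound hK hrun n0 ell0 hd rn L2 _ (hsize i) erefl).
(* The logarithm of the size condition is L + r ln 9, and ln 9 >= 1 because e <= 4. *)
rewrite /L [X in _ <= ln X]mulrAC [leRHS]lnM ?posrE ?exprn_gt0// lerD2l lnXn//.
rewrite lerMn2r; apply/orP; right.
rewrite -[leLHS](expRK 1) ler_ln ?posrE ?expR_gt0//.
by apply: le_trans (expR1_le4 R) _; rewrite ler_nat.
Qed.
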